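(* Let $e\ge2$ be an integer. Under the Poissonised Plancherel measure $\mathrm{pl}_t$, as $t\to+\infty$ the expected size of the $e$-core $\overline\lambda$ of $\lambda$ satisfies $$\mathbb{E}_t|\overline{\lambda}|\sim\frac{2\sqrt t}{\pi}\cot\frac{\pi}{2e}.$$
   Context: A partition is a finite non-increasing sequence $\lambda=(\lambda_1\ge\dots\ge\lambda_h>0)$ of positive integers (possibly empty), with size $|\lambda|=\sum_a\lambda_a$; $\mathcal{P}$ is the set of all partitions. Its Young diagram is $\mathcal{Y}(\lambda)=\{(a,b)\in\mathbb{Z}_{\ge1}^2: 1\le a\le h,\ 1\le b\le\lambda_a\}$, and $\mathrm{Std}(\lambda)$ is the set of standard Young tableaux of shape $\lambda$ (bijections $\mathcal{Y}(\lambda)\to\{1,\dots,|\lambda|\}$ increasing along rows and down columns). For $t>0$, the Poissonised Plancherel measure is the probability measure on $\mathcal{P}$ given by $\mathrm{pl}_t(\lambda)=\exp(-t)\,t^{|\lambda|}\left(\frac{\#\mathrm{Std}(\lambda)}{|\lambda|!}\right)^2$; $\mathbb{E}_t$ is the expectation when $\lambda$ is distributed according to $\mathrm{pl}_t$. For $(a,b)\in\mathcal{Y}(\lambda)$ the rim hook at $(a,b)$ is $r_{(a,b)}=\{(a',b')\in\mathcal{Y}(\lambda): a'\ge a,\ b'\ge b,\ (a'+1,b'+1)\notin\mathcal{Y}(\lambda)\}$; it is an $e$-rim hook if it has exactly $e$ elements. Removing a rim hook from $\mathcal{Y}(\lambda)$ gives the Young diagram of a partition. Starting from $\lambda$ and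 repeatedly removing $e$-rim hooks until none is left, one reaches a partition which does not depend on the choices made: it is the $e$-core $\overline\lambda$ of $\lambda$. The symbol $\sim$ means that the ratio of the two sides tends to $1$. *)

(* Defs.v *)
From HB Require Import structures.
From Stdlib Require Import Relations.
From mathcomp Require Import all_boot all_order all_algebra finmap.
From mathcomp Require Import all_classical all_reals all_analysis.
Set Implicit Arguments.
Unset Strict Implicit.
Unset Printing Implicit Defensive.
Import Order.TTheory GRing.Theory Num.Theory numFieldNormedType.Exports.

Definition is_partition (s : seq nat) : bool := sorted geq s && all (leq 1) s.

Record partition := Partition {
  parts :> seq nat;
  partsP : is_partition parts }.
HB.instance Definition _ := [isSub of partition for parts].
HB.instance Definition _ := [Countable of partition by <:].

Definition psize (la : partition) : nat := sumn la.

(* Cells (a, b) are numbered from 1, parts of a sequence from 0. *)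
Definition young (la : partition) : {fset nat * nat} :=
  [fset c | c in [seq (a, b) | a <- iota 1 (size la),
                               b <- iota 1 (nth 0 la a.-1)]]%fset.

Lemma in_young (la : partition) (a b : nat) :
  ((a, b) \in young la) =
  (1 <= a <= size la) && (1 <= b <= nth 0 la a.-1).
Proof.
rewrite !inE; apply/allpairsPdep/idP => [[x [y [+ + [-> ->]]]]|].
  by rewrite !mem_iota !add1n !ltnS => -> ->.
by case/andP=> ha hb; exists a, b; rewrite !mem_iota !add1n !ltnS.
Qed.

(* The entries are 0, ..., |la| - 1 instead of 1, ..., |la|. *)
Definition is_standard (la : partition)
    (T : {ffun young la -> 'I_(psize la)}) : bool :=
  [&& injectiveb T,
      [forall k, exists c, T c == k],
      [forall c, forall d,
        ((val c).1 == (val d).1) && ((val c).2 < (val d).2) ==> (T c < T d)] &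
      [forall c, forall d,
        ((val c).2 == (val d).2) && ((val c).1 < (val d).1) ==> (T c < T d)]].

Definition Std (la : partition) : {set {ffun young la -> 'I_(psize la)}} :=
  [set T | is_standard T]%SET.

Definition rim_hook (la : partition) (c : nat * nat) : {fset nat * nat} :=
  [fset d in young la | [&& c.1 <= d.1, c.2 <= d.2 &
                            (d.1.+1, d.2.+1) \notin young la]]%fset.

Definition is_rim_hook_at (e : nat) (la : partition) (c : nat * nat) : bool :=
  (c \in young la) && (#|` rim_hook la c| == e).

Definition remove_rim_hook (e : nat) (la mu : partition) : Prop :=
  exists2 c, is_rim_hook_at e la c &
             young mu = (young la `\` rim_hook la c)%fset.

Definition is_ecore (e : nat) (la mu : partition) : Prop :=
  clos_refl_trans _ (remove_rim_hook e) la mu /\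
  forall c, ~~ is_rim_hook_at e mu c.

(* The default value la of xget is irrelevant: for 0 < e there is exactly one
   mu such that is_ecore e la mu. *)
Definition ecore (e : nat) (la : partition) : partition :=
  xget la [set mu | is_ecore e la mu]%classic.

Local Open Scope ring_scope.

Definition plancherel (R : realType) (t : R) (la : partition) : R :=
  expR (- t) * t ^+ psize la * (#|Std la|%:R / (psize la)`!%:R) ^+ 2.

(* The expectation of X when la has law plancherel t. For 0 <= t it is a sum of
   non-negative terms (X is nat-valued), hence makes sense in \bar R. *)
Definition plancherel_expectation (R : realType) (t : R)
    (X : partition -> nat) : \bar R :=
  (\esum_(la in [set: partition]) (plancherel t la * (X la)%:R)%:E)%E.

Definition cot (R : realType) (x : R) : R := cos x / sin x.

(* Main.v *)
Require Import Defs.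
From HB Require Import structures.
From Stdlib Require Import Relations.
From mathcomp Require Import all_boot all_order all_algebra finmap.
From mathcomp Require Import all_classical all_reals all_analysis.
From mathcomp Require Import zify ring lra complex.
Require Import Defs.
Set Implicit Arguments.
Unset Strict Implicit.
Unset Printing Implicit Defensive.
Import Order.TTheory GRing.Theory Num.Theory numFieldNormedType.Exports.

(** * PART Alg *)

Local Open Scope ring_scope.

Definition ad (A : pzRingType) (x y : A) : A := x * y - y * x.

Section Ad.
Variable A : pzRingType.
Implicit Types a b x y : A.

Lemma ad0 a : ad a 0 = 0.
Proof. by rewrite /ad mulr0 mul0r subr0. Qed.

Lemma adD a x y : ad a (x + y) = ad a x + ad a y.
Proof. by rewrite /ad mulrDr mulrDl opprD addrACA. Qed.

Lemma adN a x : ad a (- x) = - ad a x.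
Proof. by rewrite /ad mulrN mulNr opprB opprK addrC. Qed.

Lemma ad_anti a x : ad a x = - ad x a.
Proof. by rewrite /ad opprB. Qed.

Lemma ad_sum a (I : Type) (r : seq I) (P : pred I) (F : I -> A) :
  ad a (\sum_(i <- r | P i) F i) = \sum_(i <- r | P i) ad a (F i).
Proof. by apply: (big_morph (ad a) (adD a) (ad0 a)). Qed.

Lemma adMn a x n : ad a (x *+ n) = ad a x *+ n.
Proof.
by elim: n => [|n IH]; rewrite ?mulr0n ?ad0 // !mulrS adD IH.
Qed.

Lemma adM a x y : ad a (x * y) = ad a x * y + x * ad a y.
Proof. by rewrite /ad mulrBl mulrBr !mulrA addrA subrK. Qed.

Lemma ad_ad a x y : ad a (ad x y) = ad (ad a x) y + ad x (ad a y).
Proof.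
have adE u v : ad u v = u * v - v * u by [].
rewrite [ad x y]adE adD adN !adM [ad (ad a x) y]adE [ad x (ad a y)]adE.
by rewrite [RHS]addrACA opprD [in LHS](addrC (- (_ * x))).
Qed.

Lemma ad_comm a b x : GRing.comm a b -> ad a (ad b x) = ad b (ad a x).
Proof. by move=> ab; rewrite ad_ad {2}/ad ab subrr {1}/ad mul0r mulr0 subrr add0r. Qed.

End Ad.

Section Vacuum.
Variables (K : fieldType) (A : algType K) (D U : A) (L : {scalar A}).
Hypothesis DU : ad D U = 1.
Hypothesis LU : forall X, L (U * X) = 0.
Hypothesis LD : forall X, L (X * D) = 0.
Hypothesis L1 : L 1 = 1.

Lemma adZ a (c : K) (x : A) : ad a (c *: x) = c *: ad a x.
Proof. by rewrite /ad -scalerAr -scalerAl scalerBr. Qed.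

Lemma ad_one (a : A) : ad a 1 = 0.
Proof. by rewrite /ad mulr1 mul1r subrr. Qed.

Lemma ad_DU_comm X : ad D (ad U X) = ad U (ad D X).
Proof. by rewrite ad_ad DU /ad mul1r mulr1 subrr add0r. Qed.

Lemma iter_ad_DU_comm m n X :
  iter m (ad D) (iter n (ad U) X) = iter n (ad U) (iter m (ad D) X).
Proof.
elim: m => //= m ->; elim: n => //= n <-; exact: ad_DU_comm.
Qed.

Lemma mulDn_ad n X :
  D ^+ n * X = \sum_(k < n.+1) (iter k (ad D) X * D ^+ (n - k)) *+ 'C(n, k).
Proof.
elim: n => [|n IH].
  by rewrite big_ord_recl big_ord0 /= expr0 mul1r mulr1 addr0.
rewrite exprS -mulrA IH mulr_sumr.
have step Y m : D * (Y * D ^+ m) = ad D Y * D ^+ m + Y * D ^+ m.+1.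
  by rewrite /ad mulrBl !mulrA exprS mulrA subrK.
under eq_bigr => k _ do rewrite mulrnAr step mulrnDl -iterS -subSn ?leq_ord //.
rewrite big_split /= [RHS]big_ord_recl /= bin0.
rewrite [in RHS](eq_bigr (fun k : 'I_n.+1 =>
    (ad D (iter k (ad D) X) * D ^+ (n - k)) *+ 'C(n, k) +
    (ad D (iter k (ad D) X) * D ^+ (n - k)) *+ 'C(n, k.+1))); last first.
  by move=> k _; rewrite /bump /= add0n binS subSS addnC mulrnDr.
rewrite big_split /= addrCA; congr (_ + _).
rewrite big_ord_recl /= bin0 subn0 -(subn0 n.+1).
congr (_ + _).
rewrite [RHS]big_ord_recr /= bin_small // mulr0n addr0.
by apply: eq_bigr => k _; rewrite /bump /= add1n subSS.
Qed.

Lemma L_mulUn k X : L (X * U ^+ k) = (-1) ^+ k * L (iter k (ad U) X).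
Proof.
elim: k X => [|k IH] X; first by rewrite !expr0 mulr1 mul1r.
rewrite exprS mulrA IH iterSr.
have -> : iter k (ad U) (X * U) = iter k (ad U) X * U.
  elim: k {IH} => //= k ->; rewrite adM (_ : ad U U = 0) ?mulr0 ?addr0 //.
  by rewrite /ad subrr.
have -> : iter k (ad U) (ad U X) = ad U (iter k (ad U) X).
  by rewrite -iterSr.
by rewrite /ad raddfB /= LU sub0r exprS mulrN mulN1r mulNr opprK.
Qed.

Lemma L_mulDU m n X :
  L (X * D ^+ m * U ^+ n) = (n ^_ m)%:R * L (X * U ^+ (n - m)).
Proof.
have DUn k : D * U ^+ k = U ^+ k * D + U ^+ k.-1 *+ k.
  elim: k => [|k IH]; first by rewrite !expr0 mulr1 mul1r mulr0n addr0.
  have DU' : D * U = U * D + 1 by rewrite -DU /ad addrCA subrr addr0.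
  rewrite exprSr mulrA IH mulrDl -mulrA DU' mulrDr mulr1 mulrA -!addrA.
  congr (_ + _); rewrite mulrS; congr (_ + _).
  by case: k {IH} => [|k]; rewrite ?mulr0n ?mul0r // mulrnAl -exprSr.
elim: m X n => [|m IH] X n; first by rewrite expr0 mulr1 ffactn0 subn0 mul1r.
rewrite exprSr mulrA -!mulrA DUn !mulrDr raddfD /= !mulrA LD add0r.
rewrite mulrnAr raddfMn /= IH -[LHS]mulr_natl ffactnS natrM mulrA.
by case: n => [|n]; rewrite ?mul0r // subSS.
Qed.

Lemma L_DnXUn n X :
  L (D ^+ n * X * U ^+ n) =
  \sum_(k < n.+1) ('C(n, k) * (n ^_ (n - k)))%:R * (-1) ^+ k
     * L (iter k (ad U) (iter k (ad D) X)).
Proof.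
rewrite mulDn_ad mulr_suml raddf_sum; apply: eq_bigr => k _.
rewrite [in LHS]mulrnAl [LHS]raddfMn /= L_mulDU subKn ?leq_ord // L_mulUn.
by rewrite natrM -[LHS]mulr_natl !mulrA.
Qed.

End Vacuum.

Lemma binSS n m : 'C(n.+2, m.+2) = ('C(n, m.+2) + 'C(n, m.+1).*2 + 'C(n, m))%N.
Proof. rewrite !binS; lia. Qed.

Lemma bin_double_step k r :
  'C(k.+1.*2, k.+1 + r.+1) =
  ('C(k.*2, k + r.+1).*2 + 'C(k.*2, k + r.+2) + 'C(k.*2, k + r))%N.
Proof. by rewrite doubleS addSn !addnS binSS [X in (X + _)%N]addnC. Qed.

Lemma bin_double_step0 k :
  'C(k.+1.*2, k.+1) = ('C(k.*2, k) + 'C(k.*2, k.+1)).*2.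
Proof.
case: k => [|k] //; rewrite doubleS binSS.
have -> : 'C(k.+1.*2, k.+2) = 'C(k.+1.*2, k).
  by rewrite -bin_sub; [congr 'C(_, _)|]; lia.
lia.
Qed.

Section TwoPoint.
Variables (K : numFieldType) (A : algType K) (D U : A) (L : {scalar A}).
Hypothesis DU : ad D U = 1.
Hypothesis LD : forall X, L (X * D) = 0.
Hypothesis L1 : L 1 = 1.
Variables (kap : K) (H H' : A).
Hypothesis UDH : ad U (ad D H) = kap *: H.
Hypothesis UDH' : ad U (ad D H') = kap *: H'.
Hypothesis HH'C : GRing.comm H H'.
Hypothesis DHH' : ad (ad D H) H' = kap ^+ 2 *: D.
Hypothesis LH : forall X, L (X * H) = L X.
Hypothesis LH' : forall X, L (X * H') = L X.

Let up r (X : A) := iter r (ad D) X.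
Let dn r (X : A) := iter r (ad U) X.

Let dn_up r X : ad U (ad D X) = kap *: X -> ad U (up r.+1 X) = kap *: up r X.
Proof.
move=> UDX; rewrite /up iterSr -[ad U _]/(iter 1 (ad U) _) -iter_ad_DU_comm //.
by rewrite /= UDX; elim: r => //= r ->; rewrite adZ.
Qed.

Let up_dn r X : ad U (ad D X) = kap *: X -> ad D (dn r.+1 X) = kap *: dn r X.
Proof.
move=> UDX; rewrite /dn iterSr -[ad D _]/(iter 1 (ad D) _) iter_ad_DU_comm //.
by rewrite /= ad_DU_comm // UDX; elim: r => //= r ->; rewrite adZ.
Qed.

Lemma commutator_up_dn r :
  ad (up r H) (dn r H') = ((-1) ^+ r * r%:R * kap ^+ r.+1) *: 1 /\
  ad (up r.+1 H) (dn r H') = ((- kap) ^+ r * kap ^+ 2) *: D.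
Proof.
elim: r => [|r [IHc IHd]].
  by rewrite /= mulr0 mul0r scale0r expr0 mul1r DHH'; split=> //; rewrite /ad HH'C subrr.
have c1 : ad (up r.+1 H) (dn r.+1 H') =
    ((-1) ^+ r.+1 * r.+1%:R * kap ^+ r.+2) *: 1.
  have := congr1 (ad U) IHd; rewrite ad_ad dn_up // adZ.
  rewrite -[ad U (dn r H')]/(dn r.+1 H') (ad_anti U D) DU.
  rewrite ad_anti adZ -scalerN -ad_anti IHc scalerA scalerN => e.
  apply: (addrI ((kap * ((-1) ^+ r * r%:R * kap ^+ r.+1)) *: 1)).
  rewrite e -scalerDl -scaleNr (exprNn kap); congr (_ *: _).
  by rewrite !exprS -natr1; ring.
split=> //.
have := congr1 (ad D) c1; rewrite adZ ad_one scaler0 ad_ad.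
rewrite -[ad D (up _ _)]/(up r.+2 H) up_dn // adZ IHd scalerA => /eqP.
rewrite addr_eq0 => /eqP ->; rewrite -scaleNr; congr (_ *: _).
by rewrite [in RHS]exprS; ring.
Qed.

Let sym r := up r H * dn r H' + dn r H * up r H'.

Let QP X := ad U (ad D X).

Let addr_double (a b c : A) : (a + b) + (c + a) = (a + a) + (b + c).
Proof. by rewrite (addrC c) addrACA. Qed.

Let twice_kap (X : A) : (2 * kap) *: X = kap *: X + kap *: X.
Proof. by rewrite mulr_natl mulr2n scalerDl. Qed.

Let QP_mul X Y : ad U (ad D X) = kap *: X -> ad U (ad D Y) = kap *: Y ->
  QP (X * Y) = (2 * kap) *: (X * Y) + (up 1 X * dn 1 Y + dn 1 X * up 1 Y).
Proof.
move=> hX hY; rewrite /QP adM adD !adM hX hY -scalerAl -scalerAr twice_kap.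
exact: addr_double.
Qed.

Let QP_up_dn X Y r : ad U (ad D X) = kap *: X -> ad U (ad D Y) = kap *: Y ->
  QP (up r.+1 X * dn r.+1 Y) = (2 * kap) *: (up r.+1 X * dn r.+1 Y) +
    up r.+2 X * dn r.+2 Y + kap ^+ 2 *: (up r X * dn r Y).
Proof.
move=> hX hY; rewrite /QP adM up_dn // -scalerAr adD adM adZ adM.
rewrite -[ad D (up _ _)]/(up r.+2 X) !dn_up // -!scalerAl scalerDr scalerA.
rewrite -[ad U (dn r.+1 Y)]/(dn r.+2 Y) -[ad U (dn r Y)]/(dn r.+1 Y).
by rewrite twice_kap addr_double addrA.
Qed.

Let QP_dn_up X Y r : ad U (ad D X) = kap *: X -> ad U (ad D Y) = kap *: Y ->
  QP (dn r.+1 X * up r.+1 Y) = (2 * kap) *: (dn r.+1 X * up r.+1 Y) +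
    dn r.+2 X * up r.+2 Y + kap ^+ 2 *: (dn r X * up r Y).
Proof.
move=> hX hY; rewrite /QP adM up_dn // -scalerAl adD adM adZ adM.
rewrite -[ad D (up _ _)]/(up r.+2 Y) !dn_up // -!scalerAr scalerDr scalerA.
rewrite -[ad U (dn r.+1 X)]/(dn r.+2 X) -[ad U (dn r X)]/(dn r.+1 X).
by rewrite twice_kap addr_double (addrC (_ *: _) (_ * _)) addrA.
Qed.

Let QP_sym0 : QP (sym 0) = (2 * kap) *: sym 0 + sym 1 *+ 2.
Proof.
have QPD X Y : QP (X + Y) = QP X + QP Y by rewrite /QP !adD.
by rewrite {1}/sym QPD !QP_mul // addrACA -scalerDr -mulr2n.
Qed.

Let QP_sym r :
  QP (sym r.+1) = (2 * kap) *: sym r.+1 + sym r.+2 + kap ^+ 2 *: sym r.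
Proof.
have QPD X Y : QP (X + Y) = QP X + QP Y by rewrite /QP !adD.
rewrite {1}/sym QPD QP_up_dn // QP_dn_up //.
by rewrite addrACA [X in X + _ = _]addrACA -!scalerDr.
Qed.

Let L_up r X : L (X * up r.+1 H') = 0.
Proof.
elim: r X => [|r IH] X.
  by rewrite /= /ad mulrBr raddfB /= !mulrA LD LH' LD subrr.
by rewrite [up _ _]/= /ad mulrBr raddfB /= mulrA IH mulrA LD subrr.
Qed.

Let L_up' r X : L (X * up r.+1 H) = 0.
Proof.
elim: r X => [|r IH] X.
  by rewrite /= /ad mulrBr raddfB /= !mulrA LD LH LD subrr.
by rewrite [up _ _]/= /ad mulrBr raddfB /= mulrA IH mulrA LD subrr.
Qed.

Let L_sym r : L (sym r) = (r == 0%N)%:R * 2 + (-1) ^+ r * r%:R * kap ^+ r.+1.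
Proof.
case: r => [|r].
  by rewrite /sym /= raddfD /= !LH' -(mul1r H) LH L1; ring.
have -> : sym r.+1 = ad (up r.+1 H) (dn r.+1 H') +
    (dn r.+1 H' * up r.+1 H + dn r.+1 H * up r.+1 H').
  by rewrite /ad addrA subrK.
have [-> _] := commutator_up_dn r.+1.
by rewrite !raddfD /= linearZ /= L1 L_up L_up'; ring.
Qed.

Let L_QP_sym k r : L (iter k.+1 QP (sym r)) =
  2 * kap ^+ (k.+1 + r) *
    ('C(k.+1.*2, k.+1 + r)%:R - kap * 'C(k.*2, k + r)%:R).
Proof.
move: QP_sym0 QP_sym L_sym k r; move: sym => S QPS0 QPS LS.
have QPD X Y : QP (X + Y) = QP X + QP Y by rewrite /QP (adD D) (adD U).
have QPZ (c : K) X : QP (c *: X) = c *: QP X by rewrite /QP !adZ.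
have QPMn X n : QP (X *+ n) = QP X *+ n by rewrite /QP !adMn.
elim=> [|k IH] [|r].
- rewrite /= QPS0 raddfD raddfMn /= linearZ /= !LS (_ : 'C(1.*2, 1 + 0) = 2%N) //.
  by rewrite (_ : 'C(0.*2, 0 + 0) = 1%N) //=; ring.
- have -> : 'C(0.*2, 0 + r.+1) = 0%N by [].
  have -> : 'C(1.*2, 1 + r.+1) = (r == 0%N) by case: r => // r; rewrite bin_small.
  rewrite [X in L X]/= QPS 2!(raddfD L) [LHS]/= !linearZ [LHS]/= !LS.
  by case: r => [|r]; rewrite /= add1n !exprS -?natr1; ring.
- rewrite iterSr QPS0.
  have -> : iter k.+1 QP ((2 * kap) *: S 0%N + S 1%N *+ 2) =
     (2 * kap) *: iter k.+1 QP (S 0%N) + iter k.+1 QP (S 1%N) *+ 2.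
    by elim: k.+1 => // n; rewrite !iterS => ->; rewrite QPD QPZ QPMn.
  rewrite raddfD raddfMn /= linearZ /= -!iterS !IH.
  rewrite !addn0 !addn1 (bin_double_step0 k.+1) (bin_double_step0 k).
  by rewrite -!muln2 !natrM !natrD !exprS; ring.
rewrite iterSr QPS.
have -> : iter k.+1 QP ((2 * kap) *: S r.+1 + S r.+2 + kap ^+ 2 *: S r) =
     (2 * kap) *: iter k.+1 QP (S r.+1) + iter k.+1 QP (S r.+2)
     + kap ^+ 2 *: iter k.+1 QP (S r).
  by elim: k.+1 => // n; rewrite !iterS => ->; rewrite !QPD !QPZ.
have -> X Y Z : L ((2 * kap) *: X + Y + kap ^+ 2 *: Z) =
    (2 * kap) * L X + L Y + kap ^+ 2 * L Z by rewrite !raddfD /= !linearZ.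
rewrite !IH.
rewrite (bin_double_step k.+1) (bin_double_step k) -!muln2 !natrD !natrM.
rewrite !addnS !addSn !exprS.
by ring.
Qed.

Lemma L_adU_adD_mul k : L (iter k.+1 (ad U) (iter k.+1 (ad D) (H * H'))) =
  kap ^+ k.+1 * ('C(k.+1.*2, k.+1)%:R - kap * 'C(k.*2, k)%:R).
Proof.
have -> : iter k.+1 (ad U) (iter k.+1 (ad D) (H * H')) = iter k.+1 QP (H * H').
  elim: k.+1 => // n IH; rewrite [RHS]iterS -IH /QP.
  by rewrite -[ad D (iter n _ _)]/(iter 1 (ad D) _) (iter_ad_DU_comm DU).
have := L_QP_sym k 0; rewrite !addn0.
have -> : sym 0 = (H * H') *+ 2.
  by rewrite /sym /= {2}HH'C mulr2n -HH'C.
have -> : iter k.+1 QP ((H * H') *+ 2) = iter k.+1 QP (H * H') *+ 2.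
  by elim: k.+1 => // n; rewrite !iterS => ->; rewrite /QP !adMn.
rewrite raddfMn /= -[L _ *+ 2]mulr_natl -mulrA => /mulfI; apply.
by rewrite pnatr_eq0.
Qed.

End TwoPoint.

Local Close Scope ring_scope.

(** * PART Endo *)

Local Open Scope ring_scope.

Record endo (K : fieldType) (S : pointedType) := Endo {
  eapp :> (S -> K) -> S -> K;
  eapp_linear : forall c g h x,
    eapp (fun y => c * g y + h y) x = c * eapp g x + eapp h x }.

HB.instance Definition _ K S := gen_eqMixin (endo K S).
HB.instance Definition _ K S := gen_choiceMixin (endo K S).

Section Endo.
Variables (K : fieldType) (S : pointedType).
Implicit Types E F G : endo K S.

Lemma endoP E F : (forall g x, E g x = F g x) -> E = F.
Proof.
case: E F => [e He] [f Hf] /= ef.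
have {}ef : e = f by apply/funext => g; apply/funext => x.
by case: f / ef Hf => Hf; congr Endo; exact: Prop_irrelevance.
Qed.

Lemma eapp0 E x : E (fun=> 0) x = 0.
Proof.
apply: (addIr (E (fun=> 0) x)); rewrite add0r -[X in X + _]mul1r -eapp_linear.
by congr (E _ x); apply/funext => y; rewrite mul1r addr0.
Qed.

Program Definition endo0 := @Endo K S (fun _ _ => 0) _.
Next Obligation. by move=> c g h x; rewrite mulr0 addr0. Qed.
Program Definition endo1 := @Endo K S (fun g => g) _.
Next Obligation. by []. Qed.
Program Definition endoN E := @Endo K S (fun g x => - E g x) _.
Next Obligation. by move=> E c g h x /=; rewrite eapp_linear opprD mulrN. Qed.
Program Definition endoD E F := @Endo K S (fun g x => E g x + F g x) _.
Next Obligation. by move=> E F c g h x /=; rewrite !eapp_linear mulrDr addrACA. Qed.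
Program Definition endoM E F := @Endo K S (fun g => E (F g)) _.
Next Obligation.
move=> E F c g h x /=; rewrite -eapp_linear; congr (E _ x).
by apply/funext => y; rewrite eapp_linear.
Qed.
Program Definition endoZ (a : K) E := @Endo K S (fun g x => a * E g x) _.
Next Obligation. by move=> a E c g h x /=; rewrite eapp_linear mulrDr !mulrA (mulrC a). Qed.

Lemma endo_addA : associative endoD.
Proof. by move=> E F G; apply: endoP => g x /=; rewrite addrA. Qed.
Lemma endo_addC : commutative endoD.
Proof. by move=> E F; apply: endoP => g x /=; rewrite addrC. Qed.
Lemma endo_add0 : left_id endo0 endoD.
Proof. by move=> E; apply: endoP => g x /=; rewrite add0r. Qed.
Lemma endo_addN : left_inverse endo0 endoN endoD.
Proof. by move=> E; apply: endoP => g x /=; rewrite addNr. Qed.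
HB.instance Definition _ := GRing.isZmodule.Build (endo K S)
  endo_addA endo_addC endo_add0 endo_addN.

Lemma endo_mulA : associative endoM. Proof. by move=> E F G; apply: endoP. Qed.
Lemma endo_mul1 : left_id endo1 endoM. Proof. by move=> E; apply: endoP. Qed.
Lemma endo_1mul : right_id endo1 endoM. Proof. by move=> E; apply: endoP. Qed.
Lemma endo_mulDl : left_distributive endoM +%R.
Proof. by move=> E F G; apply: endoP. Qed.
Lemma endo_mulDr : right_distributive endoM +%R.
Proof.
move=> E F G; apply: endoP => g x /=.
by rewrite -[E (F g) x]mul1r -eapp_linear; congr (E _ x); apply/funext => y; rewrite mul1r.
Qed.
HB.instance Definition _ := GRing.Zmodule_isPzRing.Build (endo K S)
  endo_mulA endo_mul1 endo_1mul endo_mulDl endo_mulDr.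
Lemma endo_1neq0 : (1 : endo K S) != 0.
Proof.
apply/eqP => /(congr1 (fun E : endo K S => E (fun=> 1) point))/= /eqP.
by rewrite oner_eq0.
Qed.
HB.instance Definition _ := GRing.PzSemiRing_isNonZero.Build (endo K S) endo_1neq0.

Lemma endo_scaleA a b E : endoZ a (endoZ b E) = endoZ (a * b) E.
Proof. by apply: endoP => g x /=; rewrite mulrA. Qed.
Lemma endo_scale1 : left_id 1 endoZ.
Proof. by move=> E; apply: endoP => g x /=; rewrite mul1r. Qed.
Lemma endo_scaleDr : right_distributive endoZ +%R.
Proof. by move=> a E F; apply: endoP => g x /=; rewrite mulrDr. Qed.
Lemma endo_scaleDl E : {morph endoZ^~ E : a b / a + b}.
Proof. by move=> a b; apply: endoP => g x /=; rewrite mulrDl. Qed.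
HB.instance Definition _ := GRing.Zmodule_isLmodule.Build K (endo K S)
  endo_scaleA endo_scale1 endo_scaleDr endo_scaleDl.

Lemma endo_scaleAl a E F : a *: (E * F) = (a *: E) * F.
Proof. exact: endoP. Qed.
HB.instance Definition _ := GRing.Lmodule_isLalgebra.Build K (endo K S) endo_scaleAl.
Lemma endo_scaleAr a E F : a *: (E * F) = E * (a *: F).
Proof.
apply: endoP => g x; change (a * E (F g) x = E (fun y => a * F g y) x).
rewrite -[LHS]addr0 -[X in _ + X](eapp0 E x) -eapp_linear.
by congr (E _ x); apply/funext => y; rewrite addr0.
Qed.
HB.instance Definition _ := GRing.Lalgebra_isAlgebra.Build K (endo K S) endo_scaleAr.
End Endo.

Local Close Scope ring_scope.

(** * PART Young *)

Implicit Types la mu : partition.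

Definition rowlen (la : partition) (i : nat) : nat := nth 0 la i.

Lemma rowlen_anti la i j : i <= j -> rowlen la j <= rowlen la i.
Proof.
case: la => s sP; rewrite /rowlen /=; case/andP: sP => srt _ ij.
have [js|sj] := ltnP j (size s); last by rewrite nth_default.
have geq_trans : transitive geq by move=> x y z /= xy yz; apply: leq_trans yz xy.
apply: (sorted_leq_nth geq_trans leqnn 0 srt) => //.
exact: leq_ltn_trans ij js.
Qed.

Lemma rowlen_default la i : size la <= i -> rowlen la i = 0.
Proof. exact: nth_default. Qed.

Lemma rowlen_gt0 la i : (0 < rowlen la i) = (i < size la).
Proof.
case: la => s sP; rewrite /rowlen /=; case/andP: sP => _ /(all_nthP 0) s_gt0.
have [si|si] := ltnP i (size s); last by rewrite nth_default.
exact: s_gt0.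
Qed.

Lemma partition_ext la mu : rowlen la =1 rowlen mu -> la = mu.
Proof.
move=> e.
have le_size (s1 s2 : partition) : rowlen s1 =1 rowlen s2 -> size s2 <= size s1.
  move=> es; rewrite leqNgt -rowlen_gt0 -es.
  by rewrite (rowlen_default (leqnn _)).
have sz : size la = size mu by apply/eqP; rewrite eqn_leq !le_size.
have : parts la = parts mu by apply: (@eq_from_nth _ 0) => // i _; exact: e.
exact: val_inj.
Qed.

Lemma antitone_leq (g : nat -> nat) : (forall i, g i.+1 <= g i) ->
  forall i j, i <= j -> g j <= g i.
Proof.
move=> gS i j /subnKC <-; elim: (j - i) => [|k IH]; first by rewrite addn0.
by rewrite addnS (leq_trans (gS _)).
Qed.

Lemma partition_of_subproof (g : nat -> nat) n :
  (forall i, g i.+1 <= g i) -> is_partition [seq x <- mkseq g n | 0 < x].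
Proof.
move=> gS; apply/andP; split; last by apply/allP=> x; rewrite mem_filter => /andP[].
have geq_trans : transitive geq by move=> x y z /= xy yz; apply: leq_trans yz xy.
apply: (sorted_filter geq_trans).
by apply: (homo_sorted (e := leq)) (iota_sorted 0 n) => i j; exact: antitone_leq.
Qed.

Definition partition_of g n (gS : forall i, g i.+1 <= g i) : partition :=
  Partition (partition_of_subproof n gS).

Lemma rowlen_partition_of g n gS i :
  (forall j, n <= j -> g j = 0) -> rowlen (@partition_of g n gS) i = g i.
Proof.
move=> g0; rewrite /rowlen /=.
have -> : nth 0 [seq x <- mkseq g n | 0 < x] i = nth 0 (mkseq g n) i.
  elim: n g gS g0 i => //= n IH g gS g0 i.
  rewrite /mkseq /= -[1]addn0 iotaDl -map_comp.
  have gS' j : g j.+2 <= g j.+1 by [].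
  have g0' j : n <= j -> g j.+1 = 0 by move=> nj; exact: g0.
  have {IH g0'} := IH (g \o S) gS' g0'; rewrite /mkseq => IH.
  rewrite (eq_map (g := g \o S)) //.
  have [g00|g_gt0] := posnP (g 0); last by case: i => [|i] //=; exact: IH.
  have gz j : g j = 0 by apply/eqP; rewrite -leqn0 -g00; exact: antitone_leq.
  have nth_gz (h : nat -> nat) s k : h =1 (fun=> 0) -> nth 0 (map h s) k = 0.
    by move=> hz; elim: s k => [|x s IHs] [|k] //=; rewrite hz.
  rewrite IH nth_gz; last by move=> j; exact: gz.
  by case: i => [|i] /=; rewrite ?g00 ?nth_gz // => j; exact: gz.
have [ni|i_n] := leqP n i; last by rewrite nth_mkseq.
by rewrite nth_default ?size_mkseq // g0.
Qed.

Lemma psizeE la n : size la <= n -> psize la = (\sum_(i < n) rowlen la i)%N.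
Proof.
move=> lan; rewrite /psize sumnE (big_nth 0) -(big_mkord xpredT (rowlen la)).
rewrite [RHS](@big_cat_nat _ _ _ (size la)) //= [X in _ = (_ + X)%N]big_nat_cond.
rewrite [X in _ = (_ + X)%N]big1 ?addn0 // => i /andP[/andP[lai _] _].
exact: rowlen_default.
Qed.

Definition addable la i := (i == 0) || (rowlen la i < rowlen la i.-1).
Definition removable la i := rowlen la i.+1 < rowlen la i.

Lemma addable_size la i : addable la i -> i <= size la.
Proof.
case: i => // i /=; rewrite /addable /= => h.
by rewrite -rowlen_gt0; apply: leq_trans h.
Qed.

Lemma removable_size la i : removable la i -> i < size la.
Proof. by rewrite -rowlen_gt0; apply: leq_trans. Qed.

Definition add_row la i (j : nat) :=
  if addable la i then (rowlen la j + (j == i))%N else rowlen la j.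
Definition rem_row la i (j : nat) :=
  if removable la i then (rowlen la j - (j == i))%N else rowlen la j.

Lemma add_row_anti la i j : add_row la i j.+1 <= add_row la i j.
Proof.
rewrite /add_row; have := rowlen_anti la (leqnSn j); rewrite /addable.
have [<-|ne] := eqVneq j.+1 i => /=; last by case: ifP; lia.
by case: ifP; lia.
Qed.

Lemma rem_row_anti la i j : rem_row la i j.+1 <= rem_row la i j.
Proof.
rewrite /rem_row; have := rowlen_anti la (leqnSn j); rewrite /removable.
by have [->|ne] := eqVneq j i => /=; case: ifP; lia.
Qed.

Definition add_box la i := partition_of (size la).+1 (add_row_anti la i).
Definition rem_box la i := partition_of (size la) (rem_row_anti la i).

Lemma rowlen_add_box la i j : addable la i ->
  rowlen (add_box la i) j = (rowlen la j + (j == i))%N.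
Proof.
move=> ai; rewrite rowlen_partition_of; first by rewrite /add_row ai.
move=> k szk; rewrite /add_row ai rowlen_default; last exact: ltnW.
by have := addable_size ai; case: eqP => //; lia.
Qed.

Lemma rowlen_rem_box la i j : removable la i ->
  rowlen (rem_box la i) j = (rowlen la j - (j == i))%N.
Proof.
move=> ri; rewrite rowlen_partition_of; first by rewrite /rem_row ri.
by move=> k szk; rewrite /rem_row ri rowlen_default.
Qed.

Lemma add_boxK la i : addable la i ->
  removable (add_box la i) i /\ rem_box (add_box la i) i = la.
Proof.
move=> ai.
have ri : removable (add_box la i) i.
  rewrite /removable !rowlen_add_box // eqxx; have := rowlen_anti la (leqnSn i).
  by case: eqP; lia.
split=> //; apply: partition_ext => j; rewrite rowlen_rem_box // rowlen_add_box //.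
by rewrite addnK.
Qed.

Lemma rem_boxK la i : removable la i ->
  addable (rem_box la i) i /\ add_box (rem_box la i) i = la.
Proof.
move=> ri.
have ai : addable (rem_box la i) i.
  case: i ri => [|i] // ri; rewrite /addable !rowlen_rem_box // eqxx /=.
  have := rowlen_anti la (leqnSn i); move: ri; rewrite /removable.
  by case: eqP; lia.
split=> //; apply: partition_ext => j; rewrite rowlen_add_box // rowlen_rem_box //.
by case: eqP => [->|_]; move: ri; rewrite /removable; lia.
Qed.

Lemma rem_add_comm la i j : i != j ->
  addable la i -> removable (add_box la i) j ->
  [/\ removable la j, addable (rem_box la j) i &
      rem_box (add_box la i) j = add_box (rem_box la j) i].
Proof.
move=> ij ai; rewrite /removable !rowlen_add_box // => rj.
have rj' : removable la j by rewrite /removable; lia.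
have ai' : addable (rem_box la j) i.
  case: i ij ai rj => [|i] // ij; rewrite /addable !rowlen_rem_box //=.
  by have [->|ne] := eqVneq i j; lia.
split=> //; apply: partition_ext => k.
have rj2 : removable (add_box la i) j by rewrite /removable !rowlen_add_box.
rewrite rowlen_rem_box // !rowlen_add_box // rowlen_rem_box //.
by have [->|ne] := eqVneq k j; lia.
Qed.

Lemma add_rem_comm la i j : i != j ->
  removable la j -> addable (rem_box la j) i ->
  addable la i /\ removable (add_box la i) j.
Proof.
move=> ij rj ai.
have ai' : addable la i.
  move: ai; rewrite /addable; case: i ij => [|i] // ij; rewrite !rowlen_rem_box //=.
  by lia.
split=> //; rewrite /removable !rowlen_add_box //.
move: ai (rj); rewrite /addable /removable; case: i ij ai' => [|i] ij ai' /=; first by lia.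
rewrite !rowlen_rem_box //=; case: (eqVneq i j) => [e|ne]; [subst j|]; lia.
Qed.

Lemma psize_add_box la i : addable la i -> psize (add_box la i) = (psize la).+1.
Proof.
move=> ai; rewrite (@psizeE _ (size (add_box la i) + (size la).+1)) ?leq_addr //.
under eq_bigr => j _ do rewrite rowlen_add_box //.
rewrite big_split /= -psizeE ?(leq_trans _ (leq_addl _ _)) // -[RHS]addn1; congr addn.
have ilt : i < size (add_box la i) + (size la).+1.
  by apply: leq_trans (leq_addl _ _); rewrite ltnS addable_size.
rewrite (bigD1 (Ordinal ilt)) //= eqxx big1 // => j /eqP ji.
by case: eqP => // e; case: ji; exact: val_inj.
Qed.

(** * PART Std *)

Section StandardFilling.
Implicit Types (A : {fset nat * nat}) (p q : nat * nat).

Definition cell_lt p q :=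
  ((p.1 == q.1) && (p.2 < q.2)) || ((p.2 == q.2) && (p.1 < q.1)).

Definition standard_fillings A m : {set {ffun A -> 'I_m}} :=
  [set T : {ffun A -> 'I_m} | [&& injectiveb T, [forall k, exists c, T c == k],
      [forall c, forall d,
        ((val c).1 == (val d).1) && ((val c).2 < (val d).2) ==> (T c < T d)] &
      [forall c, forall d,
        ((val c).2 == (val d).2) && ((val c).1 < (val d).1) ==> (T c < T d)]]]%SET.

Lemma standard_fillingsP A m (T : {ffun A -> 'I_m}) :
  reflect [/\ injective T, forall k, exists c, T c = k &
     forall c d, cell_lt (val c) (val d) -> T c < T d]
   (T \in standard_fillings A m).
Proof.
rewrite inE; apply: (iffP and4P) => [[/injectiveP Ti /forallP Ts /forallP Tr /forallP Tc]|[Ti Ts Tm]].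
  split=> // [k|c d].
    by have /existsP[c /eqP <-] := Ts k; exists c.
  have /forallP/(_ d)/implyP h1 := Tr c; have /forallP/(_ d)/implyP h2 := Tc c.
  by case/orP.
split; first exact/injectiveP.
- by apply/forallP => k; apply/existsP; have [c <-] := Ts k; exists c.
- by apply/forallP => c; apply/forallP => d; apply/implyP => h; apply: Tm; rewrite /cell_lt h.
- by apply/forallP => c; apply/forallP => d; apply/implyP => h; apply: Tm; rewrite /cell_lt h orbT.
Qed.

Definition maximal_cell A p := [forall d : A, ~~ cell_lt p (val d)].

Lemma cell_ltxx p : cell_lt p p = false.
Proof. by rewrite /cell_lt !ltnn !andbF. Qed.

Section Extension.
Variables (A : {fset nat * nat}) (m : nat) (c0 : A).
Local Notation B := (A `\ val c0)%fset.

Let incl (y : B) : A := [` fsubsetP (fsubD1set A (val c0)) _ (valP y)]%fset.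

Let incl_neq y : incl y != c0.
Proof. by have := valP y; rewrite in_fsetD1 => /andP[]. Qed.

Let inclP (x : A) : x != c0 -> exists y, incl y = x.
Proof.
move=> xc; have xB : val x \in B by rewrite in_fsetD1 (valP x) andbT.
by exists [` xB]%fset; apply: val_inj.
Qed.

Definition extend_filling (S : {ffun B -> 'I_m}) : {ffun A -> 'I_m.+1} :=
  [ffun x : A => if insub (val x) : option B is Some y then lift ord_max (S y) else ord_max].

Let extend_incl S y : extend_filling S (incl y) = lift ord_max (S y).
Proof.
rewrite ffunE; case: insubP => [z _ zy|]; last by rewrite (valP y).
by have -> : z = y by apply: val_inj.
Qed.

Let extend_c0 S : extend_filling S c0 = ord_max.
Proof.
rewrite ffunE; case: insubP => // z; rewrite in_fsetD1 eqxx //.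
Qed.

Lemma card_fillings_max :
  #|[set T in standard_fillings A m.+1 | T c0 == ord_max]%SET| =
  if maximal_cell A (val c0) then #|standard_fillings B m| else 0.
Proof.
case: ifPn => [/forallP c0max|]; last first.
  rewrite negb_forall => /existsP[d]; rewrite negbK => c0d.
  apply: eq_card0 => T; rewrite inE; apply/negP => /andP[/standard_fillingsP[_ _ Tm] /eqP Tc0].
  by have := Tm _ _ c0d; rewrite Tc0 /= ltnNge -ltnS ltn_ord.
have extI : injective extend_filling.
  move=> S S' SS'; apply/ffunP => y; apply: (@lift_inj _ ord_max).
  by rewrite -!extend_incl SS'.
rewrite -(card_imset _ extI); apply: eq_card => T; rewrite inE.
apply/andP/imsetP => [[/standard_fillingsP[Ti Ts Tm] /eqP Tc0]|[S /standard_fillingsP[Si Ss Sm] ->]].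
  have /fin_all_exists[S SP] y : exists j : 'I_m, T (incl y) = lift ord_max j.
    have : ord_max != T (incl y).
      by rewrite -Tc0 (inj_eq Ti) eq_sym.
    by case/unlift_some => j ->; exists j.
  have TE : T = extend_filling [ffun y => S y].
    apply/ffunP => x; have [->|/inclP[y <-]] := eqVneq x c0; first by rewrite extend_c0.
    by rewrite extend_incl ffunE.
  exists [ffun y => S y] => //; apply/standard_fillingsP; split.
  - move=> y y' e; have : T (incl y) = T (incl y') by rewrite TE !extend_incl e.
    by move/Ti => [e']; apply: val_inj.
  - move=> k; have [x xk] := Ts (lift ord_max k).
    have /inclP[y yx] : x != c0.
      by apply/eqP => xc; move: xk; rewrite xc Tc0 => /eqP; rewrite (negbTE (neq_lift _ _)).
    by exists y; apply: (@lift_inj _ ord_max); rewrite -extend_incl -TE yx.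
  - move=> y y' /(Tm (incl y) (incl y')).
    by rewrite TE !extend_incl !lift_max.
split; last by rewrite extend_c0.
apply/standard_fillingsP; split.
- move=> x x'; have [->|/inclP[y <-]] := eqVneq x c0; have [->|/inclP[y' <-]] := eqVneq x' c0 => //.
  + by rewrite extend_c0 extend_incl => /eqP; rewrite (negbTE (neq_lift _ _)).
  + by rewrite extend_c0 extend_incl => /esym/eqP; rewrite (negbTE (neq_lift _ _)).
  + by rewrite !extend_incl => /lift_inj/Si ->.
- move=> k; have [j ->|->] := unliftP ord_max k; last by exists c0.
  by have [y <-] := Ss j; exists (incl y).
- move=> x x'; have [->|/inclP[y <-]] := eqVneq x c0.
    by move=> h; have := c0max x'; rewrite h.
  have [->|/inclP[y' <-]] := eqVneq x' c0.
    by rewrite extend_c0 extend_incl lift_max ltn_ord.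
  by rewrite !extend_incl !lift_max => /Sm.
Qed.
End Extension.

Lemma card_fillings A m : #|standard_fillings A m.+1| =
  \sum_(c : A | maximal_cell A (val c)) #|standard_fillings (A `\ val c)%fset m|.
Proof.
rewrite -sum1_card big_mkcond /= [RHS]big_mkcond /=.
under [RHS]eq_bigr => c _ do rewrite -card_fillings_max -sum1_card big_mkcond.
rewrite exchange_big; apply: eq_bigr => T _ /=.
case: ifP => [TS|TF]; last by rewrite big1 // => c _; rewrite finset.in_set TF.
have /standard_fillingsP[Ti Ts _] := TS.
have [c Tc] := Ts ord_max.
rewrite (bigD1 c) //= finset.in_set TS Tc eqxx big1 ?addn0 // => d dc.
by rewrite finset.in_set TS -Tc (inj_eq Ti) (negbTE dc).
Qed.

End StandardFilling.

Definition corner la i : nat * nat := (i.+1, rowlen la i).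

Lemma in_young_row la p :
  (p \in young la) = [&& 0 < p.1, 0 < p.2 & p.2 <= rowlen la p.1.-1].
Proof.
case: p => a b; rewrite in_young /= -/(rowlen la _).
case: a => [|a] //=; case: b => [|b] /=; first by rewrite andbF.
apply/andP/idP => [[]//|h]; split=> //.
by rewrite -rowlen_gt0; apply: leq_trans h.
Qed.

Lemma corner_in_young la i : i < size la -> corner la i \in young la.
Proof. by rewrite in_young_row /= leqnn andbT -rowlen_gt0. Qed.

Lemma maximal_cell_youngP la p : p \in young la ->
  reflect (exists2 i, removable la i & p = corner la i) (maximal_cell (young la) p).
Proof.
case: p => a b; rewrite in_young_row /= => /and3P[a_gt0 b_gt0 b_le].
apply: (iffP forallP) => [pmax|[i ri [-> ->]]].
  have out q : cell_lt (a, b) q -> q \notin young la.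
    by move=> h; apply/negP => qY; have := pmax [` qY]%fset; rewrite h.
  have h1 : (a, b.+1) \notin young la by apply: out; rewrite /cell_lt /= eqxx ltnSn.
  have h2 : (a.+1, b) \notin young la by apply: out; rewrite /cell_lt /= eqxx ltnSn orbT.
  move: h1 h2; rewrite !in_young_row /= a_gt0 b_gt0 /= -!ltnNge => h1 h2.
  have e : b = rowlen la a.-1 by lia.
  exists a.-1; last by rewrite /corner prednK // -e.
  by rewrite /removable prednK // -e.
move=> d; apply/negP; have := valP d; rewrite in_young_row.
case: (val d) => x y /=; rewrite /cell_lt /=.
move=> /and3P[x0 y0 yx] /orP[/andP[/eqP e yl]|/andP[/eqP e xl]].
  by move: yx; rewrite -e /= leqNgt yl.
subst y; move: ri; rewrite /removable => ri.
have := @rowlen_anti la i.+1 x.-1; lia.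
Qed.

Lemma young_rem_box la i : removable la i ->
  young (rem_box la i) = (young la `\ corner la i)%fset.
Proof.
move=> ri; apply/fsetP => -[a b]; rewrite in_fsetD1 !in_young_row /=.
rewrite rowlen_rem_box // /corner xpair_eqE negb_and.
case: a => [|a] //=.
rewrite eqSS; case: (eqVneq a i) => [->|ne] /=; last by rewrite subn0.
by move: ri; rewrite /removable; lia.
Qed.

Lemma psize_rem_box la i : removable la i -> psize la = (psize (rem_box la i)).+1.
Proof. by move=> ri; have [ai {1}<-] := rem_boxK ri; rewrite psize_add_box. Qed.

(** The largest entry of a standard tableau sits in a removable box. *)
Lemma card_Std_rec la : 0 < psize la ->
  #|Std la| = \sum_(0 <= i < size la | removable la i) #|Std (rem_box la i)|.
Proof.
move=> la_gt0; have -> : #|Std la| = #|standard_fillings (young la) (psize la)| by [].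
rewrite -(prednK la_gt0) card_fillings.
pose F p := #|standard_fillings (young la `\ p)%fset (psize la).-1|.
have -> : \sum_(0 <= i < size la | removable la i) #|Std (rem_box la i)| =
    \sum_(0 <= i < size la | removable la i) F (corner la i).
  apply: eq_bigr => i ri; rewrite /F -young_rem_box //.
  by rewrite (psize_rem_box ri).
rewrite big_mkord.
have -> : \sum_(c : young la | maximal_cell (young la) (val c)) F (val c) =
  \sum_(c : young la | maximal_cell (young la) (val c))
    \sum_(i < size la | removable la i && (corner la i == val c)) F (corner la i).
  apply: eq_bigr => c /(maximal_cell_youngP (valP c))[i ri ec].
  rewrite (big_pred1 (Ordinal (removable_size ri))) ?ec //= => j /=.
  rewrite /corner xpair_eqE eqSS; apply/andP/eqP => [[_ /andP[/eqP ji _]]|->]; first exact: val_inj.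
  by rewrite !eqxx.
rewrite (exchange_big_dep (fun i : 'I_(size la) => removable la i)) /=; last by move=> c i _ /andP[].
apply: eq_bigr => i ri.
rewrite (big_pred1 [` corner_in_young (ltn_ord i)]%fset) // => c /=.
apply/andP/eqP => [[_ /andP[_ /eqP e]]|->]; first exact: val_inj.
split; last by rewrite ri eqxx.
by apply/(maximal_cell_youngP (corner_in_young (ltn_ord i))); exists (val i).
Qed.

Lemma card_Std0 la : psize la = 0 -> #|Std la| = 1.
Proof.
move=> la0; have -> : #|Std la| = #|standard_fillings (young la) (psize la)| by [].
have sz : size la = 0.
  apply/eqP; rewrite -leqn0 leqNgt -rowlen_gt0 -leqNgt leqn0.
  move: la0; rewrite (psizeE (leqnSn _)) big_ord_recl => /eqP.
  by rewrite addn_eq0 => /andP[].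
have Y0 : young la = fset0.
  apply/fsetP => p; rewrite in_young_row in_fset0.
  by rewrite rowlen_default ?sz //; case: p => a b /=; lia.
have no (x : fset0 : {fset nat * nat}) : False by have := valP x; rewrite in_fset0.
rewrite la0 Y0 (_ : standard_fillings _ _ = [set: {ffun (fset0 : {fset nat * nat}) -> 'I_0}]%SET).
  by rewrite cardsT card_ffun card_ord -cardfE cardfs0.
apply/setP => T; rewrite [RHS]finset.in_setT; apply/standard_fillingsP.
by split=> [x|[]|x] //; case: (no x).
Qed.

(** * PART Ops *)

Local Open Scope ring_scope.

Definition empty_part : partition := @Partition [::] isT.
HB.instance Definition _ := isPointed.Build partition empty_part.

Section Content.
Variable K : fieldType.
Variables z w : K.
Hypothesis zw : z * w = 1.

Definition content_gf la : K :=
  \sum_(i < size la) \sum_(j < rowlen la i) z ^+ j * w ^+ i.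

Lemma content_gfE la n : (size la <= n)%N ->
  content_gf la = \sum_(i < n) \sum_(j < rowlen la i) z ^+ j * w ^+ i.
Proof.
move=> lan.
rewrite /content_gf -!(big_mkord xpredT (fun i => \sum_(j < rowlen la i) z ^+ j * w ^+ i)).
rewrite [RHS](@big_cat_nat _ _ _ (size la)) //= [X in _ = _ + X]big_nat_cond.
rewrite [X in _ = _ + X]big1 ?addr0 // => i /andP[/andP[lai _] _].
by rewrite rowlen_default // big_ord0.
Qed.

Lemma content_gf_add_box la i : addable la i ->
  content_gf (add_box la i) = content_gf la + z ^+ rowlen la i * w ^+ i.
Proof.
move=> ai; pose n := (size (add_box la i) + (size la).+1)%N.
have ilt : (i < n)%N.
  by apply: leq_trans (leq_addl _ _); rewrite ltnS addable_size.
rewrite (@content_gfE _ n) ?leq_addr // (@content_gfE la n); last first.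
  by apply: leq_trans (leq_addl _ _).
rewrite (bigD1 (Ordinal ilt)) //= [in RHS](bigD1 (Ordinal ilt)) //=.
rewrite rowlen_add_box // eqxx addn1 big_ord_recr /= -!addrA; congr (_ + _).
rewrite addrC; congr (_ + _); apply: eq_bigr => j ji.
rewrite rowlen_add_box //; case: eqP => [e|]; last by rewrite addn0.
by case/eqP: ji; exact: val_inj.
Qed.

Lemma content_gf_rem_box la i : removable la i ->
  content_gf la = content_gf (rem_box la i) + z ^+ (rowlen la i).-1 * w ^+ i.
Proof.
move=> ri; have [ai e] := rem_boxK ri.
by rewrite -{1}e content_gf_add_box // rowlen_rem_box // eqxx subn1.
Qed.

Lemma content_gf0 : content_gf point = 0.
Proof. exact: big_ord0. Qed.

Lemma content_gf_beta la n : (size la <= n)%N ->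
  (z - 1) * content_gf la = \sum_(i < n) (z ^+ rowlen la i - 1) * w ^+ i.
Proof.
move=> lan; rewrite (content_gfE lan) mulr_sumr; apply: eq_bigr => i _.
by rewrite -mulr_suml mulrA -subrX1.
Qed.

Lemma corner_sum_aux la m :
  \sum_(0 <= i < m.+1) (if addable la i then z ^+ rowlen la i * w ^+ i else 0)
  - \sum_(0 <= i < m)
      (if removable la i then z ^+ (rowlen la i).-1 * w ^+ i else 0) =
  \sum_(0 <= i < m.+1) z ^+ rowlen la i * w ^+ i
  - \sum_(0 <= i < m) z ^+ rowlen la i * w ^+ i.+1.
Proof.
elim: m => [|m IH]; first by rewrite !big_nat1 !big_geq.
have step (a b c d : nat -> K) :
    \sum_(0 <= i < m.+1) a i - \sum_(0 <= i < m) b i =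
    \sum_(0 <= i < m.+1) c i - \sum_(0 <= i < m) d i ->
    a m.+1 - b m = c m.+1 - d m ->
    \sum_(0 <= i < m.+2) a i - \sum_(0 <= i < m.+1) b i =
    \sum_(0 <= i < m.+2) c i - \sum_(0 <= i < m.+1) d i.
  have recr (F : nat -> K) n : \sum_(0 <= i < n.+1) F i = \sum_(0 <= i < n) F i + F n.
    by rewrite big_nat_recr.
  move=> e1 e2; rewrite (recr a m.+1) (recr b m) (recr c m.+1) (recr d m).
  by rewrite !opprD [LHS]addrACA [RHS]addrACA e1 e2.
apply: step IH _.
rewrite /addable /removable /=; case: ltnP => [h|h].
  case: (rowlen la m) h => //= k _.
  by congr (_ - _); rewrite (exprS z k) (exprS w m) mulrACA zw mul1r.
have -> : rowlen la m.+1 = rowlen la m.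
  by apply/eqP; rewrite eqn_leq h rowlen_anti.
by rewrite !subrr.
Qed.

Lemma corner_sum la n : (size la <= n)%N ->
  \sum_(0 <= i < n.+1) (if addable la i then z ^+ rowlen la i * w ^+ i else 0)
  - \sum_(0 <= i < n.+1)
      (if removable la i then z ^+ (rowlen la i).-1 * w ^+ i else 0) =
  1 - (2 - z - w) * content_gf la.
Proof.
move=> lan.
have -> : \sum_(0 <= i < n.+1)
    (if removable la i then z ^+ (rowlen la i).-1 * w ^+ i else 0) =
  \sum_(0 <= i < n)
    (if removable la i then z ^+ (rowlen la i).-1 * w ^+ i else 0).
  rewrite big_nat_recr //= ifN ?addr0 //; apply/negP => /removable_size.
  by rewrite ltnNge lan.
rewrite corner_sum_aux big_nat_recr //= rowlen_default // expr0 mul1r.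
have -> : 1 - (2 - z - w) * content_gf la = 1 + (1 - w) * ((z - 1) * content_gf la).
  by move: zw => zw'; have -> : 2 - z - w = - ((1 - w) * (z - 1)) + (z * w - 1) *- 1; [ring|rewrite zw'; ring].
rewrite (content_gf_beta lan) -(big_mkord xpredT (fun i => (z ^+ rowlen la i - 1) * w ^+ i)).
have -> : \sum_(0 <= i < n) (z ^+ rowlen la i - 1) * w ^+ i =
   \sum_(0 <= i < n) z ^+ rowlen la i * w ^+ i - \sum_(0 <= i < n) w ^+ i.
  by rewrite -sumrB; apply: eq_bigr => i _; rewrite mulrBl mul1r.
have -> : \sum_(0 <= i < n) z ^+ rowlen la i * w ^+ i.+1 =
   w * \sum_(0 <= i < n) z ^+ rowlen la i * w ^+ i.
  by rewrite mulr_sumr; apply: eq_bigr => i _; rewrite exprS mulrCA.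
have e : (1 - w) * \sum_(0 <= i < n) w ^+ i = 1 - w ^+ n.
  by rewrite big_mkord -(opprB (w ^+ n)) subrX1 -mulNr opprB.
by rewrite mulrBr e; ring.
Qed.

End Content.

Section Operators.
Variable K : fieldType.
Implicit Types (c : partition -> nat -> K) (h g : partition -> K).

Program Definition add_op c : endo K partition := @Endo K partition
  (fun g la => \sum_(0 <= i < (size la).+1)
     (if addable la i then c la i * g (add_box la i) else 0)) _.
Next Obligation.
move=> c a g h x /=; rewrite mulr_sumr -big_split; apply: eq_bigr => i _ /=.
by case: ifP => _; [ring|rewrite mulr0 addr0].
Qed.

Program Definition rem_op c : endo K partition := @Endo K partition
  (fun g la => \sum_(0 <= i < (size la).+1)
     (if removable la i then c la i * g (rem_box la i) else 0)) _.
Next Obligation.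
move=> c a g h x /=; rewrite mulr_sumr -big_split; apply: eq_bigr => i _ /=.
by case: ifP => _; [ring|rewrite mulr0 addr0].
Qed.

Program Definition diag_op h : endo K partition := @Endo K partition
  (fun g la => h la * g la) _.
Next Obligation. by move=> h c g g' x /=; ring. Qed.

Lemma add_opE c g la n : (size la < n)%N -> add_op c g la =
  \sum_(0 <= i < n) (if addable la i then c la i * g (add_box la i) else 0).
Proof.
move=> lan /=; rewrite [RHS](@big_cat_nat _ _ _ (size la).+1) //=.
rewrite [X in _ = _ + X]big_nat_cond [X in _ = _ + X]big1 ?addr0 //.
move=> i /andP[/andP[lai _] _]; case: ifP => // /addable_size.
by rewrite leqNgt lai.
Qed.

Lemma rem_opE c g la n : (size la <= n)%N -> rem_op c g la =
  \sum_(0 <= i < n) (if removable la i then c la i * g (rem_box la i) else 0).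
Proof.
move=> lan.
have aux m : (size la <= m)%N ->
    \sum_(0 <= i < m) (if removable la i then c la i * g (rem_box la i) else 0) =
    \sum_(0 <= i < size la) (if removable la i then c la i * g (rem_box la i) else 0).
  move=> lam; rewrite [LHS](@big_cat_nat _ _ _ (size la)) //=.
  rewrite [X in _ + X = _]big_nat_cond [X in _ + X = _]big1 ?addr0 //.
  move=> i /andP[/andP[lai _] _]; case: ifP => // /removable_size.
  by rewrite ltnNge lai.
by rewrite [LHS]aux ?aux.
Qed.

Lemma size_add_box la i : (size (add_box la i) <= (size la).+1)%N.
Proof. by rewrite size_filter (leq_trans (count_size _ _)) // size_mkseq. Qed.

Lemma size_rem_box la i : (size (rem_box la i) <= size la)%N.
Proof. by rewrite size_filter (leq_trans (count_size _ _)) // size_mkseq. Qed.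

(** Adding a box and removing a box in distinct rows commute, so that only the
   operations undoing each other contribute to the commutator. *)
Lemma ad_add_rem c :
  (forall la i j, i != j -> addable la i -> removable (add_box la i) j ->
     c (add_box la i) j = c la j) ->
  ad (add_op (fun _ _ => 1)) (rem_op c) =
  diag_op (fun la =>
    \sum_(0 <= i < (size la).+1) (if addable la i then c (add_box la i) i else 0)
    - \sum_(0 <= i < (size la).+1) (if removable la i then c la i else 0)).
Proof.
move=> cP; apply: endoP => g la.
change (add_op (fun _ _ => 1) (rem_op c g) la -
   rem_op c (add_op (fun _ _ => 1) g) la =
  (\sum_(0 <= i < (size la).+1) (if addable la i then c (add_box la i) i else 0)
    - \sum_(0 <= i < (size la).+1) (if removable la i then c la i else 0)) * g la).
pose n := (size la).+1.
pose A i j := if addable la i && removable (add_box la i) j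
  then c (add_box la i) j * g (rem_box (add_box la i) j) else 0.
pose B i j := if removable la j && addable (rem_box la j) i
  then c la j * g (add_box (rem_box la j) i) else 0.
have -> : add_op (fun _ _ => 1) (rem_op c g) la =
    \sum_(0 <= i < n) \sum_(0 <= j < n) A i j.
  rewrite (@add_opE _ _ _ n) //; apply: eq_bigr => i _; rewrite /A.
  case: ifP => ai; last by rewrite big1.
  by rewrite mul1r (@rem_opE _ _ _ n) // size_add_box.
have -> : rem_op c (add_op (fun _ _ => 1) g) la =
    \sum_(0 <= i < n) \sum_(0 <= j < n) B i j.
  rewrite exchange_big (@rem_opE _ _ _ n) //; apply: eq_bigr => j _; rewrite /B.
  case: ifP => rj; last by rewrite big1.
  rewrite (@add_opE _ _ _ n) ?ltnS ?size_rem_box // mulr_sumr.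
  by apply: eq_bigr => i _; case: ifP; rewrite ?mul1r ?mulr0.
have AB i j : i != j -> A i j = B i j.
  move=> ij; rewrite /A /B.
  case: (boolP (_ && _)) => [/andP[ai rj]|nA].
    by have [-> -> ->] := rem_add_comm ij ai rj; rewrite cP.
  case: (boolP (_ && _)) => [/andP[rj ai]|//].
  by have [h1 h2] := add_rem_comm ij rj ai; rewrite h1 h2 in nA.
rewrite -sumrB -sumrB mulr_suml; apply: eq_big_nat => i /andP[_ i_n].
rewrite -sumrB (bigD1_seq i) ?mem_index_iota ?iota_uniq //.
rewrite big1 => [|j ji]; last by rewrite AB ?subrr // eq_sym.
rewrite [LHS]addr0.
rewrite /A /B mulrBl; congr (_ - _).
  case: (boolP (addable la i)) => ai; last by rewrite mul0r.
  by have [-> ->] := add_boxK ai.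
case: (boolP (removable la i)) => ri; last by rewrite mul0r.
by have [-> ->] := rem_boxK ri.
Qed.

Lemma ad_add_diag c h : ad (add_op c) (diag_op h) =
  add_op (fun la i => c la i * (h (add_box la i) - h la)).
Proof.
apply: endoP => g la.
change (add_op c (fun mu => h mu * g mu) la - h la * add_op c g la =
  add_op (fun la i => c la i * (h (add_box la i) - h la)) g la).
rewrite /= mulr_sumr -sumrB; apply: eq_bigr => i _.
by case: ifP => _; [ring|rewrite mulr0 subr0].
Qed.

Lemma ad_rem_diag c h : ad (rem_op c) (diag_op h) =
  rem_op (fun la i => c la i * (h (rem_box la i) - h la)).
Proof.
apply: endoP => g la.
change (rem_op c (fun mu => h mu * g mu) la - h la * rem_op c g la =
  rem_op (fun la i => c la i * (h (rem_box la i) - h la)) g la).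
rewrite /= mulr_sumr -sumrB; apply: eq_bigr => i _.
by case: ifP => _; [ring|rewrite mulr0 subr0].
Qed.

Lemma eq_add_op c c' : (forall la i, addable la i -> c la i = c' la i) ->
  add_op c = add_op c'.
Proof.
move=> cc'; apply: endoP => g la /=; apply: eq_bigr => i _.
by case: ifP => // ai; rewrite cc'.
Qed.

Lemma eq_rem_op c c' : (forall la i, removable la i -> c la i = c' la i) ->
  rem_op c = rem_op c'.
Proof.
move=> cc'; apply: endoP => g la /=; apply: eq_bigr => i _.
by case: ifP => // ai; rewrite cc'.
Qed.

Definition D_op : endo K partition := add_op (fun _ _ => 1).
Definition U_op : endo K partition := rem_op (fun _ _ => 1).
Definition vacuum : partition -> K := fun la => (la == point)%:R.
Definition vev (X : endo K partition) : K := X vacuum point.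

Lemma vev_is_scalar : scalar vev.
Proof. by move=> a X Y. Qed.
HB.instance Definition _ := GRing.isLinear.Build K (endo K partition) K _ vev vev_is_scalar.

Lemma not_removable0 i : removable point i = false.
Proof. by apply/negP => /removable_size. Qed.

Lemma vev_mulU X : vev (U_op * X) = 0.
Proof. by rewrite /vev /= big1 // => i _; rewrite not_removable0. Qed.

Lemma vev_mulD X : vev (X * D_op) = 0.
Proof.
rewrite /vev; change (X (D_op vacuum) point = 0).
have -> : D_op vacuum = fun=> 0; last exact: eapp0.
apply/funext => la /=; apply: big1 => i _; case: ifP => // ai.
rewrite /vacuum mul1r; case: eqP => // e.
by move: (psize_add_box ai); rewrite e.
Qed.

Lemma vev1 : vev 1 = 1.
Proof. by rewrite /vev /= /vacuum eqxx. Qed.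

Lemma vev_mul_diag X h : h point = 1 -> vev (X * diag_op h) = vev X.
Proof.
move=> h1; rewrite /vev; congr (X _ point); apply/funext => la /=.
by rewrite /vacuum; case: eqP => [->|]; rewrite ?h1 ?mul1r ?mulr0.
Qed.

End Operators.

Section ContentOperators.
Variables (K : fieldType) (z w : K).
Hypothesis zw : z * w = 1.

Local Notation D := (@D_op K).
Local Notation U := (@U_op K).
Local Notation kap := (2 - z - w).

Lemma ad_D_remz : ad D (rem_op (fun la i => z ^+ (rowlen la i).-1 * w ^+ i)) =
  diag_op (fun la => 1 - kap * content_gf z w la).
Proof.
rewrite /D_op ad_add_rem.
  congr diag_op; apply/funext => la; rewrite -(corner_sum zw (leqnn _)).
  congr (_ - _); apply: eq_bigr => i _; case: ifP => // ai.
  by rewrite rowlen_add_box // eqxx addn1.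
move=> la i j ij ai _; rewrite rowlen_add_box // (_ : j == i = false) ?addn0 //.
by rewrite eq_sym; apply/negbTE.
Qed.

Lemma ad_D_content : ad D (diag_op (content_gf z w)) =
  add_op (fun la i => z ^+ rowlen la i * w ^+ i).
Proof.
rewrite /D_op ad_add_diag; apply: eq_add_op => la i ai.
by rewrite mul1r content_gf_add_box // addrC addKr.
Qed.

Lemma ad_U_content : ad U (diag_op (content_gf z w)) =
  - rem_op (fun la i => z ^+ (rowlen la i).-1 * w ^+ i).
Proof.
transitivity (rem_op (fun la i => - (z ^+ (rowlen la i).-1 * w ^+ i))).
  rewrite /U_op ad_rem_diag; apply: eq_rem_op => la i ri.
  by rewrite mul1r (content_gf_rem_box z w ri) opprD addNKr.
apply: endoP => g la.
change (rem_op (fun la i => - (z ^+ (rowlen la i).-1 * w ^+ i)) g la =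
  - rem_op (fun la i => z ^+ (rowlen la i).-1 * w ^+ i) g la).
rewrite /= -sumrN; apply: eq_bigr => i _.
by case: ifP; rewrite ?oppr0 ?mulNr.
Qed.

End ContentOperators.

Local Close Scope ring_scope.

(** * PART Vev *)

Local Open Scope ring_scope.

Definition add_boxes la : seq partition :=
  [seq add_box la i | i <- iota 0 (size la).+1 & addable la i].

Fixpoint level n : seq partition :=
  if n is n'.+1 then undup (flatten [seq add_boxes la | la <- level n'])
  else [:: point].

Arguments level : simpl never.

Lemma level_uniq n : uniq (level n).
Proof. by case: n => [|n]; [|exact: undup_uniq]. Qed.

Lemma psize_eq0 la : (psize la == 0%N) = (la == point).
Proof.
apply/eqP/eqP => [la0|->//]; apply: partition_ext => i.
rewrite [RHS]rowlen_default //; apply/eqP; rewrite -leqn0.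
have [lai|ilt] := leqP (size la) i; first by rewrite rowlen_default.
by rewrite -la0 (psizeE (leqnn _)) (bigD1 (Ordinal ilt)) //= leq_addr.
Qed.

Lemma exists_removable la : la != point -> exists i, removable la i.
Proof.
rewrite -psize_eq0 => la0; exists (size la).-1.
have sz : (0 < size la)%N.
  rewrite lt0n; apply: contraNneq la0 => s0.
  by rewrite (psizeE (leqnn _)) s0 big_ord0.
by rewrite /removable prednK // rowlen_default // rowlen_gt0 prednK.
Qed.

Lemma mem_level n la : (la \in level n) = (psize la == n).
Proof.
elim: n la => [|n IH] la; first by rewrite inE psize_eq0.
rewrite [level n.+1]/(undup _) mem_undup; apply/flatten_mapP/eqP => [[mu mu_n]|la_n].
  move: mu_n; rewrite IH => /eqP mu_n /mapP[k].
  rewrite mem_filter => /andP[ak _] ->.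
  by rewrite psize_add_box // mu_n.
have la0 : la != point by rewrite -psize_eq0 la_n.
have [i ri] := exists_removable la0; have [ai e] := rem_boxK ri.
exists (rem_box la i); first by rewrite IH -eqSS -la_n -psize_rem_box.
apply/mapP; exists i; last by rewrite e.
by rewrite mem_filter ai mem_iota add0n ltnS addable_size.
Qed.

Lemma size_le_psize la : (size la <= psize la)%N.
Proof.
rewrite (psizeE (leqnn _)) -[leqLHS]card_ord -sum1_card.
by apply: leq_sum => i _; rewrite rowlen_gt0.
Qed.

Section Moments.
Variable K : fieldType.
Implicit Types (h g : partition -> K).

(** Both sides sum over the edges of Young's lattice between two levels. *)
Lemma sum_level_edges n (G : partition -> partition -> K) :
  \sum_(la <- level n) \sum_(0 <= i < (size la).+1)
     (if addable la i then G la (add_box la i) else 0) =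
  \sum_(mu <- level n.+1) \sum_(0 <= i < (size mu).+1)
     (if removable mu i then G (rem_box mu i) mu else 0).
Proof.
have ext (P : pred nat) (F : nat -> K) (m N : nat) : (m <= N)%N ->
    (forall i, P i -> (i < m)%N) ->
    \sum_(0 <= i < m) (if P i then F i else 0) =
    \sum_(0 <= i < N) (if P i then F i else 0).
  move=> mN Pm; rewrite [RHS](@big_cat_nat _ _ _ m) //=.
  rewrite [X in _ = _ + X]big_nat_cond [X in _ = _ + X]big1 ?addr0 //.
  by move=> i /andP[/andP[mi _] _]; case: ifP => // /Pm; rewrite ltnNge mi.
transitivity (\sum_(la <- level n) \sum_(mu <- level n.+1) \sum_(0 <= i < n.+2)
   (if addable la i && (add_box la i == mu) then G la mu else 0)).
  rewrite big_seq [RHS]big_seq; apply: eq_bigr => la.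
  rewrite mem_level => /eqP la_n.
  rewrite (ext _ _ _ n.+2); last 2 first.
    by rewrite ltnS (leq_trans (size_le_psize la)) // la_n leqnSn.
    by move=> i /addable_size.
  rewrite [RHS]exchange_big; apply: eq_bigr => i _ /=.
  case: (boolP (addable la i)) => ai /=; last by rewrite big1.
  rewrite (bigD1_seq (add_box la i)) ?level_uniq ?mem_level ?psize_add_box ?la_n //.
  rewrite eqxx big1 => [|mu]; last by rewrite eq_sym => /negbTE ->.
  by rewrite [RHS]addr0.
rewrite exchange_big big_seq [RHS]big_seq; apply: eq_bigr => mu.
rewrite mem_level => /eqP mu_n.
rewrite (ext _ _ _ n.+2); last 2 first.
  by rewrite ltnS -mu_n size_le_psize.
  by move=> i /removable_size; exact: ltnW.
rewrite exchange_big; apply: eq_bigr => i _ /=.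
case: (boolP (removable mu i)) => ri /=; last first.
  rewrite big1 // => la _; case: ifP => // /andP[ai /eqP e].
  by have [] := add_boxK ai; rewrite e (negbTE ri).
have [ai e] := rem_boxK ri.
rewrite (bigD1_seq (rem_box mu i)) ?level_uniq ?mem_level //; last first.
  by rewrite -eqSS -mu_n -psize_rem_box.
rewrite ai e eqxx big1 => [|la lane]; first by rewrite [LHS]addr0.
case: ifP => // /andP[ai' /eqP e'].
by case/eqP: lane; have [_ <-] := add_boxK ai'; rewrite e'.
Qed.

Lemma U_opn_vacuum n la :
  (U_op K ^+ n) (vacuum K) la = if psize la == n then #|Std la|%:R else 0.
Proof.
elim: n la => [|n IH] la.
  rewrite expr0 /= /vacuum psize_eq0; case: eqP => [->|//].
  by rewrite card_Std0.
rewrite exprS; change (U_op K ((U_op K ^+ n) (vacuum K)) la =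
  if psize la == n.+1 then #|Std la|%:R else 0).
rewrite {1}/U_op (rem_opE _ _ (leqnn _)).
case: (posnP (psize la)) => [la0|la_gt0].
  have -> : (psize la == n.+1) = false by rewrite la0.
  rewrite big1 // => i _; case: ifP => // ri.
  by move: (psize_rem_box ri); rewrite la0.
case: eqP => la_n.
  rewrite card_Std_rec // natr_sum [RHS]big_mkcond /=.
  apply: eq_bigr => i _; case: ifP => // ri.
  by rewrite mul1r IH -eqSS -psize_rem_box // la_n eqxx.
apply: big1 => i _; case: ifP => // ri.
rewrite mul1r IH -eqSS -psize_rem_box //.
by case: eqP => // /la_n.
Qed.

Lemma D_opn_point n g :
  (D_op K ^+ n) g point = \sum_(la <- level n) #|Std la|%:R * g la.
Proof.
suff -> : (D_op K ^+ n) g point =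
    \sum_(la <- level n) (U_op K ^+ n) (vacuum K) la * g la.
  rewrite big_seq [RHS]big_seq; apply: eq_bigr => la.
  by rewrite mem_level U_opn_vacuum => ->.
elim: n g => [|n IH] g; first by rewrite !expr0 /= big_seq1 /vacuum eqxx mul1r.
rewrite exprSr; change ((D_op K ^+ n) (D_op K g) point =
  \sum_(la <- level n.+1) (U_op K ^+ n.+1) (vacuum K) la * g la).
rewrite IH.
transitivity (\sum_(la <- level n) \sum_(0 <= i < (size la).+1)
  (if addable la i then (U_op K ^+ n) (vacuum K) la * g (add_box la i) else 0)).
  apply: eq_bigr => la _; rewrite mulr_sumr; apply: eq_bigr => i _.
  by case: ifP; rewrite ?mulr0 // mul1r.
rewrite (sum_level_edges n (fun la mu => (U_op K ^+ n) (vacuum K) la * g mu)).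
apply: eq_bigr => mu _; rewrite exprS.
change (\sum_(0 <= i < (size mu).+1) (if removable mu i
    then (U_op K ^+ n) (vacuum K) (rem_box mu i) * g mu else 0) =
  U_op K ((U_op K ^+ n) (vacuum K)) mu * g mu).
rewrite mulr_suml; apply: eq_bigr => i _.
by case: ifP; rewrite ?mul0r // mul1r.
Qed.

Lemma vev_level n h : vev (D_op K ^+ n * diag_op h * U_op K ^+ n) =
  \sum_(la <- level n) #|Std la|%:R ^+ 2 * h la.
Proof.
change ((D_op K ^+ n) (fun la => h la * (U_op K ^+ n) (vacuum K) la) point =
  \sum_(la <- level n) #|Std la|%:R ^+ 2 * h la).
rewrite D_opn_point big_seq [RHS]big_seq; apply: eq_bigr => la.
by rewrite mem_level U_opn_vacuum => ->; rewrite expr2 mulrCA mulrC.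
Qed.

End Moments.

Section ContentStatistic.
Variables (K : fieldType) (z w : K).
Hypothesis zw : z * w = 1.
Local Notation kap := (2 - z - w).

Definition content_statistic la : K := 1 - kap * content_gf z w la.

Lemma diag_content_statistic :
  diag_op content_statistic = 1 - kap *: diag_op (content_gf z w).
Proof.
apply: endoP => g la.
change (content_statistic la * g la = g la - kap * (content_gf z w la * g la)).
by rewrite /content_statistic mulrBl mul1r mulrA.
Qed.

Lemma ad_D_U : ad (D_op K) (U_op K) = 1.
Proof.
have -> : U_op K = rem_op (fun la i => 1 ^+ (rowlen la i).-1 * 1 ^+ i).
  by apply: eq_rem_op => la i _; rewrite !expr1n mulr1.
rewrite (ad_D_remz (mulr1 1)); apply: endoP => g la.
by rewrite /= [2 - 1 - 1](_ : _ = 0) ?mul0r ?subr0 ?mul1r //; ring.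
Qed.

Lemma ad_U_D_content_statistic :
  ad (U_op K) (ad (D_op K) (diag_op content_statistic)) =
  kap *: diag_op content_statistic.
Proof.
rewrite -(ad_DU_comm ad_D_U) {1}diag_content_statistic (adD (U_op K)).
rewrite ad_one add0r adN adZ (ad_U_content z w) scalerN opprK adZ.
by rewrite (ad_D_remz zw).
Qed.

Lemma content_statistic_point : content_statistic point = 1.
Proof. by rewrite /content_statistic content_gf0 mulr0 subr0. Qed.

End ContentStatistic.

Section SecondMoment.
Variables (K : numFieldType) (z w : K).
Hypothesis zw : z * w = 1.
Local Notation kap := (2 - z - w).

Lemma ad_ad_content_statistic :
  ad (ad (D_op K) (diag_op (content_statistic z w)))
     (diag_op (content_statistic w z)) = kap ^+ 2 *: D_op K.
Proof.
rewrite !diag_content_statistic (adD (D_op K)) ad_one add0r adN adZ ad_D_content.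
rewrite adD ad_one add0r adN adZ (ad_anti (- _)) adN adZ opprK.
rewrite (ad_anti (diag_op _)) ad_add_diag !scalerN opprK scalerA -addrA.
rewrite (addrC (- w)) addrA -expr2; congr (_ *: _).
apply: eq_add_op => la i ai; rewrite content_gf_add_box // addrC addKr mulrACA.
by rewrite -exprMn [w ^+ i * _]mulrC -exprMn zw !expr1n mulr1.
Qed.

Lemma second_moment n :
  \sum_(la <- level n) #|Std la|%:R ^+ 2 *
     (content_statistic z w la * content_statistic w z la) =
  n`!%:R * (1 + \sum_(k < n) 'C(n, k.+1)%:R * (-1) ^+ k.+1 / (k.+1)`!%:R *
     (kap ^+ k.+1 * ('C(k.+1.*2, k.+1)%:R - kap * 'C(k.*2, k)%:R))).
Proof.
have wz : w * z = 1 by rewrite mulrC.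
have kapC : 2 - w - z = kap by rewrite addrAC.
set H := diag_op (content_statistic z w); set H' := diag_op (content_statistic w z).
have HH' : GRing.comm H H' by apply: endoP => g la /=; rewrite mulrCA.
rewrite -(vev_level n (fun la => content_statistic z w la * content_statistic w z la)).
have -> : diag_op (fun la => content_statistic z w la * content_statistic w z la) = H * H'.
  by apply: endoP => g la /=; rewrite mulrA.
have LH X : vev (X * H) = vev X by apply: vev_mul_diag; exact: content_statistic_point.
have LH' X : vev (X * H') = vev X by apply: vev_mul_diag; exact: content_statistic_point.
have UDH := ad_U_D_content_statistic zw.
have UDH' := ad_U_D_content_statistic wz; rewrite kapC in UDH'.
have vk := @L_adU_adD_mul K _ _ _ (@vev K) (ad_D_U K) (@vev_mulD K) (@vev1 K) _ _ _
  UDH UDH' HH' ad_ad_content_statistic LH LH'.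
rewrite (@L_DnXUn K _ _ _ (@vev K) (ad_D_U K) (@vev_mulU K) (@vev_mulD K)) big_ord_recl.
have v0 : vev (H * H') = 1 by rewrite LH' -(mul1r H) LH vev1.
rewrite [X in _ * X + _](_ : _ = 1) //.
rewrite bin0 mul1n subn0 ffactnn expr0 !mulr1 mulrDr mulr1 mulr_sumr.
congr (_ + _).
apply: eq_bigr => k _; rewrite !lift0 vk natrM.
have nk : (k.+1 <= n)%N by [].
have -> : (n ^_ (n - k.+1))%:R = n`!%:R / (k.+1)`!%:R :> K.
  have f0 : (k.+1)`!%:R != 0 :> K by rewrite pnatr_eq0 -lt0n fact_gt0.
  by rewrite -(ffact_fact (leq_subr k.+1 n)) subKn // natrM mulfK.
by ring.
Qed.

End SecondMoment.

Local Close Scope ring_scope.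

(** * PART Core *)

Section RimHook.
Variables (la : partition) (a b : nat).

Definition hook_row i :=
  if i < a then rowlen la i else maxn (minn (rowlen la i) b) (rowlen la i.+1).-1.

Lemma hook_row_anti i : hook_row i.+1 <= hook_row i.
Proof.
rewrite /hook_row; have := rowlen_anti la (leqnSn i); have := rowlen_anti la (leqnSn i.+1).
by case: (ltnP i a); case: (ltnP i.+1 a); lia.
Qed.

Definition hook_removal := partition_of (size la) hook_row_anti.

Lemma rowlen_hook_removal i : rowlen hook_removal i = hook_row i.
Proof.
apply: rowlen_partition_of => j laj; rewrite /hook_row.
by rewrite !rowlen_default ?(leq_trans laj) // min0n if_same.
Qed.

Lemma young_hook_removal :
  young hook_removal = (young la `\` rim_hook la (a.+1, b.+1))%fset.
Proof.
apply/fsetP => -[x y]; rewrite in_fsetD.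
have -> : ((x, y) \in rim_hook la (a.+1, b.+1)) = ((x, y) \in young la) &&
    [&& a.+1 <= x, b.+1 <= y & (x.+1, y.+1) \notin young la].
  by rewrite /rim_hook inE /= inE.
rewrite !in_young_row /=.
case: x => [|x] //=; case: y => [|y] //=; rewrite ?andbF //.
rewrite rowlen_hook_removal /hook_row !ltnS.
have := rowlen_anti la (leqnSn x).
by case: (ltnP x a); lia.
Qed.

Hypothesis ab : b < rowlen la a.

Lemma foot_exists : exists i, [/\ a <= i, b < rowlen la i & rowlen la i.+1 <= b].
Proof.
have ex : exists i, b < rowlen la i by exists a.
have bnd i : b < rowlen la i -> i <= size la.
  by move=> h; apply: ltnW; rewrite -rowlen_gt0; apply: leq_ltn_trans h.
case: (ex_maxnP ex bnd) => i bi imax; exists i; split=> //; first exact: imax.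
by rewrite leqNgt; apply/negP => /imax; rewrite ltnn.
Qed.

Variable f : nat.
Hypothesis fP : [/\ a <= f, b < rowlen la f & rowlen la f.+1 <= b].

Lemma hook_telescope (V : zmodType) (psi : nat -> nat -> V) n :
  (forall r i, psi r.+1 i.+1 = psi r i) -> size la <= n ->
  (\sum_(i < n) psi (rowlen la i) i - \sum_(i < n) psi (rowlen hook_removal i) i =
   psi (rowlen la a) a - psi b f)%R.
Proof.
case: fP => af bf fb psiS lan.
have f_n : f < n by apply: leq_trans lan; rewrite -rowlen_gt0; apply: leq_ltn_trans bf.
have row_lt i : i < a -> rowlen hook_removal i = rowlen la i.
  by move=> ia; rewrite rowlen_hook_removal /hook_row ia.
have row_mid i : a <= i < f -> rowlen hook_removal i = (rowlen la i.+1).-1.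
  move=> /andP[ai i_f]; rewrite rowlen_hook_removal /hook_row ltnNge ai /=.
  by have := rowlen_anti la i_f; lia.
have row_f : rowlen hook_removal f = b.
  by rewrite rowlen_hook_removal /hook_row ltnNge af /=; lia.
have row_gt i : f < i -> rowlen hook_removal i = rowlen la i.
  move=> fi; rewrite rowlen_hook_removal /hook_row ltnNge (leq_trans af (ltnW fi)) /=.
  by have := rowlen_anti la fi; have := rowlen_anti la (leqnSn i); lia.
pose d i : V := (psi (rowlen la i) i - psi (rowlen hook_removal i) i)%R.
have d_lt : (\sum_(0 <= i < a) d i = 0)%R.
  rewrite big_nat_cond big1 // => i /andP[/andP[_ ia] _].
  by rewrite /d row_lt // subrr.
have d_gt : (\sum_(f.+1 <= i < n) d i = 0)%R.
  rewrite big_nat_cond big1 // => i /andP[/andP[fi _] _].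
  by rewrite /d row_gt // subrr.
rewrite -sumrB -(big_mkord xpredT d).
rewrite (big_cat_nat (n := f.+1)) //= d_gt addr0.
rewrite (big_cat_nat (n := a)) //=; last exact: ltnW.
rewrite d_lt add0r /d.
rewrite big_nat_recr //= row_f.
have -> : (\sum_(a <= i < f) (psi (rowlen la i) i - psi (rowlen hook_removal i) i) =
   \sum_(a <= i < f) (psi (rowlen la i) i - psi (rowlen la i.+1) i.+1))%R.
  apply: eq_big_nat => i i_af; congr (_ - _)%R; rewrite row_mid //.
  case/andP: i_af => _ i_f; have := rowlen_anti la i_f.
  by case: (rowlen la i.+1) => [|r] rf /=; [lia|rewrite psiS].
have -> : (\sum_(a <= i < f) (psi (rowlen la i) i - psi (rowlen la i.+1) i.+1) =
   psi (rowlen la a) a - psi (rowlen la f) f)%R.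
  rewrite -[RHS]opprB -(telescope_sumr (fun i => psi (rowlen la i) i)) //.
  by rewrite -sumrN; apply: eq_bigr => i _; rewrite opprB.
by rewrite addrA subrK.
Qed.

Lemma psize_hook_removal :
  psize la + a + b = psize hook_removal + rowlen la a + f.
Proof.
pose n := (size la + size hook_removal)%N.
have psiS r i : (r.+1%:Z - i.+1%:Z = r%:Z - i%:Z)%R by lia.
have := hook_telescope psiS (leq_addr (size hook_removal) _).
rewrite -sumrB.
have -> : (\sum_(i < n) ((rowlen la i)%:Z - i%:Z - ((rowlen hook_removal i)%:Z - i%:Z)) =
    (psize la)%:Z - (psize hook_removal)%:Z)%R.
  rewrite (psizeE (leq_addr (size hook_removal) _)) (psizeE (leq_addl (size la) _)).
  rewrite !(big_morph Posz PoszD (erefl _)) -sumrB; apply: eq_bigr => i _.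
  by rewrite opprB addrA subrK.
lia.
Qed.

End RimHook.

Lemma young_inj : injective young.
Proof.
move=> la mu e; apply: partition_ext => i.
have lt_row nu j : (j < rowlen nu i) = ((i.+1, j.+1) \in young nu).
  by rewrite in_young_row.
have le_row nu nu' : young nu = young nu' -> rowlen nu i <= rowlen nu' i.
  move=> eY; rewrite leqNgt; apply/negP; rewrite lt_row eY -lt_row.
  by rewrite ltnn.
by apply/eqP; rewrite eqn_leq !le_row.
Qed.

Lemma card_young la : #|` young la| = psize la.
Proof.
move: {2}(psize la) (erefl (psize la)) => n; elim: n la => [|n IH] la la_n.
  move/eqP: (la_n); rewrite psize_eq0 => /eqP ->; apply/eqP; rewrite cardfs_eq0.
  apply/eqP/fsetP => -[x y]; rewrite in_young_row in_fset0 rowlen_default //=; lia.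
have la0 : la != point by rewrite -psize_eq0 la_n.
have [i ri] := exists_removable la0.
rewrite (cardfsD1 (corner la i)) corner_in_young ?removable_size // -young_rem_box //.
rewrite (IH (rem_box la i)); last by apply: succn_inj; rewrite -psize_rem_box.
by rewrite add1n -psize_rem_box.
Qed.

Lemma young_cell la c : c \in young la ->
  exists a b, c = (a.+1, b.+1) /\ b < rowlen la a.
Proof.
case: c => [[|a] [|b]]; rewrite in_young_row //= ?andbF // => h.
by exists a, b.
Qed.

Lemma card_rim_hook la a b : b < rowlen la a ->
  psize la = #|` rim_hook la (a.+1, b.+1)| + psize (hook_removal la a b).
Proof.
move=> ab; rewrite -!card_young young_hook_removal.
rewrite -(cardfsID (rim_hook la (a.+1, b.+1)) (young la)); congr (_ + _).
congr (#|` _|); apply/fsetIidPr/fsubsetP => p.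
by rewrite /rim_hook inE => /andP[].
Qed.

Lemma is_rim_hook_atE la a b f e : b < rowlen la a ->
  [/\ a <= f, b < rowlen la f & rowlen la f.+1 <= b] ->
  is_rim_hook_at e la (a.+1, b.+1) = (rowlen la a + f == e + a + b).
Proof.
move=> ab fP; rewrite /is_rim_hook_at in_young_row /= ab /=.
have h1 := card_rim_hook ab; have h2 := psize_hook_removal ab fP.
by apply/eqP/eqP; move: h1 h2; move: #|` _| (psize _) (psize _) => x y v; lia.
Qed.

Lemma remove_rim_hookP e la mu : remove_rim_hook e la mu ->
  exists a b, [/\ b < rowlen la a, is_rim_hook_at e la (a.+1, b.+1) &
    mu = hook_removal la a b].
Proof.
move=> [c hc ymu]; have /andP[/young_cell[a [b [cE ab]]] _] := hc.
rewrite cE in hc ymu.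
by exists a, b; split=> //; apply: young_inj; rewrite ymu young_hook_removal.
Qed.

Lemma psize_remove_rim_hook e la mu : 0 < e -> remove_rim_hook e la mu ->
  psize mu < psize la.
Proof.
move=> e0 /remove_rim_hookP[a [b [ab /andP[_ /eqP ce] ->]]].
by rewrite (card_rim_hook ab) ce; lia.
Qed.

Lemma ecore_exists e la : 0 < e -> exists mu, is_ecore e la mu.
Proof.
move=> e0; have [n] := ubnP (psize la); elim: n la => // n IH la la_n.
have [[c hc]|no] := pselect (exists c, is_rim_hook_at e la c); last first.
  exists la; split; first exact: rt_refl.
  by move=> c; apply/negP => hc; apply: no; exists c.
have /andP[/young_cell[a [b [cE ab]]] _] := hc.
have rm : remove_rim_hook e la (hook_removal la a b).
  by exists c => //; rewrite cE young_hook_removal.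
have [|mu [lamu mu_core]] := IH (hook_removal la a b).
  by apply: leq_trans (psize_remove_rim_hook e0 rm) _.
exists mu; split=> //; apply: rt_trans lamu; exact: rt_step.
Qed.

Lemma ecoreP e la : 0 < e -> is_ecore e la (ecore e la).
Proof. by move=> /(ecore_exists la)[mu hmu]; exact: (xgetPex la (ex_intro _ mu hmu)). Qed.

Section RootOfUnity.
Variables (K : fieldType) (z w : K) (e : nat).
Hypotheses (zw : (z * w = 1)%R) (ze : (z ^+ e = 1)%R) (z1 : z != 1%R).

(** The contents of an e-rim hook are e consecutive integers. *)
Lemma content_gf_remove la mu : remove_rim_hook e la mu ->
  content_gf z w mu = content_gf z w la.
Proof.
move=> /remove_rim_hookP[a [b [ab hk ->]]].
have [f fP] := foot_exists ab.
move: hk; rewrite (is_rim_hook_atE _ ab fP) => /eqP hk.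
pose n := (size la + size (hook_removal la a b))%N.
have psiS r i : (z ^+ r.+1 * w ^+ i.+1 = z ^+ r * w ^+ i)%R.
  by rewrite !exprS mulrACA zw mul1r.
have := hook_telescope ab fP psiS (leq_addr (size (hook_removal la a b)) _).
have -> : (z ^+ rowlen la a * w ^+ a = z ^+ b * w ^+ f)%R.
  case: fP => af _ _.
  have -> : (z ^+ b * w ^+ f = z ^+ (b + e) * w ^+ f)%R by rewrite exprD ze mulr1.
  have -> : (b + e = rowlen la a + (f - a))%N by lia.
  rewrite exprD -mulrA; congr (_ * _)%R.
  by rewrite -{2}(subnK af) exprD mulrA -exprMn zw expr1n mul1r.
rewrite subrr => /eqP; rewrite subr_eq0 => /eqP h.
have z1' : (z - 1 != 0)%R by rewrite subr_eq0.
apply: (mulfI z1').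
rewrite (content_gf_beta _ _ (leq_addr (size (hook_removal la a b)) (size la))).
rewrite (content_gf_beta _ _ (leq_addl (size la) (size (hook_removal la a b)))).
have split_sum (g : nat -> nat) : (\sum_(i < n) (z ^+ g i - 1) * w ^+ i =
   \sum_(i < n) z ^+ g i * w ^+ i - \sum_(i < n) w ^+ i)%R.
  by rewrite -sumrB; apply: eq_bigr => i _; rewrite mulrBl mul1r.
by rewrite !split_sum h.
Qed.

Lemma content_gf_ecore la : 0 < e -> content_gf z w (ecore e la) = content_gf z w la.
Proof.
move=> e0; have [+ _] := ecoreP la e0.
move: (ecore e la) => mu; elim=> {la mu} [la mu|//|la mu nu _ h1 _ h2].
  exact: content_gf_remove.
by rewrite h2 h1.
Qed.

End RootOfUnity.

(** * PART Flush *)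

Definition beta_number la N i := rowlen la i + (N - i.+1).
Definition beta_set la N : seq nat := mkseq (beta_number la N) N.

Lemma beta_number_lt la N i j : i < j -> j < N ->
  beta_number la N j < beta_number la N i.
Proof. by move=> ij jN; have := rowlen_anti la (ltnW ij); rewrite /beta_number; lia. Qed.

Lemma beta_set_uniq la N : uniq (beta_set la N).
Proof.
apply/mkseq_uniqP => i j; rewrite !inE => iN jN e.
by case: (ltngtP i j) => // ij; have := @beta_number_lt la N _ _ ij; rewrite e ltnn; [move=> /(_ jN)|move=> /(_ iN)].
Qed.

Lemma mem_beta_set la N i : i < N -> beta_number la N i \in beta_set la N.
Proof. by move=> iN; apply/mapP; exists i; rewrite ?mem_iota. Qed.

Lemma beta_setP la N x :
  reflect (exists2 i, i < N & x = beta_number la N i) (x \in beta_set la N).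
Proof.
apply: (iffP mapP) => [[j]|[i iN ->]]; last by exists i; rewrite ?mem_iota.
by rewrite mem_iota add0n /= => jN ->; exists j.
Qed.

Lemma sum_beta_set la N : size la <= N ->
  (\sum_(x <- beta_set la N) x).*2 = (psize la).*2 + N * N.-1.
Proof.
move=> laN; rewrite big_map (_ : iota 0 N = index_iota 0 N); last first.
  by rewrite /index_iota subn0.
rewrite big_split /= big_mkord -(psizeE laN) doubleD; congr (_ + _).
rewrite big_mkord (reindex_inj rev_ord_inj) /=.
rewrite (eq_bigr (fun i : 'I_N => i : nat)); last by move=> i _; have := ltn_ord i; lia.
by elim: N {laN} => [|N IH]; rewrite ?big_ord0 // big_ord_recr /= doubleD IH; nia.
Qed.

(** If x is in the beta set and x - e is not, the corresponding row contains a
   box of hook length e. *)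
Lemma core_flush e la N x : 0 < e -> size la <= N ->
  (forall c, ~~ is_rim_hook_at e la c) ->
  x \in beta_set la N -> e <= x -> x - e \in beta_set la N.
Proof.
move=> e0 laN no /beta_setP[a aN ->] ex; apply: contraT => xe.
set t := beta_number la N a - e in xe.
have ne i : i < N -> beta_number la N i != t.
  by move=> iN; apply: contraNneq xe => <-; exact: mem_beta_set.
have ta : t < beta_number la N a by rewrite /t; lia.
pose P i := (i < N) && (t < beta_number la N i).
have exP : exists i, P i by exists a; rewrite /P aN.
have bndP i : P i -> i <= N by case/andP => /ltnW.
case: (ex_maxnP exP bndP) => f /andP[fN tf] fmax.
have af : a <= f by apply: fmax; rewrite /P aN.
have tf1 : f.+1 < N -> beta_number la N f.+1 < t.
  move=> f1N; rewrite ltn_neqAle ne //= leqNgt; apply/negP => h.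
  by have := fmax f.+1; rewrite /P f1N h ltnn => /(_ isT).
have tN : N - f.+1 <= t.
  have [|f1N] := leqP N f.+1; first by lia.
  by have := tf1 f1N; rewrite /beta_number; lia.
pose b := t - (N - f.+1).
have bf : b < rowlen la f by move: tf; rewrite /b /beta_number; lia.
have fb : rowlen la f.+1 <= b.
  have [Nf|f1N] := leqP N f.+1.
    by rewrite rowlen_default // (leq_trans laN).
  by have := tf1 f1N; rewrite /b /beta_number; lia.
have ab : b < rowlen la a by apply: leq_trans bf _; exact: rowlen_anti.
have := no (a.+1, b.+1); rewrite (@is_rim_hook_atE la a b f) //.
by move: ex tN; rewrite /b /t /beta_number; lia.
Qed.

Section Flush.
Variables (s : seq nat) (e : nat).
Hypotheses (e0 : 0 < e) (su : uniq s).
Hypothesis flush : forall x, x \in s -> e <= x -> x - e \in s.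

Lemma flush_count x : x \in s ->
  count (fun y => (y < x) && (y == x %[mod e])) s = x %/ e.
Proof.
move=> xs; rewrite -size_filter -[RHS](size_iota 0) -[size (iota _ _)](size_map (fun m => x %% e + m * e)).
apply: perm_size; apply: uniq_perm; first exact: filter_uniq.
  rewrite map_inj_in_uniq ?iota_uniq // => i j _ _ /addnI/eqP.
  by rewrite eqn_pmul2r // => /eqP.
have down m : m <= x %/ e -> x - m * e \in s.
  elim: m => [|m IH] mx; first by rewrite mul0n subn0.
  have h : m.+1 * e <= x by rewrite -leq_divRL.
  have := flush (IH (ltnW mx)); rewrite mulSn in h *.
  by rewrite -subnDA addnC; apply; lia.
move=> y; rewrite mem_filter; apply/andP/mapP => [[/andP[yx /eqP yxe] ys]|[m]].
  exists (y %/ e); last by rewrite -yxe addnC -divn_eq.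
  rewrite mem_iota add0n /= ltn_divLR //.
  by move: yx; rewrite {1}(divn_eq x e) {1}(divn_eq y e) yxe ltn_add2r ltn_pmul2r // ltn_divLR.
rewrite mem_iota add0n /= => mx ->.
split.
  have h : m * e < x %/ e * e by rewrite ltn_pmul2r.
  rewrite addnC modnMDl modn_mod eqxx andbT.
  by rewrite {2}(divn_eq x e) ltn_add2r.
have -> : x %% e + m * e = x - (x %/ e - m) * e.
  by rewrite mulnBl {2}(divn_eq x e) subnBA ?leq_mul2r ?(ltnW mx) ?orbT //; lia.
by apply: down; exact: leq_subr.
Qed.

(** Each pair of congruent elements is counted at its largest one. *)
Lemma flush_pairs :
  \sum_(x <- s) \sum_(y <- s) (x == y %[mod e]) = \sum_(x <- s) (x %/ e).*2.+1.
Proof.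
have low : \sum_(x <- s) \sum_(y <- s) ((y < x) && (y == x %[mod e])) = \sum_(x <- s) x %/ e.
  rewrite big_seq [RHS]big_seq; apply: eq_bigr => x xs.
  by rewrite -(flush_count xs) -sum1_count [RHS]big_mkcond; apply: eq_bigr => y _; case: (_ && _).
have high : \sum_(x <- s) \sum_(y <- s) ((x < y) && (y == x %[mod e])) = \sum_(x <- s) x %/ e.
  rewrite exchange_big -low; apply: eq_bigr => x _; apply: eq_bigr => y _.
  by rewrite eq_sym.
have diag : \sum_(x <- s) \sum_(y <- s) (x == y) = \sum_(x <- s) 1.
  rewrite big_seq [RHS]big_seq; apply: eq_bigr => x xs.
  rewrite (bigD1_seq x) //= eqxx big1 // => y; rewrite eq_sym => /negbTE ->//.
transitivity (\sum_(x <- s) x %/ e + \sum_(x <- s) x %/ e + \sum_(x <- s) 1); last first.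
  by rewrite -!big_split; apply: eq_bigr => x _ /=; lia.
rewrite -{1}low -high -diag -!big_split; apply: eq_bigr => x _.
rewrite -!big_split; apply: eq_bigr => y _ /=.
by rewrite [y == x %[mod e]]eq_sym; case: (ltngtP x y) => [||->] /=; rewrite ?eqxx //; lia.
Qed.
End Flush.

Local Open Scope ring_scope.

Section Fourier.
Variables (K : fieldType) (om : K) (e : nat).
Hypothesis e1 : (1 < e)%N.
Hypothesis om_prim : e.-primitive_root om.
Let e0 : (0 < e)%N := ltnW e1.
Let zeta (j : nat) : K := om ^+ j.
Let zeta' (j : nat) : K := om ^+ (j * e.-1).

Lemma sum_prim_root m : (\sum_(1 <= j < e) om ^+ (j * m)) =
  (if (e %| m)%N then e%:R else 0) - 1 :> K.
Proof.
have -> : \sum_(1 <= j < e) om ^+ (j * m) = \sum_(0 <= j < e) om ^+ (j * m) - 1.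
  by rewrite [in RHS]big_ltn // mul0n expr0 addrAC subrr add0r.
congr (_ - _); case: ifP => em.
  rewrite (eq_bigr (fun _ => 1)); last first.
    by move=> j _; apply/eqP; rewrite -(prim_order_dvd om_prim) dvdn_mull.
  by rewrite sumr_const_nat subn0.
have om1 : om ^+ m - 1 != 0 by rewrite subr_eq0 -(prim_order_dvd om_prim) em.
apply: (mulfI om1); rewrite mulr0 big_mkord.
rewrite (eq_bigr (fun i : 'I_e => (om ^+ m) ^+ i)); last by move=> i _; rewrite -exprM mulnC.
by rewrite -subrX1 -exprM mulnC exprM (prim_expr_order om_prim) expr1n subrr.
Qed.

Lemma zeta_neq1 j : (0 < j < e)%N -> zeta j != 1.
Proof.
move=> /andP[j0 je]; rewrite /zeta -(prim_order_dvd om_prim).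
by apply/negP => /dvdn_leq; rewrite j0 => /(_ isT); rewrite leqNgt je.
Qed.

Lemma zetaK j : zeta j * zeta' j = 1.
Proof.
rewrite /zeta /zeta' -exprD -mulnS prednK // mulnC exprM.
by rewrite (prim_expr_order om_prim) expr1n.
Qed.

Lemma zeta'_neq1 j : (0 < j < e)%N -> zeta' j != 1.
Proof.
by move=> je; apply: contraNneq (zeta_neq1 je) => h; have := zetaK j; rewrite h mulr1 => ->.
Qed.

Lemma zeta_expe j : zeta j ^+ e = 1.
Proof. by rewrite /zeta -exprM mulnC exprM (prim_expr_order om_prim) expr1n. Qed.
Lemma zeta'_expe j : zeta' j ^+ e = 1.
Proof. by rewrite /zeta' -exprM mulnC exprM (prim_expr_order om_prim) expr1n. Qed.

Lemma sum_zeta r : (\sum_(1 <= j < e) zeta j ^+ r) = (if (e %| r)%N then e%:R else 0) - 1 :> K.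
Proof. by rewrite -sum_prim_root; apply: eq_bigr => j _; rewrite -exprM. Qed.

Lemma coprime_pred : coprime e e.-1.
Proof. by rewrite -{1}(prednK e0) coprimeSn. Qed.

Lemma sum_zeta' r : (\sum_(1 <= j < e) zeta' j ^+ r) = (if (e %| r)%N then e%:R else 0) - 1 :> K.
Proof.
have <- : (e %| e.-1 * r)%N = (e %| r)%N by rewrite Gauss_dvdr // coprime_pred.
by rewrite -sum_prim_root; apply: eq_bigr => j _; rewrite -exprM mulnA.
Qed.

(** The discrete Fourier transform of the sawtooth. *)
Lemma sawtooth r : (r < e)%N ->
  \sum_(1 <= j < e) (zeta j ^+ r / (1 - zeta' j) + zeta' j ^+ r / (1 - zeta j)) =
  e%:R - 1 - r%:R *+ 2 :> K.
Proof.
elim: r => [_|r IH re].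
  rewrite mul0rn subr0 (eq_big_nat _ _ (F2 := fun=> 1)).
    by rewrite sumr_const_nat natrB.
  move=> j je; rewrite !expr0; have := zetaK j.
  have : 1 - zeta j != 0 by rewrite subr_eq0 eq_sym zeta_neq1.
  have : 1 - zeta' j != 0 by rewrite subr_eq0 eq_sym zeta'_neq1.
  move: (zeta j) (zeta' j) => z w hw hz zw.
  have -> : 1 / (1 - w) + 1 / (1 - z) = (2 - z - w) / ((1 - z) * (1 - w)).
    by field; rewrite hz hw.
  have -> : (1 - z) * (1 - w) = 2 - z - w + (z * w - 1) by ring.
  rewrite zw subrr addr0 divff // (_ : 2 - z - w = (1 - z) * (1 - w)).
    exact: mulf_neq0.
  have -> : (1 - z) * (1 - w) = 2 - z - w + (z * w - 1) by ring.
  by rewrite zw subrr addr0.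
have step j : (1 <= j < e)%N ->
    zeta j ^+ r.+1 / (1 - zeta' j) + zeta' j ^+ r.+1 / (1 - zeta j) =
    (zeta j ^+ r / (1 - zeta' j) + zeta' j ^+ r / (1 - zeta j)) +
    (zeta j ^+ r.+1 + zeta' j ^+ r.+1).
  move=> je; have := zetaK j.
  have : 1 - zeta j != 0 by rewrite subr_eq0 eq_sym zeta_neq1.
  have : 1 - zeta' j != 0 by rewrite subr_eq0 eq_sym zeta'_neq1.
  move: (zeta j) (zeta' j) => z w hw hz zw.
  have h (x y : K) : x * y = 1 -> 1 - y != 0 ->
      x ^+ r.+1 / (1 - y) = x ^+ r / (1 - y) + x ^+ r.+1.
    move=> xy hy; apply: (mulIf hy); rewrite mulrDl !divfK //.
    by rewrite mulrBr mulr1 exprSr -mulrA xy mulr1 addrCA subrr addr0.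
  by rewrite (h z w) // (h w z) 1?mulrC // addrACA.
rewrite (eq_big_nat _ _ step) big_split /= (IH (ltnW re)) big_split /=.
rewrite sum_zeta sum_zeta' gtnNdvd //= -natr1; ring.
Qed.

Lemma sawtooth_mod x :
  \sum_(1 <= j < e) (zeta j ^+ x / (1 - zeta' j) + zeta' j ^+ x / (1 - zeta j)) =
  e%:R - 1 - (x %% e)%:R *+ 2 :> K.
Proof.
rewrite -sawtooth ?ltn_mod //; apply: eq_bigr => j _.
by rewrite -[zeta j ^+ x](expr_mod _ (zeta_expe j)) -[zeta' j ^+ x](expr_mod _ (zeta'_expe j)).
Qed.

Lemma sum_zeta_pair x y : \sum_(1 <= j < e) zeta j ^+ x * zeta' j ^+ y =
  (if x == y %[mod e] then e%:R else 0) - 1 :> K.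
Proof.
have <- : (e %| x + e.-1 * y)%N = (x == y %[mod e]).
  have -> : (e %| x + e.-1 * y)%N = (x + e.-1 * y == 0 %[mod e]) by rewrite mod0n.
  rewrite -(eqn_modDr y) add0n -addnA -mulSnr prednK // addnC mulnC modnMDl.
  by [].
rewrite -sum_prim_root; apply: eq_bigr => j _.
by rewrite /zeta /zeta' -!exprM -exprD mulnDr mulnA.
Qed.

Variable (la : partition).
Hypothesis la_core : forall c, ~~ is_rim_hook_at e la c.

Let N := ((size la).+1 * e)%N.
Let s := beta_set la N.
Let lapN : (size la <= N)%N. Proof. by rewrite (leq_trans (leqnSn _)) // leq_pmulr. Qed.

Let N0 : (0 < N)%N. Proof. by rewrite muln_gt0. Qed.

Lemma beta_set_content (z w : K) : z * w = 1 -> z ^+ e = 1 -> w ^+ e = 1 -> w != 1 ->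
  \sum_(x <- s) z ^+ x = (1 - w) * content_gf z w la.
Proof.
move=> zw ze we w1.
have zwn n : z ^+ n * w ^+ n = 1 by rewrite -exprMn zw expr1n.
have zN : z ^+ N.-1 = w.
  rewrite -[LHS]mulr1 -zw mulrA -exprSr prednK //.
  by rewrite /N mulnC exprM ze expr1n mul1r.
have -> : 1 - w = w * (z - 1) by rewrite mulrBr mulr1 mulrC zw.
rewrite -mulrA (content_gf_beta z w lapN).
have -> : \sum_(i < N) (z ^+ rowlen la i - 1) * w ^+ i =
   \sum_(i < N) z ^+ rowlen la i * w ^+ i - \sum_(i < N) w ^+ i.
  by rewrite -sumrB; apply: eq_bigr => i _; rewrite mulrBl mul1r.
have -> : \sum_(i < N) w ^+ i = 0.
  have w1' : w - 1 != 0 by rewrite subr_eq0.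
  by apply: (mulfI w1'); rewrite -subrX1 mulr0 /N mulnC exprM we expr1n subrr.
rewrite subr0 /s big_map (_ : iota 0 N = index_iota 0 N) ?big_mkord; last first.
  by rewrite /index_iota subn0.
rewrite -{1}zN mulr_sumr; apply: eq_bigr => i _; rewrite /beta_number exprD.
rewrite mulrCA; congr (_ * _).
have -> : N.-1 = (N - i.+1 + i)%N by have := ltn_ord i; lia.
by rewrite exprD -mulrA zwn mulr1.
Qed.

Theorem core_size : (psize la)%:R *+ 2 =
  \sum_(1 <= j < e)
     (content_statistic (zeta j) (zeta' j) la * content_statistic (zeta' j) (zeta j) la - 1)
       / (2 - zeta j - zeta' j) :> K.
Proof.
pose p j := \sum_(x <- s) zeta j ^+ x; pose p' j := \sum_(x <- s) zeta' j ^+ x.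
have term j : (1 <= j < e)%N ->
    (content_statistic (zeta j) (zeta' j) la * content_statistic (zeta' j) (zeta j) la - 1)
       / (2 - zeta j - zeta' j) =
    p j * p' j - (p j / (1 - zeta' j) + p' j / (1 - zeta j)).
  move=> je.
  rewrite /p /p' (beta_set_content (zetaK j) (zeta_expe j) (zeta'_expe j) (zeta'_neq1 je)).
  rewrite (beta_set_content (etrans (mulrC _ _) (zetaK j)) (zeta'_expe j) (zeta_expe j) (zeta_neq1 je)).
  rewrite /content_statistic.
  have := zetaK j.
  have : 1 - zeta j != 0 by rewrite subr_eq0 eq_sym zeta_neq1.
  have : 1 - zeta' j != 0 by rewrite subr_eq0 eq_sym zeta'_neq1.
  move: (content_gf _ _ _) (content_gf _ _ _) => f f'.
  move: (zeta j) (zeta' j) => z w hw hz zw.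
  have k1 : (1 - z) * (1 - w) = 2 - z - w.
    have -> : (1 - z) * (1 - w) = 2 - z - w + (z * w - 1) by ring.
    by rewrite zw subrr addr0.
  have k2 : (1 - z) * (1 - w) = 2 - w - z by rewrite k1 addrAC.
  by rewrite -k2 -k1; field; rewrite hz hw.
rewrite (eq_big_nat _ _ term) sumrB.
have -> : \sum_(1 <= j < e) p j * p' j =
    e%:R * (\sum_(x <- s) (x %/ e).*2.+1)%:R - (N ^ 2)%:R.
  rewrite -(flush_pairs e0 (beta_set_uniq la N) (fun x => @core_flush e la N x e0 lapN la_core)).
  have sum1 : \sum_(x <- s) 1 = N%:R :> K.
    by rewrite big_const_seq count_predT iter_addr_0 size_mkseq.
  have -> : (N ^ 2)%:R = \sum_(x <- s) \sum_(y <- s) 1 :> K.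
    rewrite (eq_bigr (fun=> N%:R * 1)) => [|x _]; last by rewrite mulr1.
    by rewrite -mulr_sumr sum1 -natrM.
  rewrite natr_sum mulr_sumr -sumrB.
  under eq_bigr => j _ do rewrite mulr_suml.
  rewrite exchange_big /=; apply: eq_bigr => x _.
  rewrite natr_sum mulr_sumr -sumrB.
  under eq_bigr => j _ do rewrite mulr_sumr.
  rewrite exchange_big /=; apply: eq_bigr => y _.
  by rewrite sum_zeta_pair; case: eqP => _; rewrite ?mulr1 ?mulr0.
have -> : \sum_(1 <= j < e) (p j / (1 - zeta' j) + p' j / (1 - zeta j)) =
    \sum_(x <- s) (e%:R - 1 - (x %% e)%:R *+ 2).
  under [RHS]eq_bigr => x _ do rewrite -sawtooth_mod.
  rewrite [RHS]exchange_big /=; apply: eq_bigr => j _.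
  by rewrite big_split /= !mulr_suml.
have sz : size s = N by rewrite size_mkseq.
rewrite sumrB big_const_seq count_predT iter_addr_0 sz sumrMnl -natr_sum.
have : (e * (\sum_(x <- s) (x %/ e).*2.+1) + (\sum_(x <- s) x %% e).*2 + N =
   (psize la).*2 + N ^ 2 + e * N)%N.
  have -> : (e * (\sum_(x <- s) (x %/ e).*2.+1) + (\sum_(x <- s) x %% e).*2 =
     (\sum_(x <- s) x).*2 + e * N)%N.
    rewrite -[X in (_ + e * X)%N]sz -sum1_size -!muln2 !big_distrl !big_distrr /= -!big_split.
    by apply: eq_bigr => x _ /=; have := divn_eq x e; lia.
  by rewrite sum_beta_set //; have := prednK N0; nia.
move: (\sum_(x <- s) (x %/ e).*2.+1)%N (\sum_(x <- s) x %% e)%N (psize la) (N) => A B m n.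
move/(congr1 (fun n => n%:R : K)); rewrite !natrD -!muln2 !natrM => h.
rewrite -[LHS]mulr_natr -(mulr_natr (e%:R - 1)) -[B%:R *+ 2]mulr_natr.
have -> : m%:R * 2 =
   e%:R * A%:R + B%:R * 2 + n%:R - n%:R * n%:R - e%:R * n%:R :> K by rewrite h; ring.
by ring.
Qed.

End Fourier.

Local Close Scope ring_scope.

(** * PART Trig *)

Local Open Scope classical_set_scope.
Local Open Scope ring_scope.

Section Trig.
Variable R : realType.
Implicit Types x y : R.

Lemma sin_MVT x : 0 < x -> exists2 c, 0 < c < x & sin x = cos c * x.
Proof.
move=> x0; have [|c cx] := @MVT R sin cos 0 x x0 (fun y _ => is_derive_sin y).
  by apply: continuous_subspaceT; exact: continuous_sin.
by rewrite sin0 !subr0 => ->; exists c.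
Qed.

Lemma sin_le x : 0 <= x -> sin x <= x.
Proof.
rewrite le_eqVlt => /predU1P[<-|x0]; first by rewrite sin0.
by have [c _ ->] := sin_MVT x0; rewrite ler_piMl ?cos_le1 // ltW.
Qed.

Lemma norm_sin_le x : `|sin x| <= `|x|.
Proof.
wlog x0 : x / 0 <= x => [h|].
  have [/h //|x0] := leP 0 x.
  by rewrite -normrN -sinN -[leRHS]normrN; apply: h; rewrite oppr_ge0 ltW.
have [x1|x1] := leP x 1; last by rewrite (le_trans (sin_max x)) // ger0_norm // ltW.
have s0 : 0 <= sin x by apply: sin_ge0_pi; rewrite x0 (le_trans x1) // (le_trans _ (pi_ge2 R)) // ler1n.
by rewrite !ger0_norm // sin_le.
Qed.

Lemma one_sub_cos x : 1 - cos x = 2 * sin (x / 2) ^+ 2.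
Proof. by rewrite {1}[x](_ : _ = (x / 2) *+ 2) ?cos_mulr2n ?cos2sin2; [ring|field]. Qed.

Lemma one_sub_cos_le x : 1 - cos x <= x ^+ 2 / 2.
Proof.
rewrite one_sub_cos; have := norm_sin_le (x / 2).
rewrite -[_ <= _](@ler_sqr R) ?nnegrE ?normr_ge0 // !real_normK ?num_real //.
by rewrite expr_div_n; lra.
Qed.

Lemma sin_ge x : 0 <= x -> x - x ^+ 3 / 2 <= sin x.
Proof.
rewrite le_eqVlt => /predU1P[<-|x0]; first by rewrite sin0 expr0n /= mul0r subr0.
have [c /andP[c0 cx] ->] := sin_MVT x0.
have h1 := one_sub_cos_le c.
have h2 : c ^+ 2 <= x ^+ 2 by rewrite ler_sqr ?nnegrE ltW.
have h3 : 1 - x ^+ 2 / 2 <= cos c by lra.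
have -> : x - x ^+ 3 / 2 = (1 - x ^+ 2 / 2) * x by field.
by rewrite ler_wpM2r // ltW.
Qed.

Lemma cos_sub x y : cos x - cos y = - (2 * sin ((x + y) / 2) * sin ((x - y) / 2)).
Proof.
have -> : cos x = cos ((x + y) / 2 + (x - y) / 2) by congr cos; field.
have -> : cos y = cos ((x + y) / 2 - (x - y) / 2) by congr cos; field.
by rewrite cosD cosB; ring.
Qed.

Lemma cos_lipschitz x y : `|cos x - cos y| <= `|x - y|.
Proof.
rewrite cos_sub normrN !normrM ger0_norm //.
have -> : `|x - y| = 2 * 1 * `|(x - y) / 2|.
  by rewrite normrM [ `|2^-1|]gtr0_norm ?invr_gt0 //; field.
apply: ler_pM; rewrite ?mulr_ge0 ?norm_sin_le //.
by rewrite ler_wpM2l // sin_max.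
Qed.

Lemma cos_lipschitz2 x y : `|cos x - cos y| <= `|x ^+ 2 - y ^+ 2| / 2.
Proof.
rewrite cos_sub normrN !normrM ger0_norm //.
have -> : `|x ^+ 2 - y ^+ 2| / 2 = 2 * `|(x + y) / 2| * `|(x - y) / 2|.
  by rewrite !normrM [ `|2^-1|]gtr0_norm ?invr_gt0 // subr_sqr normrM; field.
by apply: ler_pM => //; rewrite ?mulr_ge0 // ?ler_wpM2l // norm_sin_le.
Qed.

Variable N : nat.
Hypothesis N0 : (0 < N)%N.
Definition theta (j : nat) : R := pi * j%:R / N%:R.

Let N0' : N%:R != 0 :> R. Proof. by rewrite pnatr_eq0 -lt0n. Qed.

Lemma cos_natpi m : cos (pi * m%:R : R) = (-1) ^+ m.
Proof.
elim: m => [|m IH]; first by rewrite mulr0 cos0.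
by rewrite -natr1 mulrDr mulr1 cosDpi IH exprS mulN1r.
Qed.

Lemma sin_natpi m : sin (pi * m%:R : R) = 0.
Proof.
elim: m => [|m IH]; first by rewrite mulr0 sin0.
by rewrite -natr1 mulrDr mulr1 sinDpi IH oppr0.
Qed.

Lemma sin_theta_gt0 j : (0 < j < N)%N -> 0 < sin (theta j).
Proof.
move=> /andP[j0 jN]; apply: sin_gt0_pi; rewrite /theta.
rewrite divr_gt0 ?mulr_gt0 ?pi_gt0 ?ltr0n //=.
by rewrite ltr_pdivrMr ?ltr0n // ltr_pM2l ?pi_gt0 // ltr_nat.
Qed.

Lemma sum_cos_theta r : (0 < r < N)%N ->
  \sum_(0 <= l < N) cos (2 * r%:R * theta l) = 0.
Proof.
move=> rN; have sr := sin_theta_gt0 rN.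
have h2 : 2 * sin (theta r) != 0 by rewrite mulf_neq0 ?pnatr_eq0 // gt_eqF.
apply: (mulfI h2).
rewrite mulr0 mulr_sumr.
rewrite (eq_bigr (fun l => sin ((2 * l.+1%:R - 1) * theta r) - sin ((2 * l%:R - 1) * theta r))).
  rewrite telescope_sumr //.
  have -> : (2 * N%:R - 1) * theta r = - theta r + pi * (2 * r)%N%:R.
    by rewrite /theta natrM; field.
  by rewrite sinD cos_natpi sin_natpi mulr0 addr0 mulrC exprM sqrrN !expr1n mul1r mulr0 sub0r mulN1r subrr.
move=> l _.
have -> : (2 * l.+1%:R - 1) * theta r = 2 * r%:R * theta l + theta r.
  by rewrite -natr1 /theta; field.
have -> : (2 * l%:R - 1) * theta r = 2 * r%:R * theta l - theta r.
  by rewrite /theta; field.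
by rewrite sinD sinB; ring.
Qed.

Lemma sum_sin_theta : \sum_(0 <= l < N) sin (theta l) =
  cos (pi / (2 * N%:R)) / sin (pi / (2 * N%:R)).
Proof.
have h0 : sin (pi / (2 * N%:R)) != 0 :> R.
  rewrite gt_eqF // sin_gt0_pi // divr_gt0 ?pi_gt0 ?mulr_gt0 ?ltr0n //=.
  rewrite ltr_pdivrMr ?mulr_gt0 ?ltr0n // -[ltLHS]mulr1 ltr_pM2l ?pi_gt0 //.
  by rewrite -natrM ltr1n; lia.
have h2 : 2 != 0 :> R by rewrite pnatr_eq0.
set b := pi / (2 * N%:R) in h0 *.
apply: (mulfI (mulf_neq0 h2 h0)); rewrite mulr_sumr.
rewrite (eq_bigr (fun l => - cos ((2 * l.+1%:R - 1) * b) - - cos ((2 * l%:R - 1) * b))).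
  rewrite telescope_sumr //.
  have -> : (2 * N%:R - 1) * b = pi - b by rewrite /b; field.
  rewrite mulr0 sub0r mulN1r cosN -[pi - b]addrC cosDpi cosN; field.
  by rewrite h0.
move=> l _.
have -> : (2 * l.+1%:R - 1) * b = theta l + b.
  by rewrite -natr1 /theta /b; field.
have -> : (2 * l%:R - 1) * b = theta l - b.
  by rewrite /theta /b; field.
by rewrite cosD cosB; ring.
Qed.

(** The averages of even powers of the sine over the N-th roots of unity are
   exactly the moments of the arcsine law, as long as the power is below N. *)
Lemma sum_sin_pow_cos k r : (k + r < N)%N ->
  \sum_(0 <= l < N) (4 * sin (theta l) ^+ 2) ^+ k * cos (2 * r%:R * theta l) =
  N%:R * (-1) ^+ r * 'C(k.*2, k + r)%:R.
Proof.
elim: k r => [|k IH] r krN.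
  rewrite (eq_bigr (fun l => cos (2 * r%:R * theta l))); last by move=> l _; rewrite expr0 mul1r.
  case: r krN => [|r] krN; last by rewrite sum_cos_theta // mulr0.
  rewrite (eq_bigr (fun=> 1)) ?sumr_const_nat ?subn0 ?expr0 ?mulr1 //.
  by move=> l _; rewrite mulr0 mul0r cos0.
have four l : 4 * sin (theta l) ^+ 2 = 2 - 2 * cos (2 * theta l).
  by rewrite [2 * theta l]mulr_natl cos_mulr2n cos2sin2; ring.
have prod l m : (4 * sin (theta l) ^+ 2) ^+ k.+1 * cos (2 * m.+1%:R * theta l) =
    2 * ((4 * sin (theta l) ^+ 2) ^+ k * cos (2 * m.+1%:R * theta l))
    - (4 * sin (theta l) ^+ 2) ^+ k * cos (2 * m%:R * theta l)
    - (4 * sin (theta l) ^+ 2) ^+ k * cos (2 * m.+2%:R * theta l).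
  rewrite exprSr -mulrA {2}four.
  have e1 : 2 * m%:R * theta l = 2 * m.+1%:R * theta l - 2 * theta l by rewrite -natr1; ring.
  have e2 : 2 * m.+2%:R * theta l = 2 * m.+1%:R * theta l + 2 * theta l by rewrite -natr1; ring.
  by rewrite e1 e2 cosB cosD; ring.
have sumP m : (k + m.+2 < N)%N -> \sum_(0 <= l < N) (4 * sin (theta l) ^+ 2) ^+ k.+1 * cos (2 * m.+1%:R * theta l) =
    N%:R * (-1) ^+ m.+1 * 'C(k.+1.*2, k.+1 + m.+1)%:R.
  move=> km; rewrite (eq_bigr _ (fun l _ => prod l m)) !sumrB -mulr_sumr.
  rewrite !IH; [|lia..]. 
  by rewrite bin_double_step -!muln2 !natrD !natrM !addnS !exprS; ring.
case: r krN => [|r] krN; last by apply: sumP; lia.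
have prod0 l : (4 * sin (theta l) ^+ 2) ^+ k.+1 * cos (2 * 0%:R * theta l) =
    2 * ((4 * sin (theta l) ^+ 2) ^+ k * cos (2 * 0%:R * theta l))
    - 2 * ((4 * sin (theta l) ^+ 2) ^+ k * cos (2 * 1%:R * theta l)).
  by rewrite exprSr -mulrA {2}four !(mulr0, mul0r) cos0 !mulr1; ring.
rewrite (eq_bigr _ (fun l _ => prod0 l)) sumrB -!mulr_sumr !IH; [|lia..].
rewrite !addn0 addn1 bin_double_step0 -!muln2 !natrM !natrD; ring.
Qed.

Lemma sum_sin_pow k : (k < N)%N ->
  \sum_(0 <= l < N) sin (theta l) ^+ k.*2 = N%:R * 'C(k.*2, k)%:R / 4 ^+ k.
Proof.
move=> kN; have := @sum_sin_pow_cos k 0; rewrite addn0 mulr1 => /(_ kN) <-.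
rewrite mulr_suml; apply: eq_bigr => l _.
have h4 : 4 ^+ k != 0 :> R by rewrite expf_neq0 // pnatr_eq0.
by rewrite mulr0 mul0r cos0 mulr1 exprMn mulrAC divff // mul1r -exprM mul2n.
Qed.

(** Fejer's identity. *)
Lemma fejer M : (M <= N)%N ->
  \sum_(1 <= l < N) (1 - cos (2 * M%:R * theta l)) / sin (theta l) ^+ 2 =
  2 * M%:R * (N%:R - M%:R).
Proof.
have step m : (0 < m < N)%N ->
  \sum_(1 <= l < N) (1 - cos (2 * m.+1%:R * theta l)) / sin (theta l) ^+ 2 =
  2 * (\sum_(1 <= l < N) (1 - cos (2 * m%:R * theta l)) / sin (theta l) ^+ 2)
  - \sum_(1 <= l < N) (1 - cos (2 * m.-1%:R * theta l)) / sin (theta l) ^+ 2 - 4.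
  move=> mN; have := sum_cos_theta mN.
  rewrite big_ltn // (_ : theta 0 = 0) ?mulr0 ?cos0; last by rewrite /theta mulr0 mul0r.
  move=> /eqP; rewrite addrC addr_eq0 => /eqP h.
  rewrite -[X in _ - X]mulr1 -[X in _ - _ * X]opprK -h mulrN opprK !mulr_sumr -sumrB -big_split /=.
  apply: eq_big_nat => l lN; have sl : sin (theta l) != 0 by rewrite gt_eqF // sin_theta_gt0.
  case: m mN {h} => [|m] // _.
  have e1 : 2 * m%:R * theta l = 2 * m.+1%:R * theta l - 2 * theta l by rewrite -natr1; ring.
  have e2 : 2 * m.+2%:R * theta l = 2 * m.+1%:R * theta l + 2 * theta l by rewrite -natr1; ring.
  rewrite /= e1 e2 cosB cosD [2 * theta l]mulr_natl cos_mulr2n cos2sin2.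
  by field.
elim/ltn_ind: M => -[|[|m]] IH mN.
- by rewrite !mulr0 mul0r big1 // => l _; rewrite mul0r cos0 subrr mul0r.
- rewrite (eq_big_nat _ _ (F2 := fun=> 2)) ?sumr_const_nat.
    by rewrite mulr1 -natr1 -[in RHS](prednK N0) -natr1 subn1; ring.
  move=> l lN; have sl : sin (theta l) != 0 by rewrite gt_eqF // sin_theta_gt0.
  by rewrite mulr1 [2 * _]mulr_natl cos_mulr2n cos2sin2; field.
rewrite step ?mN // IH ?(ltnW mN) // IH /=; [|lia..].
by rewrite -!natr1; ring.
Qed.

End Trig.

Local Close Scope ring_scope.

Local Close Scope classical_set_scope.

(** * PART Kernel *)

Local Open Scope classical_set_scope.
Local Open Scope ring_scope.

Section Kernel.
Variable R : realType.
Implicit Types a x y s : R.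

Definition cos_kernel a s := if s == 0 then a ^+ 2 / 2 else (1 - cos (a * s)) / s ^+ 2.

Definition kernel_mean N a := (\sum_(0 <= l < N) cos_kernel a (sin (theta R N l))) / N%:R.

Lemma cos_even_reflect M x : cos (2 * M%:R * (pi - x)) = cos (2 * M%:R * x) :> R.
Proof.
have -> : 2 * M%:R * (pi - x) = - (2 * M%:R * x) + pi * (2 * M)%N%:R by rewrite natrM; ring.
by rewrite cosD sin_natpi cos_natpi mulr0 subr0 exprM sqrrN !expr1n mulr1 cosN.
Qed.

Lemma sin_reflect x : sin (pi - x) = sin x :> R.
Proof. by rewrite addrC sinDpi sinN opprK. Qed.

Lemma near_term (M : nat) a x : 2 * M%:R <= a <= 2 * M%:R + 2 -> 0 < x <= 1 ->
  `|cos (2 * M%:R * x) - cos (a * sin x)| / sin x ^+ 2 <= 12 * a.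
Proof.
move=> /andP[Ma aM] /andP[x0 x1].
have a0 : 0 <= a by rewrite (le_trans _ Ma) // mulr_ge0 // ler0n.
have s_le := sin_le (ltW x0); have s_ge := sin_ge (ltW x0).
have x2 : x ^+ 2 <= 1 by rewrite expr_le1 // ltW.
have xs : x / 2 <= sin x by apply: le_trans s_ge; rewrite exprS; nra.
have s0 : 0 < sin x by apply: lt_le_trans xs; rewrite divr_gt0.
rewrite ler_pdivrMr ?exprn_gt0 //.
have h1 : `|cos (2 * M%:R * x) - cos (a * x)| <= 2 * a * x ^+ 2.
  apply: le_trans (cos_lipschitz2 _ _) _.
  have m0 : 0 <= M%:R :> R by [].
  have -> : (2 * M%:R * x) ^+ 2 - (a * x) ^+ 2 = - (x ^+ 2 * ((a - 2 * M%:R) * (a + 2 * M%:R))) by ring.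
  have p0 : 0 <= (a - 2 * M%:R) * (a + 2 * M%:R) by rewrite mulr_ge0; lra.
  rewrite normrN ger0_norm; last exact: mulr_ge0 (sqr_ge0 x) p0.
  have p1 : (a - 2 * M%:R) * (a + 2 * M%:R) <= 4 * a by nra.
  have := sqr_ge0 x; move: p1; move: ((a - _) * _) (x ^+ 2) => p y; nra.
have h2 : `|cos (a * x) - cos (a * sin x)| <= a * x ^+ 2 / 2.
  apply: le_trans (cos_lipschitz _ _) _.
  rewrite -mulrBr normrM (ger0_norm a0) -[leRHS]mulrA ler_wpM2l // ger0_norm ?subr_ge0 //.
  by rewrite exprS in s_ge; nra.
have h3 : x ^+ 2 / 4 <= sin x ^+ 2.
  have -> : x ^+ 2 / 4 = (x / 2) ^+ 2 by field.
  by rewrite ler_sqr ?nnegrE ?divr_ge0 // ltW.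
apply: le_trans (_ : 12 * a * (x ^+ 2 / 4) <= 12 * a * sin x ^+ 2); last first.
  by rewrite ler_wpM2l // mulr_ge0.
apply: le_trans (ler_distD (cos (a * x)) _ _) _.
apply: le_trans (lerD h1 h2) _.
have := mulr_ge0 a0 (sqr_ge0 x); nra.
Qed.

Lemma sin_ge_far x y : 0 < x <= pi / 2 -> x <= y <= pi - x -> sin x <= sin y.
Proof.
have mono u v : 0 < u -> u <= v -> v <= pi / 2 -> sin u <= sin v :> R.
  move=> u0 uv vpi; have pi0 := pi_gt0 R.
  by rewrite leNgt ltr_sin -?leNgt // in_itv /=; apply/andP; split; lra.
move=> /andP[x0 xpi] /andP[xy yx].
have [yp|yp] := leP y (pi / 2); first exact: mono.
by rewrite -(sin_reflect y); apply: mono; lra.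
Qed.

Variables (q n : nat).
Hypotheses (q4 : (4 <= q)%N) (n0 : (0 < n)%N).
Let N := (q * n)%N.
Let N0 : (0 < N)%N. Proof. by rewrite muln_gt0 n0 andbT; lia. Qed.
Let NE : N%:R = q%:R * n%:R :> R. Proof. exact: natrM. Qed.
Let q0 : 0 < q%:R :> R. Proof. by rewrite ltr0n; lia. Qed.
Let n0' : 0 < n%:R :> R. Proof. by rewrite ltr0n. Qed.

Lemma theta_reflect l : (l <= N)%N -> theta R N (N - l) = pi - theta R N l.
Proof.
move=> lN; rewrite /theta natrB // mulrBr mulrBl mulfK // pnatr_eq0; lia.
Qed.

Let thetaE k : theta R N k = pi / q%:R * (k%:R / n%:R).
Proof. by rewrite /theta NE; field; rewrite !gt_eqF. Qed.

Definition far_const : R := 2 / sin (pi / q%:R) ^+ 2.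

Let pi_q : 0 < (pi / q%:R : R) <= 1.
Proof.
rewrite divr_gt0 ?pi_gt0 //= ler_pdivrMr // mul1r.
have := pihalf_lt2 R; have : 4 <= q%:R :> R by rewrite (ler_nat _ 4). lra.
Qed.

Let far_const_ge0 : 0 <= far_const.
Proof. by rewrite /far_const divr_ge0 // sqr_ge0. Qed.

Lemma term_bound M a l : 2 * M%:R <= a <= 2 * M%:R + 2 -> (0 < l < N)%N ->
  `|cos (2 * M%:R * theta R N l) - cos (a * sin (theta R N l))| / sin (theta R N l) ^+ 2
  <= 12 * a * ((l < n)%:R + (N - l < n)%:R) + far_const.
Proof.
move=> Ma /andP[l0 lN].
have a0 : 0 <= a by case/andP: Ma => Ma _; rewrite (le_trans _ Ma) // mulr_ge0 // ler0n.
have near k : (0 < k < n)%N -> 0 < theta R N k <= 1.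
  move=> /andP[k0 kn]; rewrite /theta divr_gt0 ?mulr_gt0 ?pi_gt0 ?ltr0n //=.
  apply: le_trans (andP pi_q).2; rewrite -/(theta R N k) thetaE ler_piMr //.
    by case/andP: pi_q => /ltW.
  by rewrite ler_pdivrMr // mul1r ler_nat ltnW.
have [ln|nl] := ltnP l n.
  apply: le_trans (near_term Ma (near l _)) _; first by rewrite l0.
  by rewrite mulrDr mulr1 -!addrA lerDl addr_ge0 // !mulr_ge0.
have [ln|nl'] := ltnP (N - l) n.
  rewrite -(sin_reflect (theta R N l)) -cos_even_reflect -theta_reflect; last exact: ltnW.
  apply: le_trans (near_term Ma (near (N - l)%N _)) _; first by rewrite subn_gt0 lN.
  by rewrite add0r mulr1 lerDl.
rewrite addr0 mulr0 add0r /far_const.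
have hs : sin (pi / q%:R) <= sin (theta R N l).
  have pq0 : 0 <= pi / q%:R :> R by case/andP: pi_q => /ltW.
  have ge1 k : (n <= k)%N -> pi / q%:R <= theta R N k.
    by move=> nk; rewrite thetaE ler_peMr // ler_pdivlMr // mul1r ler_nat.
  apply: sin_ge_far; apply/andP; split; [by case/andP: pi_q| |exact: ge1|].
    by case/andP: pi_q => _ h; have := pi_ge2 R; lra.
  by rewrite lerBrDr addrC -lerBrDr -theta_reflect ?ge1 // ltnW.
have s0 : 0 < sin (pi / q%:R) :> R.
  by apply: sin_gt0_pi; case/andP: pi_q => -> /= h; have := pi_ge2 R; lra.
have s1 := lt_le_trans s0 hs.
apply: ler_pM => //; rewrite ?invr_ge0 ?sqr_ge0 //.
  apply: le_trans (ler_normB _ _) _; have := cos_max (2 * M%:R * theta R N l).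
  by have := cos_max (a * sin (theta R N l)); lra.
by rewrite lef_pV2 ?posrE ?exprn_gt0 // ler_pXn2r // nnegrE ltW.
Qed.

Lemma sum_near : \sum_(1 <= l < N) ((l < n)%:R + (N - l < n)%:R) <= 2 * n%:R :> R.
Proof.
have low : \sum_(0 <= l < N) (l < n)%:R = n%:R :> R.
  rewrite (@big_cat_nat _ _ _ n) //=; last by rewrite /N leq_pmull //; lia.
  rewrite [X in _ + X](_ : _ = 0); last first.
    by rewrite big_nat_cond big1 // => l /andP[/andP[nl _] _]; rewrite ltnNge nl.
  rewrite addr0.
  rewrite (eq_big_nat _ _ (F2 := fun=> 1)) ?sumr_const_nat ?subn0 //.
  by move=> l /andP[_ ->].
rewrite big_split /= (_ : 2 * n%:R = n%:R + n%:R); last by rewrite mulr_natl mulr2n.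
rewrite -low; apply: lerD.
  by rewrite [leRHS]big_ltn // lerDr.
rewrite [leRHS]big_ltn // big_nat_rev /= -[leLHS]add0r lerD //.
rewrite le_eqVlt; apply/orP; left; apply/eqP; apply: eq_big_nat => l /andP[l0 lN].
by congr (_ < _)%N%:R; rewrite -addnBA //; lia.
Qed.

Theorem kernel_mean_bound a : 0 <= a <= N%:R ->
  `|kernel_mean N a - a| <= 2 + far_const + a ^+ 2 / N%:R + 24 * a / q%:R.
Proof.
move=> /andP[a0 aN]; pose M := Num.truncn (a / 2).
have Ma : 2 * M%:R <= a <= 2 * M%:R + 2.
  have : 0 <= a / 2 by rewrite divr_ge0.
  by move=> /truncn_itv/andP[]; rewrite -/M -[M.+1%:R]natr1 => h1 h2; apply/andP; split; lra.
have MN : (M <= N)%N.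
  by rewrite -(ler_nat R); case/andP: Ma => h _; move: (ler0n R M) h aN; move: (M%:R) (N%:R) => x y; lra.
pose F := \sum_(1 <= l < N) (1 - cos (2 * M%:R * theta R N l)) / sin (theta R N l) ^+ 2.
have FE : F = 2 * M%:R * (N%:R - M%:R) by exact: fejer.
pose S := \sum_(1 <= l < N) (1 - cos (a * sin (theta R N l))) / sin (theta R N l) ^+ 2.
have QE : kernel_mean N a = (a ^+ 2 / 2 + S) / N%:R.
  rewrite /kernel_mean big_ltn //; congr ((_ + _) / _).
    by rewrite /cos_kernel /theta mulr0 mul0r sin0 eqxx.
  apply: eq_big_nat => l lN; rewrite /cos_kernel gt_eqF //.
  exact: sin_theta_gt0.
have SF : `|S - F| <= 24 * a * n%:R + N%:R * far_const.
  rewrite /S /F -sumrB; apply: le_trans (ler_norm_sum _ _ _) _.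
  apply: le_trans (_ : \sum_(1 <= l < N) (12 * a * ((l < n)%:R + (N - l < n)%:R) + far_const) <= _).
    rewrite big_nat_cond [leRHS]big_nat_cond; apply: ler_sum => l /andP[lN _].
    apply: le_trans (term_bound Ma lN).
    have sub1 (u v : R) : 1 - u - (1 - v) = v - u by ring.
    by rewrite -mulrBl sub1 normrM [ `|_^-1|]ger0_norm // invr_ge0 sqr_ge0.
  rewrite big_split /= -mulr_sumr sumr_const_nat.
  apply: lerD.
    have a12 : 0 <= 12 * a by rewrite mulr_ge0.
    by apply: le_trans (ler_wpM2l a12 sum_near) _; lra.
  rewrite -[leLHS]mulr_natl ler_wpM2r // ler_nat; exact: leq_subr.
have NN : 0 < N%:R :> R by rewrite ltr0n.
have -> : kernel_mean N a - a =
   (a ^+ 2 / 2 / N%:R + (S - F) / N%:R) + ((2 * M%:R - a) - 2 * M%:R ^+ 2 / N%:R).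
  by rewrite QE FE; field; rewrite gt_eqF.
apply: le_trans (ler_normD _ _) _.
have h1 : `|a ^+ 2 / 2 / N%:R + (S - F) / N%:R| <=
    a ^+ 2 / 2 / N%:R + (24 * a / q%:R + far_const).
  apply: le_trans (ler_normD _ _) _; apply: lerD.
    by rewrite ger0_norm // !divr_ge0 // sqr_ge0.
  rewrite normrM [ `|_^-1|]ger0_norm ?invr_ge0 // ler_pdivrMr //.
  apply: le_trans SF _; rewrite NE le_eqVlt; apply/orP; left; apply/eqP.
  by field; rewrite gt_eqF.
have h2 : `|2 * M%:R - a - 2 * M%:R ^+ 2 / N%:R| <= 2 + a ^+ 2 / 2 / N%:R.
  apply: le_trans (ler_normB _ _) _; apply: lerD.
    by rewrite ler_norml; case/andP: Ma => u v; apply/andP; split; lra.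
  rewrite ger0_norm ?divr_ge0 ?mulr_ge0 // ler_wpM2r ?invr_ge0 //.
  case/andP: Ma => u _; have m0 : 0 <= M%:R :> R by [].
  by nra.
apply: le_trans (lerD h1 h2) _.
by rewrite le_eqVlt; apply/orP; left; apply/eqP; field; rewrite !gt_eqF.
Qed.

End Kernel.

Local Close Scope ring_scope.

Local Close Scope classical_set_scope.

(** * PART Series *)

Local Open Scope classical_set_scope.
Local Open Scope ring_scope.

Section Series.
Variable R : realType.
Implicit Types (u v : R^nat) (x y a s X : R).

Lemma series_tail u v (U V : R) : (forall k, `|u k| <= v k) ->
  series u @ \oo --> U -> series v @ \oo --> V ->
  forall N, `|U - series u N| <= V - series v N.
Proof.
move=> uv cu cv N.
apply: (@ler_cvg_to _ \oo _ _ (fun n => `|series u n - series u N|)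
  (fun n => series v n - series v N)).
- by apply: cvg_norm; apply: cvgB => //; exact: cvg_cst.
- by apply: cvgB => //; exact: cvg_cst.
- near=> n.
  have Nn : (N <= n)%N by near: n; exact: nbhs_infty_ge.
  rewrite !sub_series_geq //; apply: le_trans (ler_norm_sum _ _ _) _.
  exact: ler_sum.
Unshelve. all: by end_near. Qed.

Lemma cvg_exp_series x : series (exp_coeff x) @ \oo --> expR x.
Proof. exact: is_cvg_series_exp_coeff. Qed.

Definition exp_tail x N : R := expR x - series (exp_coeff x) N.

Lemma cvg_exp_tail x : exp_tail x @ \oo --> 0.
Proof.
rewrite -(subrr (expR x)); apply: cvgB; [exact: cvg_cst|exact: cvg_exp_series].
Qed.

Lemma central_bin_le k : 'C(k.*2, k)%:R <= 4 ^+ k :> R.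
Proof.
have h := @sum_sin_pow R k.+1 isT k (ltnSn k).
have k0 : 0 < k.+1%:R :> R by [].
have p4 : 0 < 4 ^+ k :> R by rewrite exprn_gt0.
rewrite -(ler_pM2l k0) -ler_pdivrMr // -h.
have -> : k.+1%:R = \sum_(0 <= l < k.+1) 1 :> R by rewrite sumr_const_nat subn0.
by apply: ler_sum => l _; rewrite -mul2n exprM exprn_ile1 ?sqr_ge0.
Qed.

Definition bser y k : R := (- y) ^+ k * 'C(k.*2, k)%:R / k`!%:R ^+ 2.
Definition gser y k : R :=
  if k is k'.+1 then - ((- y) ^+ k * 'C(k'.*2, k')%:R / k`!%:R ^+ 2) else 0.

Lemma fact_ge1 k : 1 <= k`!%:R :> R.
Proof. by rewrite ler1n fact_gt0. Qed.

Lemma term_le y k (b : R) : 0 <= y -> 0 <= b <= 4 ^+ k ->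
  `|(- y) ^+ k * b / k`!%:R ^+ 2| <= exp_coeff (16 * y) k.
Proof.
move=> y0 /andP[b0 b4]; rewrite /exp_coeff /=.
have f1 := fact_ge1 k; have f0 : 0 < k`!%:R :> R by exact: lt_le_trans f1.
rewrite !normrM normrX normrN (ger0_norm y0) (ger0_norm b0) normrV ?unitfE ?gt_eqF ?exprn_gt0 //.
rewrite ger0_norm ?sqr_ge0 // expr2 invfM mulrA ler_wpM2r ?invr_ge0 //.
rewrite ler_pdivrMr // exprMn.
have yk : 0 <= y ^+ k by rewrite exprn_ge0.
have h16 : 4 ^+ k <= 16 ^+ k :> R by apply: lerXn2r; rewrite ?nnegrE // ler_nat.
have h : y ^+ k * b <= 16 ^+ k * y ^+ k.
  by rewrite mulrC ler_wpM2r // (le_trans b4).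
apply: le_trans h _; rewrite ler_peMr // mulr_ge0 // exprn_ge0 //.
Qed.

Lemma bser_le y k : 0 <= y -> `|bser y k| <= exp_coeff (16 * y) k.
Proof. by move=> y0; apply: term_le => //; rewrite ler0n central_bin_le. Qed.

Lemma gser_le y k : 0 <= y -> `|gser y k| <= exp_coeff (16 * y) k.
Proof.
move=> y0; case: k => [|k]; first by rewrite /gser normr0 exp_coeff_ge0 // mulr_ge0.
rewrite /gser normrN; apply: term_le => //; rewrite ler0n /=.
by apply: le_trans (central_bin_le k) _; rewrite ler_eXn2l // ltr1n.
Qed.

Lemma cvg_series_le u y : (forall k, `|u k| <= exp_coeff y k) -> cvgn (series u).
Proof.
move=> h; apply: normed_cvg; apply: (series_le_cvg _ _ h).
- by move=> n; exact: normr_ge0.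
- by move=> n; exact: le_trans (h n).
- exact: is_cvg_series_exp_coeff.
Qed.

Definition Bfun y : R := limn (series (bser y)).
Definition Gfun y : R := limn (series (gser y)).

Lemma cvg_Bfun y : 0 <= y -> series (bser y) @ \oo --> Bfun y.
Proof. by move=> y0; apply: cvg_series_le => k; exact: bser_le. Qed.

Lemma cvg_Gfun y : 0 <= y -> series (gser y) @ \oo --> Gfun y.
Proof. by move=> y0; apply: cvg_series_le => k; exact: gser_le. Qed.

Definition kernel_coeff a s k : R :=
  if k is k'.+1 then (-1) ^+ k' * a ^+ k.*2 * s ^+ k'.*2 / k.*2`!%:R else 0.

Lemma cos_coeff'E' x k : cos_coeff' x k = (-1) ^+ k * x ^+ k.*2 / k.*2`!%:R.
Proof. by []. Qed.

Lemma fact_double_ge k : (k`! <= k.*2`!)%N.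
Proof.
rewrite -addnn; elim: {3}k => [|m IH]; first by rewrite addn0.
by rewrite addnS factS (leq_trans IH) // leq_pmull.
Qed.

Lemma pow_fact_le X x k : 0 <= X -> `|x| <= X ->
  `|x| ^+ k.*2 / k.*2`!%:R <= exp_coeff (X ^+ 2) k.
Proof.
move=> X0 xX; rewrite /exp_coeff /=; apply: ler_pM; rewrite ?invr_ge0 ?exprn_ge0 //.
  by rewrite -exprM mul2n lerXn2r // nnegrE.
by rewrite lef_pV2 ?posrE ?ltr0n ?fact_gt0 // ler_nat fact_double_ge.
Qed.

Lemma cos_tail X x N : 0 <= X -> `|x| <= X ->
  `|cos x - series (cos_coeff' x) N| <= exp_tail (X ^+ 2) N.
Proof.
move=> X0 xX; apply: series_tail; [|exact: cvg_cos_coeff'|exact: cvg_exp_series].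
move=> k; rewrite cos_coeff'E' !normrM normrX normrN1 expr1n mul1r normrX.
rewrite [ `|_^-1|]ger0_norm ?invr_ge0 //; exact: pow_fact_le.
Qed.

Lemma cvg_kernel_coeff a s : series (kernel_coeff a s) @ \oo --> cos_kernel a s.
Proof.
have kc0 : kernel_coeff a s 0 = 0 by [].
rewrite /cos_kernel; case: eqVneq => [->|s0].
  apply: cvg_near_cst; near=> n.
  have n2 : (2 <= n)%N by near: n; exact: nbhs_infty_ge.
  rewrite /series /= -(subnK n2) addn2 big_nat_recl // big_nat_recl //= big1 => [|k _].
    by rewrite !expr0 !mulr1 mul1r add0r addr0.
  by rewrite expr0n /= mulr0 mul0r.
have h : (fun n => (1 - series (cos_coeff' (a * s)) n) / s ^+ 2) @ \oo -->
    (1 - cos (a * s)) / s ^+ 2.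
  by apply: cvgMl; apply: cvgB; [exact: cvg_cst|exact: cvg_cos_coeff'].
apply: cvg_trans h; apply: near_eq_cvg; near=> n.
have n0 : (0 < n)%N by near: n; exact: nbhs_infty_gt.
rewrite /series /= -(prednK n0) big_nat_recl //= [in RHS]big_nat_recl //=.
rewrite cos_coeff'E' !expr0 mul1r divr1 opprD addrA subrr !add0r.
rewrite -sumrN mulr_suml; apply: eq_bigr => k _; rewrite cos_coeff'E'.
have e : s ^+ k.+1.*2 = s ^+ k.*2 * s ^+ 2 by rewrite -exprD doubleS addn2.
rewrite exprMn e exprS; field.
by rewrite s0 pnatr_eq0 -lt0n fact_gt0.
Unshelve. all: by end_near. Qed.

Lemma kernel_tail X a s N : 0 <= X -> `|a| <= X -> `|s| <= 1 ->
  `|cos_kernel a s - series (kernel_coeff a s) N| <= exp_tail (X ^+ 2) N.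
Proof.
move=> X0 aX s1; apply: series_tail; [|exact: cvg_kernel_coeff|exact: cvg_exp_series].
case=> [|k]; first by rewrite normr0 exp_coeff_ge0 // sqr_ge0.
rewrite /kernel_coeff 3!normrM !normrX normrN1 expr1n mul1r.
rewrite [ `|_^-1|]ger0_norm ?invr_ge0 //.
apply: le_trans (pow_fact_le k.+1 X0 aX).
rewrite ler_wpM2r ?invr_ge0 // ler_piMr ?exprn_ge0 // exprn_ile1 //.
Qed.

Section Means.
Variables (y : R) (N : nat).
Hypotheses (y0 : 0 <= y) (N0 : (0 < N)%N).
Let X := 4 * Num.sqrt y.
Let st j : R := sin (theta R N j).

Let X2 : X ^+ 2 = 16 * y.
Proof. by rewrite /X exprMn sqr_sqrtr // -natrX. Qed.

Let X0 : 0 <= X.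
Proof. by rewrite mulr_ge0 // sqrtr_ge0. Qed.

Let NR : 0 < N%:R :> R. Proof. by rewrite ltr0n. Qed.

Let Xst j : `|X * st j| <= X.
Proof. by rewrite normrM (ger0_norm X0) ler_piMr // sin_max. Qed.

Let fact_double k : k.*2`!%:R = 'C(k.*2, k)%:R * k`!%:R ^+ 2 :> R.
Proof.
by have := bin_fact (leq_addr k k); rewrite addnK addnn => <-; rewrite !natrM expr2.
Qed.

Lemma series_bser_mean :
  series (bser y) N = (\sum_(0 <= j < N) \sum_(0 <= l < N)
     series (cos_coeff' (X * st j * st l)) N) / N%:R ^+ 2.
Proof.
under [in RHS]eq_bigr => j _ do rewrite exchange_big /=.
rewrite exchange_big /= mulr_suml; apply: eq_big_nat => k /andP[_ kN].
have -> : \sum_(0 <= j < N) \sum_(0 <= l < N) cos_coeff' (X * st j * st l) k =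
  (-1) ^+ k * X ^+ k.*2 / k.*2`!%:R * (\sum_(0 <= j < N) st j ^+ k.*2)
     * (\sum_(0 <= l < N) st l ^+ k.*2).
  rewrite -mulrA mulr_suml mulr_sumr; apply: eq_bigr => j _.
  rewrite !mulr_sumr; apply: eq_bigr => l _.
  have cosE (p q r : R) : cos_coeff' (p * q * r) k =
    (-1) ^+ k * p ^+ k.*2 / k.*2`!%:R * q ^+ k.*2 * r ^+ k.*2.
    by rewrite cos_coeff'E' !exprMn; ring.
  by rewrite cosE !mulrA.
rewrite !sum_sin_pow // fact_double -[X ^+ _](_ : (16 * y) ^+ k = _); last first.
  by rewrite -X2 -exprM mul2n.
have -> : (16 * y) ^+ k = 4 ^+ k * 4 ^+ k * y ^+ k by rewrite -!exprMn; congr (_ ^+ _); ring.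
have bk : 'C(k.*2, k)%:R != 0 :> R by rewrite pnatr_eq0 -lt0n bin_gt0 -addnn leq_addr.
have fk : k`!%:R != 0 :> R by rewrite pnatr_eq0 -lt0n fact_gt0.
have p4 : 4 ^+ k != 0 :> R by rewrite expf_neq0 // pnatr_eq0.
rewrite /bser (exprNn y); move: (4 ^+ k) p4 ('C(_, _)%:R) bk (k`!%:R) fk => p p0 b b0 f f0.
by field; rewrite p0 b0 f0 gt_eqF.
Qed.

Lemma series_gser_mean :
  series (gser y) N = (\sum_(0 <= j < N) \sum_(0 <= l < N)
     series (kernel_coeff (X * st j) (st l)) N) / N%:R ^+ 2 / 4.
Proof.
under [in RHS]eq_bigr => j _ do rewrite exchange_big /=.
rewrite exchange_big /= !mulr_suml; apply: eq_big_nat => -[_|k /andP[_ kN]].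
  by rewrite big1 ?mul0r // => j _; rewrite big1.
have -> : \sum_(0 <= j < N) \sum_(0 <= l < N) kernel_coeff (X * st j) (st l) k.+1 =
  (-1) ^+ k * X ^+ k.+1.*2 / k.+1.*2`!%:R * (\sum_(0 <= j < N) st j ^+ k.+1.*2)
     * (\sum_(0 <= l < N) st l ^+ k.*2).
  rewrite -mulrA mulr_suml mulr_sumr; apply: eq_bigr => j _.
  rewrite !mulr_sumr; apply: eq_bigr => l _.
  have kerE (p q r : R) : kernel_coeff (p * q) r k.+1 =
    (-1) ^+ k * p ^+ k.+1.*2 / k.+1.*2`!%:R * q ^+ k.+1.*2 * r ^+ k.*2.
    rewrite /kernel_coeff exprMn.
    by move: (p ^+ _) (q ^+ _) (r ^+ _) (_`!%:R) => p1 p2 p3 p4; ring.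
  by rewrite kerE !mulrA.
rewrite !sum_sin_pow //; last exact: ltnW.
rewrite fact_double -[X ^+ _](_ : (16 * y) ^+ k.+1 = _); last first.
  by rewrite -X2 -exprM mul2n.
have -> : (16 * y) ^+ k.+1 = 4 ^+ k.+1 * 4 ^+ k * y ^+ k.+1 * 4.
  transitivity (4 ^+ k.+1 * 4 ^+ k.+1 * y ^+ k.+1 : R).
    by rewrite -!exprMn; congr (_ ^+ _); ring.
  by rewrite [4 ^+ k.+1]exprS; ring.
have bk : 'C(k.+1.*2, k.+1)%:R != 0 :> R by rewrite pnatr_eq0 -lt0n bin_gt0 -addnn leq_addr.
have fk : k.+1`!%:R != 0 :> R by rewrite pnatr_eq0 -lt0n fact_gt0.
have p4 n : 4 ^+ n != 0 :> R by rewrite expf_neq0 // pnatr_eq0.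
rewrite /gser (exprNn y) [(-1) ^+ k.+1]exprS.
move: (4 ^+ k) (4 ^+ k.+1) (p4 k) (p4 k.+1) => p p' p0 p0'.
move: ('C(k.+1.*2, k.+1)%:R) bk (k.+1`!%:R) fk => b b0 f f0.
by field; rewrite p0 p0' b0 f0 gt_eqF.
Qed.

End Means.

Let sqrt_pos_X y : 0 <= 4 * Num.sqrt y.
Proof. by rewrite mulr_ge0 // sqrtr_ge0. Qed.

Lemma mean_le N (F G : nat -> nat -> R) (E : R) : (0 < N)%N ->
  (forall j l, `|F j l - G j l| <= E) ->
  `|(\sum_(0 <= j < N) \sum_(0 <= l < N) F j l) / N%:R ^+ 2 -
    (\sum_(0 <= j < N) \sum_(0 <= l < N) G j l) / N%:R ^+ 2| <= E.
Proof.
move=> N0 FG; have NR : 0 < N%:R :> R by rewrite ltr0n.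
rewrite -mulrBl -sumrB normrM [ `|_^-1|]ger0_norm ?invr_ge0 ?sqr_ge0 //.
rewrite ler_pdivrMr ?exprn_gt0 //.
have -> : E * N%:R ^+ 2 = \sum_(0 <= j < N) \sum_(0 <= l < N) E.
  by rewrite !sumr_const_nat subn0 -mulrnA mulrC -natrX -[RHS]mulr_natl expnS expn1.
apply: le_trans (ler_norm_sum _ _ _) _; apply: ler_sum => j _.
rewrite -sumrB; apply: le_trans (ler_norm_sum _ _ _) _; exact: ler_sum.
Qed.

Let Xbound y N j : `|4 * Num.sqrt y * sin (theta R N j)| <= 4 * Num.sqrt y.
Proof. by rewrite normrM (ger0_norm (sqrt_pos_X y)) ler_piMr // sin_max. Qed.

Lemma Bfun_bound y : 0 <= y -> `|Bfun y| <= 1.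
Proof.
move=> y0; pose X := 4 * Num.sqrt y.
apply: (@ler_cvg_to _ \oo _ _ (fun N => `|series (bser y) N|)
  (fun N => 1 + exp_tail (X ^+ 2) N)).
- by apply: cvg_norm; exact: cvg_Bfun.
- rewrite -[X in _ --> X]addr0; apply: cvgD; [exact: cvg_cst|exact: cvg_exp_tail].
near=> N; have N0 : (0 < N)%N by near: N; exact: nbhs_infty_gt.
have NR : 0 < N%:R :> R by rewrite ltr0n.
rewrite series_bser_mean //.
set A := (X in `|X|).
pose C := (\sum_(0 <= j < N) \sum_(0 <= l < N)
     cos (X * sin (theta R N j) * sin (theta R N l))) / N%:R ^+ 2.
have AC : `|C - A| <= exp_tail (X ^+ 2) N.
  apply: mean_le => // j l; apply: cos_tail; first exact: sqrt_pos_X.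
  rewrite normrM; apply: le_trans (ler_piMr _ (sin_max _)) _ => //; exact: Xbound.
have C1 : `|C - 0| <= 1.
  have -> : 0 = (\sum_(0 <= j < N) \sum_(0 <= l < N) 0) / N%:R ^+ 2 :> R.
    by rewrite big1 ?mul0r // => j _; rewrite big1.
  by apply: mean_le => // j l; rewrite subr0 cos_max.
rewrite subr0 in C1.
rewrite -[A](subrK C) addrC; apply: le_trans (ler_normD _ _) _.
by apply: lerD => //; rewrite distrC.
Unshelve. all: by end_near. Qed.

Definition sine_mean N : R := (\sum_(0 <= l < N) sin (theta R N l)) / N%:R.

Lemma sine_mean_bound N : (2 <= N)%N -> `|sine_mean N - 2 / pi| <= 4 / N%:R.
Proof.
move=> N2; have N0 : (0 < N)%N by apply: leq_trans N2.
have NR : 0 < N%:R :> R by rewrite ltr0n.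
have N2R : 2 <= N%:R :> R by rewrite (ler_nat _ 2).
have pi0 := pi_gt0 R; have pi4 : pi < 4 :> R by have := pihalf_lt2 R; lra.
rewrite /sine_mean sum_sin_theta //; set h := pi / (2 * N%:R).
have h0 : 0 < h by rewrite divr_gt0 // mulr_gt0.
have h1 : h <= 1 by rewrite ler_pdivrMr ?mulr_gt0 // mul1r; lra.
have s_le := sin_le (ltW h0); have s_ge := sin_ge (ltW h0).
have c_le := one_sub_cos_le h; have c1 := cos_le1 h.
have h2 : h ^+ 2 <= 1 by rewrite expr_le1 // ltW.
have hs : h / 2 <= sin h by apply: le_trans s_ge; rewrite exprS; nra.
have s0 : 0 < sin h by apply: lt_le_trans hs; rewrite divr_gt0.
have NE : N%:R = pi / (2 * h).
  by rewrite /h; move: (pi : R) pi0 => p p0; field; rewrite !gt_eqF.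
have -> : cos h / sin h / N%:R - 2 / pi = 2 / pi * ((h * cos h - sin h) / sin h).
  have fld (p s c x : R) : p != 0 -> s != 0 -> x != 0 ->
      c / s / (p / (2 * x)) - 2 / p = 2 / p * ((x * c - s) / s).
    by move=> p0 s0' x0; field; rewrite p0 s0' x0.
  by rewrite NE fld // gt_eqF.
have key : `|(h * cos h - sin h) / sin h| <= 2 * h ^+ 2.
  rewrite normrM [ `|_^-1|]gtr0_norm ?invr_gt0 // ler_pdivrMr //.
  apply: le_trans (_ : h ^+ 3 <= _); last first.
    have : 0 <= h ^+ 2 by exact: sqr_ge0.
    by rewrite [h ^+ 3]exprS => q0; nra.
  have e3 : h ^+ 3 = h * h ^+ 2 by rewrite exprS.
  by rewrite ler_norml; apply/andP; split; rewrite e3 in s_ge *; nra.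
have p2 : 0 <= 2 / pi :> R by rewrite divr_ge0 // ltW.
rewrite normrM (ger0_norm p2).
apply: le_trans (ler_wpM2l p2 key) _.
have -> : 2 / pi * (2 * h ^+ 2) = pi / N%:R / N%:R.
  by rewrite /h; move: (pi : R) pi0 => p p0; field; rewrite !gt_eqF.
rewrite ler_wpM2r ?invr_ge0 // ler_pdivrMr //; lra.
Qed.

Theorem Gfun_bound q y : (4 <= q)%N -> 0 <= y ->
  `|Gfun y - 2 / pi * Num.sqrt y| <= (2 + far_const R q) / 4 + 24 * Num.sqrt y / q%:R.
Proof.
move=> q4 y0; pose X := 4 * Num.sqrt y; have X0 : 0 <= X := sqrt_pos_X y.
have q0 : (0 < q)%N by lia.
pose E N := exp_tail (X ^+ 2) N / 4 +
  (2 + far_const R q + X ^+ 2 / N%:R + 24 * X / q%:R) / 4 + X / 4 * (4 / N%:R).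
pose sub n := (q * n.+1)%N.
have sub_oo : sub n @[n --> \oo] --> \oo.
  apply/cvgnyPge => A; near=> n; rewrite /sub.
  have An : (A <= n)%N by near: n; exact: nbhs_infty_ge.
  by rewrite (leq_trans An) // (leq_trans (leqnSn _)) // leq_pmull.
apply: (@ler_cvg_to _ \oo _ _
  (fun n => `|series (gser y) (sub n) - 2 / pi * Num.sqrt y|) (fun n => E (sub n))).
- apply: cvg_norm; apply: cvgB; last exact: cvg_cst.
  by apply: (cvg_comp _ _ sub_oo); exact: cvg_Gfun.
- have inv0 : ((sub n)%:R^-1 : R) @[n --> \oo] --> 0.
    rewrite (_ : (fun n => _) = fun n => q%:R^-1 * harmonic n); last first.
      by apply/funext => n; rewrite /sub natrM invfM.
    by rewrite -(mulr0 q%:R^-1); apply: cvgMr; exact: cvg_harmonic.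
  have -> : (2 + far_const R q) / 4 + 24 * Num.sqrt y / q%:R =
     0 / 4 + (2 + far_const R q + X ^+ 2 * 0 + 24 * X / q%:R) / 4 + X / 4 * (4 * 0).
    by rewrite /X; field; rewrite pnatr_eq0 -lt0n.
  apply: cvgD.
    apply: cvgD.
      by apply: cvgMl; apply: (cvg_comp _ _ sub_oo); exact: cvg_exp_tail.
    apply: cvgMl; apply: cvgD; last exact: cvg_cst.
    by apply: cvgD; [exact: cvg_cst|apply: cvgMr].
  by apply: cvgMr; apply: cvgMr.
near=> n; rewrite /E.
have nX : X <= (sub n)%:R.
  have tn : (Num.truncn X <= n)%N by near: n; exact: nbhs_infty_ge.
  have /andP[_ /ltW hX] := truncn_itv X0.
  by apply: le_trans hX _; rewrite ler_nat /sub (leq_trans (_ : _ <= n.+1)%N) // leq_pmull.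
move: nX; rewrite {sub_oo}/sub; set N := (q * n.+1)%N => NX.
have N2 : (2 <= N)%N by rewrite /N; nia.
have N0 : (0 < N)%N by apply: leq_trans N2.
have NR : 0 < N%:R :> R by rewrite ltr0n.
rewrite series_gser_mean //.
set A := (\sum_(0 <= j < N) _) / _.
pose C := (\sum_(0 <= j < N) \sum_(0 <= l < N)
     cos_kernel (X * sin (theta R N j)) (sin (theta R N l))) / N%:R ^+ 2.
have AC : `|C - A| <= exp_tail (X ^+ 2) N.
  by apply: mean_le => // j l; apply: kernel_tail; rewrite ?sin_max //; exact: Xbound.
have CS : `|C - X * sine_mean N| <= 2 + far_const R q + X ^+ 2 / N%:R + 24 * X / q%:R.
  have -> : C = (\sum_(0 <= j < N) kernel_mean N (X * sin (theta R N j))) / N%:R.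
    by rewrite /C /kernel_mean -mulr_suml expr2 invfM mulrA.
  rewrite /sine_mean mulrA mulr_sumr -mulrBl -sumrB normrM [ `|_^-1|]gtr0_norm ?invr_gt0 //.
  rewrite ler_pdivrMr //; apply: le_trans (ler_norm_sum _ _ _) _.
  rewrite mulr_natr -[X in _ *+ X]subn0 -sumr_const_nat.
  rewrite big_nat_cond [leRHS]big_nat_cond; apply: ler_sum => j /andP[/andP[_ jN] _].
  have sj0 : 0 <= sin (theta R N j).
    case: j jN => [|j] jN; first by rewrite /theta mulr0 mul0r sin0.
    by apply: ltW; apply: sin_theta_gt0.
  have sX : X * sin (theta R N j) <= X by rewrite ler_piMr // sin_le1.
  have sX0 : 0 <= X * sin (theta R N j) by rewrite mulr_ge0.
  have : 0 <= X * sin (theta R N j) <= N%:R by rewrite sX0 (le_trans sX).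
  move=> /(kernel_mean_bound q4 (ltn0Sn n)) h; apply: le_trans h _.
  apply: lerD.
    rewrite lerD2l ler_wpM2r ?invr_ge0 //.
    by rewrite lerXn2r // nnegrE.
  by rewrite ler_wpM2r ?invr_ge0 // ler_wpM2l.
have SB := sine_mean_bound N2.
have -> : A / 4 - 2 / pi * Num.sqrt y =
   - ((C - A) / 4) + (C - X * sine_mean N) / 4 + X / 4 * (sine_mean N - 2 / pi).
  by rewrite /X; move: (pi : R) (pi_gt0 R) => p p0; field; rewrite gt_eqF.
have n4 : `|4^-1 : R| = 4^-1 by rewrite gtr0_norm // invr_gt0.
apply: le_trans (ler_normD _ _) _; apply: lerD.
  apply: le_trans (ler_normD _ _) _; rewrite normrN !normrM n4.
  by apply: lerD; rewrite ler_wpM2r // invr_ge0.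
by rewrite normrM (ger0_norm (_ : 0 <= X / 4)) ?ler_wpM2l // divr_ge0.
Unshelve. all: by end_near. Qed.

End Series.

Local Close Scope ring_scope.

Local Close Scope classical_set_scope.

(** * PART Poisson *)

Local Open Scope classical_set_scope.
Local Open Scope ring_scope.

Section Poisson.
Variable R : realType.
Implicit Types (a b : R^nat) (x t : R).

Definition cauchy_product a b : R^nat :=
  fun m => \sum_(0 <= k < m.+1) a k * b (m - k)%N.

Lemma series_cauchy_product a b n : series (cauchy_product a b) n =
  \sum_(0 <= k < n) a k * series b (n - k)%N.
Proof.
have step (c : R^nat) m : series c m.+1 = series c m + c m.
  by rewrite /series /= big_nat_recr.
elim: n => [|n IH]; first by rewrite /series /= !big_geq.
rewrite step IH /cauchy_product !big_nat_recr //= addrA -big_split /=.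
rewrite subnn subSnn; congr (_ + _); last by rewrite step /series /= big_geq // add0r.
apply: eq_big_nat => k /andP[_ kn]; rewrite subSn ?(ltnW kn) //.
by rewrite step mulrDr.
Qed.

Lemma cauchy_product_exp x t :
  cauchy_product (exp_coeff x) (exp_coeff t) = exp_coeff (x + t).
Proof.
apply/funext => m; rewrite /cauchy_product /exp_coeff /= (addrC x) exprDn mulr_suml.
rewrite big_mkord; apply: eq_bigr => -[k km] _ /=; rewrite ltnS in km.
have := bin_fact km => <-; rewrite -mulr_natr !natrM.
have f0 n : n`!%:R != 0 :> R by rewrite pnatr_eq0 -lt0n fact_gt0.
have b0 : 'C(m, k)%:R != 0 :> R by rewrite pnatr_eq0 -lt0n bin_gt0.
by field; rewrite !f0 b0.
Qed.

Lemma cauchy_product_exp_cvg a x t (C l : R) : 0 <= t ->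
  (forall k, `|a k| <= C * exp_coeff x k) -> series a @ \oo --> l ->
  series (cauchy_product a (exp_coeff t)) @ \oo --> l * expR t.
Proof.
move=> t0 aC al; set b := exp_coeff t.
have b0 k : 0 <= b k by exact: exp_coeff_ge0.
pose D (c : R^nat) n := series c n * series b n - series (cauchy_product c b) n.
have DE c n : D c n = \sum_(0 <= k < n) c k * (series b n - series b (n - k)%N).
  rewrite /D series_cauchy_product /series /= mulr_suml -sumrB.
  by apply: eq_bigr => k _; rewrite mulrBr.
have D_le n : `|D a n| <= C * D (exp_coeff x) n.
  rewrite !DE mulr_sumr; apply: le_trans (ler_norm_sum _ _ _) _.
  apply: ler_sum => k _; rewrite normrM mulrA.
  have tail0 : 0 <= series b n - series b (n - k)%N.
    by rewrite sub_series_geq ?leq_subr // sumr_ge0.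
  by rewrite (ger0_norm tail0) ler_wpM2r.
have Dx0 : D (exp_coeff x) @ \oo --> 0.
  rewrite -(subrr (expR (x + t))) {1}expRD; apply: cvgB.
    by apply: cvgM; exact: cvg_exp_series.
  by rewrite cauchy_product_exp; exact: cvg_exp_series.
have Da0 : D a @ \oo --> 0.
  apply/norm_cvg0P; apply: (@squeeze_cvgr _ _ _ _ (cst 0) (fun n => C * D (exp_coeff x) n)).
  - by apply: nearW => n; rewrite normr_ge0 D_le.
  - exact: cvg_cst.
  - by rewrite -(mulr0 C); apply: cvgMr.
have -> : series (cauchy_product a b) = (fun n => series a n * series b n - D a n).
  by apply/funext => n; rewrite /D opprB addrCA subrr addr0.
rewrite -[l * _]subr0; apply: cvgB => //.
by apply: cvgM => //; exact: cvg_exp_series.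
Qed.

End Poisson.

Local Close Scope ring_scope.

Local Close Scope classical_set_scope.

(** * PART Final *)

Local Open Scope classical_set_scope.
Local Open Scope ring_scope.
Local Open Scope complex_scope.

Section RootOfUnity.
Variables (R : realType) (e : nat).
Hypothesis e1 : (1 < e)%N.
Let e0 : (0 < e)%N := ltnW e1.

Definition unit_root : R[i] := cos (2 * theta R e 1) +i* sin (2 * theta R e 1).

Lemma unit_rootX j : unit_root ^+ j = cos (2 * theta R e j) +i* sin (2 * theta R e j).
Proof.
elim: j => [|j IH].
  by rewrite expr0 /theta mulr0 mul0r mulr0 cos0 sin0.
rewrite exprSr IH /unit_root; simpc.
have -> : 2 * theta R e j.+1 = 2 * theta R e j + 2 * theta R e 1.
  by rewrite /theta -[j.+1%:R]natr1; ring.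
by rewrite cosD sinD; congr (_ +i* _); rewrite addrC.
Qed.

Lemma cos_two_theta j : cos (2 * theta R e j) = 1 - 2 * sin (theta R e j) ^+ 2.
Proof. by rewrite [2 * theta _ _ _]mulr_natl cos_mulr2n cos2sin2; ring. Qed.

Lemma unit_root_prim : e.-primitive_root unit_root.
Proof.
rewrite /primitive_root_of_unity e0 /=; apply/forallP => i.
rewrite unity_rootE unit_rootX.
have [->|ne] := eqVneq i.+1 e.
  have -> : 2 * theta R e e = pi *+ 2 by rewrite /theta mulfK ?mulr_natl // pnatr_eq0 -lt0n.
  by rewrite cos2pi sin2pi eqxx.
apply/eqP/negbTE/eqP => -[+ _]; rewrite cos_two_theta => h.
have : 0 < sin (theta R e i.+1) by apply: sin_theta_gt0 => //=; rewrite ltn_neqAle ne ltn_ord.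
move=> /(exprn_gt0 2); lra.
Qed.

Definition kap j : R := 4 * sin (theta R e j) ^+ 2.

Lemma kap_gt0 j : (0 < j < e)%N -> 0 < kap j.
Proof. by move=> je; rewrite /kap mulr_gt0 // exprn_gt0 // sin_theta_gt0. Qed.

Lemma sqrt_kap j : (0 < j < e)%N -> Num.sqrt (kap j) = 2 * sin (theta R e j).
Proof.
move=> je; rewrite /kap (_ : 4 * _ = (2 * sin (theta R e j)) ^+ 2); last by ring.
by rewrite sqrtr_sqr ger0_norm // mulr_ge0 //; apply: ltW; apply: sin_theta_gt0.
Qed.

Lemma kapE j : 2 - unit_root ^+ j - unit_root ^+ (j * e.-1) = (kap j)%:C.
Proof.
have u0 : unit_root ^+ j != 0.
  by apply/eqP => h; have := zetaK e1 unit_root_prim j; rewrite h mul0r => /esym/eqP; rewrite oner_eq0.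
have -> : unit_root ^+ (j * e.-1) = cos (2 * theta R e j) -i* sin (2 * theta R e j).
  apply: (mulfI u0); rewrite (zetaK e1 unit_root_prim) unit_rootX; simpc.
  by rewrite -!expr2 cos2Dsin2 mulrC addNr.
rewrite unit_rootX; simpc; rewrite cos_two_theta /kap; simpc.
by congr (_ +i* _); ring.
Qed.

Definition core_moment n : R :=
  \sum_(la <- level n) #|Std la|%:R ^+ 2 * (psize (ecore e la))%:R.

Definition core_coeff k : R :=
  if k is k'.+1 then (\sum_(1 <= j < e) kap j ^+ k' *
     ('C(k.*2, k)%:R - kap j * 'C(k'.*2, k')%:R)) / 2 * (-1) ^+ k / k`!%:R else 0.

Lemma core_moment_formula n :
  core_moment n = n`!%:R * \sum_(0 <= k < n.+1) 'C(n, k)%:R * core_coeff k.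
Proof.
set om := unit_root; have prim := unit_root_prim.
pose z j : R[i] := om ^+ j; pose w j : R[i] := om ^+ (j * e.-1).
have zw j : z j * w j = 1 by exact: zetaK.
have X2 la : (psize (ecore e la))%:R * 2 = \sum_(1 <= j < e)
   (content_statistic (z j) (w j) la * content_statistic (w j) (z j) la - 1) / (kap j)%:C.
  have [_ no] := ecoreP la e0.
  rewrite mulr_natr (core_size e1 prim no); apply: eq_big_nat => j je.
  rewrite kapE; congr ((_ * _ - _) / _).
    rewrite /content_statistic; congr (_ - _ * _).
    exact: (content_gf_ecore (zw j) (zeta_expe prim j) (zeta_neq1 prim je) la e0).
  rewrite /content_statistic; congr (_ - _ * _).
  have wz : w j * z j = 1 by rewrite mulrC.
  exact: (content_gf_ecore wz (zeta'_expe prim j) (zeta'_neq1 e1 prim je) la e0).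
have sum_sq : \sum_(la <- level n) #|Std la|%:R ^+ 2 = n`!%:R :> R[i].
  have := @second_moment R[i] 1 1 (mulr1 1) n.
  have -> : 2 - 1 - 1 = 0 :> R[i] by ring.
  rewrite [X in _ * (1 + X)]big1 => [|k _]; last by rewrite (exprS 0) mul0r mul0r mulr0.
  rewrite addr0 mulr1 => <-; apply: eq_bigr => la _.
  have -> : content_statistic 1 1 la = 1 :> R[i].
    by rewrite /content_statistic (_ : 2 - 1 - 1 = 0) ?mul0r ?subr0 //; ring.
  by rewrite !mulr1.
apply: (@complexI R); apply: (mulIf (_ : 2 != 0 :> R[i])); first by rewrite pnatr_eq0.
transitivity (\sum_(1 <= j < e) (\sum_(la <- level n) #|Std la|%:R ^+ 2 *
   (content_statistic (z j) (w j) la * content_statistic (w j) (z j) la)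
     - n`!%:R) / (kap j)%:C).
  rewrite /core_moment rmorph_sum mulr_suml /=.
  under [RHS]eq_bigr => j _ do rewrite -sum_sq -sumrB mulr_suml.
  rewrite exchange_big; apply: eq_bigr => la _ /=.
  rewrite rmorphM rmorphXn !rmorph_nat -mulrA X2 mulr_sumr.
  by apply: eq_bigr => j _; rewrite [LHS]mulrA mulrBr mulr1.
under eq_bigr => j _ do rewrite (second_moment (zw j)) kapE mulrDr mulr1 addrC addKr.
have -> : \sum_(0 <= k < n.+1) 'C(n, k)%:R * core_coeff k =
    \sum_(k < n) 'C(n, k.+1)%:R * core_coeff k.+1.
  by rewrite big_mkord big_ord_recl mulr0 add0r; apply: eq_bigr => k _; rewrite lift0.
rewrite rmorphM rmorph_nat rmorph_sum /= -mulrA mulr_suml mulr_sumr.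
under eq_bigr => j _ do rewrite -mulrA mulr_suml mulr_sumr.
rewrite exchange_big /=; apply: eq_bigr => k _.
rewrite -mulr_sumr; congr (_ * _).
rewrite !rmorphM rmorph_nat !fmorphV rmorph_nat !rmorphXn rmorphN1 rmorph_sum.
rewrite rmorph_nat.
have f0 : k.+1`!%:R != 0 :> R[i] by rewrite pnatr_eq0 -lt0n fact_gt0.
transitivity ('C(n, k.+1)%:R * (-1) ^+ k.+1 / k.+1`!%:R * (\sum_(1 <= i < e)
    (kap i ^+ k * ('C(k.+1.*2, k.+1)%:R - kap i * 'C(k.*2, k)%:R))%:C)); last first.
  by move: (\sum_(1 <= i < e) _) => S; field; rewrite f0.
rewrite mulr_sumr; apply: eq_big_nat => j je.
move: (kap j) (kap_gt0 je) => x x_gt0.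
have x0 : x%:C != 0 by rewrite fmorph_eq0 gt_eqF.
rewrite (rmorphM (real_complex R)) (rmorphXn (real_complex R)) (rmorphB (real_complex R)).
rewrite (rmorphM (real_complex R)) !rmorph_nat -[LHS]mulrA; congr (_ * _).
by apply: (mulIf x0); rewrite divfK // (exprS x%:C) -mulrA mulrC.
Qed.

End RootOfUnity.

Local Close Scope complex_scope.

Local Close Scope ring_scope.

Local Close Scope classical_set_scope.

(** * PART Final2 *)

Local Open Scope classical_set_scope.
Local Open Scope ring_scope.

Lemma cvg_sum_seq (R : realType) (I : eqType) (r : seq I) (F : I -> R^nat) (l : I -> R) :
  (forall i, i \in r -> F i @ \oo --> l i) ->
  (fun n => \sum_(i <- r) F i n) @ \oo --> \sum_(i <- r) l i.
Proof.
elim: r => [|i r IH] Fl.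
  rewrite big_nil; under eq_fun do rewrite big_nil.
  exact: cvg_cst.
rewrite big_cons; under eq_fun do rewrite big_cons.
apply: cvgD; first by apply: Fl; rewrite mem_head.
by apply: IH => j jr; apply: Fl; rewrite in_cons jr orbT.
Qed.

Section Expectation.
Variables (R : realType) (e : nat).
Hypothesis e1 : (1 < e)%N.
Let e0 : (0 < e)%N := ltnW e1.
Local Notation kap := (kap R e).

Definition core_mean (t : R) : R := (\sum_(1 <= j < e)
  ((Bfun (t * kap j) - 1) / kap j + Gfun (t * kap j))) / 2.

Definition core_term (t : R) (k : nat) : R := (\sum_(1 <= j < e)
  ((bser (t * kap j) k - (k == 0%N)%:R) / kap j + gser (t * kap j) k)) / 2.

Lemma core_termE t k : core_term t k = t ^+ k / k`!%:R * core_coeff R e k.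
Proof.
rewrite /core_term /core_coeff; case: k => [|k].
  rewrite mulr0 big1 ?mul0r // => j _.
  by rewrite /bser /gser /= !expr0 mul1r bin0 fact0 expr1n divr1 subrr mul0r addr0.
rewrite mulr_suml !mulr_suml mulr_sumr; apply: eq_big_nat => j je.
rewrite /bser /gser subr0; move: (kap j) (kap_gt0 R e1 je) => x x_gt0.
have x0 : x != 0 by rewrite gt_eqF.
have f0 : k.+1`!%:R != 0 :> R by rewrite pnatr_eq0 -lt0n fact_gt0.
rewrite (exprNn (t * x)) [(t * x) ^+ _]exprMn (exprS x).
move: ('C(k.+1.*2, k.+1)%:R) ('C(k.*2, k)%:R) (k.+1`!%:R) f0 => b c f f0.
by field; rewrite x0 f0.
Qed.

Lemma kap_le4 j : 0 <= kap j <= 4.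
Proof.
by rewrite /kap mulr_ge0 ?sqr_ge0 //= ler_piMr // sin2cos2 lerBlDr lerDl sqr_ge0.
Qed.

Lemma core_term_le t k : 0 <= t -> `|core_term t k| <=
  (\sum_(1 <= j < e) (2 / kap j + 1)) / 2 * exp_coeff (64 * t) k.
Proof.
move=> t0; rewrite /core_term normrM [ `|2^-1|]gtr0_norm ?invr_gt0 // mulrAC.
rewrite ler_wpM2r ?invr_ge0 //; apply: le_trans (ler_norm_sum _ _ _) _.
rewrite mulr_suml big_nat_cond [leRHS]big_nat_cond; apply: ler_sum => j /andP[je _].
have k_gt0 := kap_gt0 R e1 je; have /andP[_ k4] := kap_le4 j.
have y0 : 0 <= t * kap j by rewrite mulr_ge0 // ltW.
have mono : exp_coeff (16 * (t * kap j)) k <= exp_coeff (64 * t) k.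
  rewrite /exp_coeff /= ler_wpM2r ?invr_ge0 //.
  apply: lerXn2r; [by rewrite nnegrE mulr_ge0|by rewrite nnegrE mulr_ge0|].
  have -> : 64 * t = 16 * (t * 4) by ring.
  by rewrite !ler_wpM2l.
have hb := le_trans (bser_le k y0) mono; have hg := le_trans (gser_le k y0) mono.
have h1 : (k == 0%N)%:R <= exp_coeff (64 * t) k.
  by case: k {hb hg mono} => [|k] /=; rewrite /exp_coeff /= ?expr0 ?fact0 ?divr1 // divr_ge0 ?exprn_ge0 ?mulr_ge0.
apply: le_trans (ler_normD _ _) _; rewrite [leRHS]mulrDl mul1r; apply: lerD => //.
rewrite normrM [ `|_^-1|]gtr0_norm ?invr_gt0 // mulrAC ler_wpM2r ?invr_ge0 ?(ltW k_gt0) //.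
have h2 : `|(k == 0%N)%:R : R| <= exp_coeff (64 * t) k by rewrite ger0_norm.
by apply: le_trans (ler_normB _ _) _; apply: le_trans (lerD hb h2) _; lra.
Qed.

Lemma cvg_core_term t : 0 <= t -> series (core_term t) @ \oo --> core_mean t.
Proof.
move=> t0.
have -> : series (core_term t) = (fun n => (\sum_(1 <= j < e)
    ((series (bser (t * kap j)) n - (n != 0%N)%:R) / kap j + series (gser (t * kap j)) n)) / 2).
  apply/funext => n; rewrite /series /= /core_term -mulr_suml exchange_big /=.
  congr (_ / _); apply: eq_bigr => j _; rewrite big_split /= -mulr_suml sumrB.
  congr ((_ - _) / _ + _); case: n => [|n]; first by rewrite big_geq.
  by rewrite big_nat_recl //= big1 ?addr0.
apply: cvgMl; apply: cvg_sum_seq => j; rewrite mem_index_iota => je.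
have y0 : 0 <= t * kap j by rewrite mulr_ge0 // ltW // kap_gt0.
apply: cvgD; last exact: cvg_Gfun.
apply: cvgMl; apply: cvgB; first exact: cvg_Bfun.
apply: cvg_near_cst; exists 1%N => //= n; rewrite /= lt0n => n0.
by rewrite n0.
Qed.

Lemma cvg_core_mean t : 0 <= t ->
  series (fun n => expR (- t) * t ^+ n / n`!%:R ^+ 2 * core_moment R e n) @ \oo
  --> core_mean t.
Proof.
move=> t0.
have -> : (fun n => expR (- t) * t ^+ n / n`!%:R ^+ 2 * core_moment R e n) =
  (fun n => expR (- t) * cauchy_product (core_term t) (exp_coeff t) n).
  apply/funext => n; rewrite core_moment_formula // /cauchy_product.
  rewrite -!mulrA; congr (_ * _); rewrite !mulrA mulr_sumr; apply: eq_big_nat => k /andP[_].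
  rewrite ltnS => kn; rewrite core_termE /exp_coeff /=.
  rewrite -(bin_fact kn) !natrM -{1}(subnKC kn) exprD.
  have f0 m : m`!%:R != 0 :> R by rewrite pnatr_eq0 -lt0n fact_gt0.
  have b0 : 'C(n, k)%:R != 0 :> R by rewrite pnatr_eq0 -lt0n bin_gt0.
  by field; rewrite !f0 b0.
have -> : series (fun n => expR (- t) * cauchy_product (core_term t) (exp_coeff t) n) =
  (fun n => expR (- t) * series (cauchy_product (core_term t) (exp_coeff t)) n).
  by apply/funext => n; rewrite /series /= mulr_sumr.
have -> : core_mean t = expR (- t) * (core_mean t * expR t).
  by rewrite mulrCA -expRD addNr expR0 mulr1.
apply: cvgMr; apply: cauchy_product_exp_cvg (cvg_core_term t0) => //.
by move=> k; exact: core_term_le.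
Qed.

Lemma esum_by_level (f : partition -> R) (l : R) : (forall la, 0 <= f la) ->
  series (fun n => \sum_(la <- level n) f la) @ \oo --> l ->
  (\esum_(la in [set: partition]) (f la)%:E = l%:E)%E.
Proof.
move=> f0 fl; pose J n := [set la : partition | psize la = n].
have -> : [set: partition] = \bigcup_(n in setT) J n.
  by apply/seteqP; split => // la _; exists (psize la).
rewrite esum_bigcupT; last 2 first.
- by move=> i j _ _ [la [/= <- <-]].
- by move=> la; rewrite lee_fin.
have level_sum n : (\esum_(la in J n) (f la)%:E = (\sum_(la <- level n) f la)%:E)%E.
  have JE : J n = [set` [fset la in level n]%fset].
    by apply/seteqP; split => la; rewrite /J /= !inE mem_level => /eqP.
  rewrite JE esum_fset //; last by move=> la _; rewrite lee_fin.
  rewrite fsbig_finite // set_fsetK sumEFin; congr (_%:E).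
  apply: perm_big; apply: uniq_perm; [exact: fset_uniq|exact: level_uniq|].
  by move=> la; rewrite !inE.
under eq_esum => n _ do rewrite level_sum.
rewrite -nneseries_esumT; last by move=> n; rewrite lee_fin sumr_ge0.
apply/cvg_lim => //.
have -> : (fun n => \sum_(0 <= k < n) (\sum_(la <- level k) f la)%:E)%E =
   EFin \o series (fun n => \sum_(la <- level n) f la).
  by apply/funext => n /=; rewrite -sumEFin.
exact: cvg_comp fl _.
Qed.

Lemma expectation_ecore t : 0 <= t ->
  plancherel_expectation t (fun la => psize (ecore e la)) = (core_mean t)%:E.
Proof.
move=> t0; rewrite /plancherel_expectation; apply: esum_by_level.
  move=> la; rewrite mulr_ge0 // /plancherel mulr_ge0 ?sqr_ge0 //.
  by rewrite mulr_ge0 ?expR_ge0 // exprn_ge0.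
rewrite (_ : (fun n => _) = fun n => expR (- t) * t ^+ n / n`!%:R ^+ 2 * core_moment R e n).
  exact: cvg_core_mean.
apply/funext => n; rewrite /core_moment mulr_sumr big_seq [RHS]big_seq.
apply: eq_bigr => la; rewrite mem_level => /eqP la_n.
rewrite /plancherel; move: (#|Std la|) => d; rewrite la_n exprMn exprVn; ring.
Qed.

End Expectation.

Local Close Scope ring_scope.

Local Close Scope classical_set_scope.

(** * PART Final3 *)

Local Open Scope classical_set_scope.
Local Open Scope ring_scope.

Lemma ratio_close (R : realFieldType) (m s p c eps a q : R) :
  0 < s -> 0 < p -> 0 < c -> 0 < eps -> 0 < q ->
  12 * p / q <= eps / 2 -> a * p / (eps * c) <= s ->
  `|m - 2 * s / p * c| <= a + 24 * c * s / q -> `|1 - m * (2 * s / p * c)^-1| <= eps.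
Proof.
move=> s0 p0 c0 eps0 q0 q_eps; rewrite ler_pdivrMr ?mulr_gt0 ?invr_gt0 // => a_s bd.
have M0 : 0 < 2 * s / p * c by rewrite !mulr_gt0 ?invr_gt0.
have -> : 1 - m * (2 * s / p * c)^-1 = - (m - 2 * s / p * c) / (2 * s / p * c).
  by rewrite opprB mulrBl divff // gt_eqF.
rewrite normrM normrN [ `|_^-1|]gtr0_norm ?invr_gt0 // ler_pdivrMr //.
apply: le_trans bd _.
have -> : eps * (2 * s / p * c) =
    s * (eps * c) / p + eps / 2 * (2 * s / p * c).
  by field; rewrite gt_eqF.
apply: lerD; first by rewrite ler_pdivlMr.
apply: le_trans (ler_wpM2r (ltW M0) q_eps).
rewrite le_eqVlt; apply/orP; left; apply/eqP.
by field; rewrite !gt_eqF.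
Qed.

Section Asymptotics.
Variables (R : realType) (e : nat).
Hypothesis e1 : (1 < e)%N.
Local Notation kap := (kap R e).
Local Notation C := (cot (pi / (2 * e%:R)) : R).

Lemma theta0 : theta R e 0 = 0.
Proof. by rewrite /theta mulr0 mul0r. Qed.

Lemma sum_sqrt_kap : \sum_(1 <= j < e) Num.sqrt (kap j) = 2 * C.
Proof.
rewrite /cot -(sum_sin_theta R (ltnW e1)) [in RHS]big_ltn ?(ltnW e1) //.
rewrite theta0 sin0 add0r mulr_sumr.
by apply: eq_big_nat => j je; rewrite (sqrt_kap R e1 je).
Qed.

Lemma sum_sqrt_mul_kap t : 0 <= t ->
  \sum_(1 <= j < e) Num.sqrt (t * kap j) = 2 * Num.sqrt t * C.
Proof.
move=> t0; under eq_bigr => j _ do rewrite sqrtrM //.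
by rewrite -mulr_sumr sum_sqrt_kap mulrA [_ * 2]mulrC.
Qed.

Lemma cot_gt0 : 0 < C.
Proof.
have : 0 < \sum_(1 <= j < e) Num.sqrt (kap j).
  rewrite big_ltn //; apply: ltr_wpDr; last by rewrite sqrtr_gt0 kap_gt0.
  by apply: sumr_ge0 => j _; exact: sqrtr_ge0.
by rewrite sum_sqrt_kap pmulr_rgt0.
Qed.

Definition core_mean_const q : R :=
  (\sum_(1 <= j < e) (2 / kap j + (2 + far_const R q) / 4)) / 2.

Lemma core_mean_bound q t : (4 <= q)%N -> 0 <= t ->
  `|core_mean e t - 2 * Num.sqrt t / pi * C| <=
  core_mean_const q + 24 * C * Num.sqrt t / q%:R.
Proof.
move=> q4 t0.
have -> : core_mean e t - 2 * Num.sqrt t / pi * C = (\sum_(1 <= j < e)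
    ((Bfun (t * kap j) - 1) / kap j + (Gfun (t * kap j) - 2 / pi * Num.sqrt (t * kap j)))) / 2.
  rewrite /core_mean; under [in RHS]eq_bigr => j _ do rewrite addrA.
  rewrite sumrB -mulr_sumr sum_sqrt_mul_kap //.
  by move: (\sum_(_ <= _ < _) _) (pi^-1) => x p; field.
have -> : core_mean_const q + 24 * C * Num.sqrt t / q%:R = (\sum_(1 <= j < e)
    (2 / kap j + ((2 + far_const R q) / 4 + 24 * Num.sqrt (t * kap j) / q%:R))) / 2.
  rewrite /core_mean_const; under [in RHS]eq_bigr => j _ do rewrite addrA.
  rewrite [in RHS]big_split /= -mulr_suml -mulr_sumr sum_sqrt_mul_kap //.
  by move: (\sum_(_ <= _ < _) _) (q%:R^-1) => x p; field.
rewrite normrM [ `|2^-1|]gtr0_norm ?invr_gt0 // ler_wpM2r ?invr_ge0 //.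
apply: le_trans (ler_norm_sum _ _ _) _; rewrite big_nat_cond [leRHS]big_nat_cond.
apply: ler_sum => j /andP[je _]; have k_gt0 := kap_gt0 R e1 je.
have y0 : 0 <= t * kap j by rewrite mulr_ge0 // ltW.
apply: le_trans (ler_normD _ _) _; apply: lerD; last exact: Gfun_bound.
rewrite normrM [ `|_^-1|]gtr0_norm ?invr_gt0 // ler_wpM2r ?invr_ge0 ?(ltW k_gt0) //.
apply: le_trans (ler_normB _ _) _; rewrite normr1 (_ : 2 = 1 + 1 :> R) //.
by rewrite lerD // Bfun_bound.
Qed.

Lemma core_mean_asymp :
  core_mean e t * (2 * Num.sqrt t / pi * C)^-1 @[t --> +oo] --> (1 : R).
Proof.
apply/cvgrPdist_le => eps eps0.
have C0 := cot_gt0; have pi0 := pi_gt0 R.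
(* two error terms, 12 pi / q and a multiple of the inverse square root of t *)
pose q := (maxn 4 (Num.truncn (24 * pi / eps)).+1)%N.
have q4 : (4 <= q)%N by rewrite leq_maxl.
have q_gt0 : 0 < q%:R :> R by rewrite ltr0n (leq_trans _ q4).
have q_eps : 12 * pi / q%:R <= eps / 2.
  have : 24 * pi / eps <= q%:R.
    by rewrite (le_trans (ltW (truncnS_gt _))) // ler_nat leq_maxr.
  rewrite !ler_pdivrMr // => h.
  by move: (pi : R) (q%:R : R) (eps : R) h => p x y h; lra.
have A0 : 0 <= core_mean_const q.
  have := core_mean_bound q4 (lexx 0); rewrite sqrtr0 !mulr0 !mul0r addr0.
  exact: le_trans (normr_ge0 _).
pose B := core_mean_const q * pi / (eps * C).
have B0 : 0 <= B by rewrite /B; apply: divr_ge0; apply: mulr_ge0 => //; exact: ltW.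
near=> t.
have t_gt0 : 0 < t by near: t; exact: nbhs_pinfty_gt.
have s_gt0 : 0 < Num.sqrt t by rewrite sqrtr_gt0.
have Bs : B <= Num.sqrt t.
  rewrite -[B]ger0_norm // -sqrtr_sqr (ler_sqrt _ (ltW t_gt0)).
  by near: t; apply: nbhs_pinfty_ge; rewrite num_real.
exact: ratio_close s_gt0 pi0 C0 eps0 q_gt0 q_eps Bs (core_mean_bound q4 (ltW t_gt0)).
Unshelve. all: by end_near. Qed.

End Asymptotics.

Theorem proposition5p1 (R : realType) (e : nat) (he : (2 <= e)%N) :
  (plancherel_expectation t (fun la => psize (ecore e la))
     * ((2 * Num.sqrt t / pi * cot (pi / (2 * e%:R)))^-1)%:E)%E
    @[t --> +oo] --> (1 : R)%:E.
Proof.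
have limit : (core_mean e t * (2 * Num.sqrt t / pi * cot (pi / (2 * e%:R)))^-1)%:E
    @[t --> +oo] --> (1 : R)%:E by apply: cvg_EFin; [exact: nearW|exact: core_mean_asymp].
apply: cvg_trans limit.
apply: near_eq_cvg; near=> t.
have t0 : 0 <= t by near: t; exact: nbhs_pinfty_ge.
by rewrite expectation_ecore // -EFinM.
Unshelve. all: by end_near. Qed.
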